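(* There is a bounded operator on a subspace of Gowers unconditional space $X_U$ which is not a strictly singular perturbation of a restriction of a diagonal operator on $X_U$. That is, there are a closed subspace $W\subset X_U$ and a bounded operator $T:W\to X_U$ such that $T$ is not of the form $T=D|_W+S$ with $D:X_U\to X_U$ a bounded diagonal operator and $S:W\to X_U$ a bounded strictly singular operator.
   Context: Definition of Gowers unconditional space $X_U$. Let $c_{00}$ be the space of finitely supported real sequences with unit vectors $(e_i)$, and $f(x)=\log_2(x+1)$. For $x=\sum_i x_ie_i$, $\operatorname{supp}x=\{i:x_i\neq0\}$, and for $E\subset\mathbb{N}$, $Ex=\sum_{i\in E}x_ie_i$; write $E<F$ if $\max E<\min F$, and $x<y$ if $\operatorname{supp}x<\operatorname{supp}y$ (such vectors are called successive). Fix an infinite set $J=\{j_1<j_2<\dots\}\subset\mathbb{N}$ with $f(j_1)>256$ and $\log\log\log n\geq4m^2$ for all $m<n$ in $J$; let $K=\{j_1,j_3,j_5,\dots\}$ and $L=\{j_2,j_4,\dots\}$. Let $\mathbf{Q}$ be the set of elements of $c_{00}$ with rational coordinates of modulus at most $1$. Fix an injection $\sigma$ (coding function) from the set of finite sequences of successive elements of $\mathbf{Q}$ into $L$ such that if $S=\sigma(z_1,\dots,z_s)$ then $\frac1{20}f(S^{1/40})^{1/2}$ is at least the number of integers in the smallest interval containing $\operatorname{supp}(z_1+\dots+z_s)$. Given a norm $\|\cdot\|'$ on $c_{00}$, let $A^*_m(\|\cdot\|')$ be the set of $x^*=\frac1{f(m)}(x_1^*+\dots+x_m^* )$ with $x_1^*<\dots<x_m^*$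 in $c_{00}$ of dual norm at most $1$ (elements of $c_{00}$ acting on $c_{00}$ by the usual pairing). A special functional of length $k$ is a functional $\frac1{\sqrt{f(k)}}\sum_{j=1}^kx_j^*$, where $x_1^*<\dots<x_k^*$ belong to $\mathbf{Q}$, $x_1^*\in A^*_{j_{2k}}(\|\cdot\|')$ and $x_{j+1}^*\in A^*_{n_{j+1}}(\|\cdot\|')$ with $n_{j+1}=\sigma(|x_1^*|,\dots,|x_j^*|)$ for $j=1,\dots,k-1$ (moduli taken coordinatewise). Put $\|x\|_0=\|x\|_\infty$ and $$\|x\|_{N+1}=\max\Big\{\|x\|_\infty,\ \sup_n\tfrac1{f(n)}\sup\big\{\sum_{i=1}^n\|E_ix\|_N:E_1<\dots<E_n\big\},\ \sup\{|x^*(x)|:x^*\text{ special functional of length }k\text{ with respect to }\|\cdot\|_N,\ k\in K\}\Big\}.$$ These norms increase to a norm $\|\cdot\|$ on $c_{00}$, and $X_U$ is the completion of $(c_{00},\|\cdot\|)$; $(e_i)$ is a 1-unconditional basis of $X_U$. Other conventions. A diagonal operator on $X_U$ is an operator $D$ with $De_i=\lambda_ie_i$ for all $i$, for some scalars $(\lambda_i)$. A bounded operator is strictly singular if none of its restrictions to an infinite dimensional closed subspace is an isomorphism onto its image. *)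

(* Defs.v *)
From HB Require Import structures.
From mathcomp Require Import all_boot all_order all_algebra.
From mathcomp Require Import finmap.
From mathcomp Require Import all_classical all_reals all_analysis.
Set Implicit Arguments.
Unset Strict Implicit.
Unset Printing Implicit Defensive.
Import Order.TTheory GRing.Theory Num.Theory.
Import numFieldNormedType.Exports.
Local Open Scope classical_set_scope.
Local Open Scope ring_scope.

(** * Finitely supported sequences *)

(* Vectors of c_00 are functions [nat -> R] in the set [c00]; coordinates are
   indexed from 0. *)
Definition supp (R : realType) (x : nat -> R) : set nat := [set i | x i != 0].

Definition c00 (R : realType) : set (nat -> R) :=
  [set x | finite_set (supp x)].

Definition unit_vec (R : realType) (i : nat) : nat -> R :=
  fun n => (n == i)%:R.

Definition proj (R : realType) (E : set nat) (x : nat -> R) : nat -> R :=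
  fun i => if i \in E then x i else 0.

Definition vabs (R : realType) (x : nat -> R) : nat -> R := fun i => `|x i|.

(* [fsbig] sum: a finite sum as soon as x or y is in c_00. *)
Definition pairing (R : realType) (x y : nat -> R) : R :=
  \sum_(i \in [set: nat]) x i * y i.

(* max E < min F; in particular E has a maximum and F a minimum, so that
   neither set is empty. *)
Definition set_lt (E F : set nat) : Prop :=
  [/\ E !=set0, F !=set0 & forall i j, E i -> F j -> (i < j)%N].

(* E_0 < ... < E_(m-1); the values E_i for i >= m are not used. *)
Definition successive_sets (m : nat) (E : nat -> set nat) : Prop :=
  forall i i', (i < i')%N -> (i' < m)%N -> set_lt (E i) (E i').

Definition successive (R : realType) (m : nat) (x : nat -> nat -> R) : Prop :=
  successive_sets m (fun i => supp (x i)).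

(* The smallest interval of integers containing A. *)
Definition interval_hull (A : set nat) : set nat :=
  [set n | exists a b, [/\ A a, A b & (a <= n <= b)%N]].

(** * Parameters of the construction *)

Definition f (R : realType) (x : R) : R := ln (x + 1) / ln 2.

(* A sequence [j] stands for {j_1 < j_2 < ...}; the value [j 0] is not used. *)
Definition Jset (j : nat -> nat) : set nat := [set j i | i in [set i | (0 < i)%N]].
Definition Kset (j : nat -> nat) : set nat := [set j i | i in [set i | odd i]].
Definition Lset (j : nat -> nat) : set nat :=
  [set j i | i in [set i | (0 < i)%N && ~~ odd i]].

Definition admissible (R : realType) (j : nat -> nat) : Prop :=
  [/\ forall i i', (0 < i)%N -> (i < i')%N -> (j i < j i')%N,
      256 < f ((j 1)%:R : R) &
      forall m n, Jset j m -> Jset j n -> (m < n)%N ->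
        4 * (m%:R : R) ^+ 2 <= ln (ln (ln n%:R))].

Definition Qset (R : realType) : set (nat -> R) :=
  [set x | c00 x /\ forall i, (exists q : rat, x i = ratr q) /\ `|x i| <= 1].

(* Nonempty finite sequences of successive elements of Q. *)
Definition Qseqs (R : realType) : set (seq (nat -> R)) :=
  [set z | [/\ (0 < size z)%N,
               forall i, (i < size z)%N -> Qset (nth 0 z i) &
               successive (size z) (nth 0 z)]].

Definition coding_function (R : realType) (j : nat -> nat)
    (sigma : seq (nat -> R) -> nat) : Prop :=
  [/\ forall z, Qseqs z -> Lset j (sigma z),
      forall z z', Qseqs z -> Qseqs z' -> sigma z = sigma z' -> z = z' &
      forall z, Qseqs z ->
        (#|` fset_set (interval_hull (supp (\sum_(x <- z) x)))|%fset)%:R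
          <= 20^-1 * Num.sqrt (f ((sigma z)%:R `^ (40^-1 : R)))].

(** * The norm *)

(* The norms take values in the extended reals so that no supremum has to be
   shown finite in order to be meaningful. *)

Definition sup_norm (R : realType) (x : nat -> R) : \bar R :=
  ereal_sup [set `|x i|%:E | i in [set: nat]].

Definition dual_norm (R : realType) (nrm : (nat -> R) -> \bar R)
    (u : nat -> R) : \bar R :=
  ereal_sup [set `|pairing u y|%:E | y in [set y | c00 y /\ (nrm y <= 1)%E]].

Definition Astar (R : realType) (nrm : (nat -> R) -> \bar R) (m : nat) :
    set (nat -> R) :=
  [set u | exists x : nat -> nat -> R,
     [/\ forall i, (i < m)%N -> c00 (x i) /\ (dual_norm nrm (x i) <= 1)%E,
         successive m x &
         u = (f (m%:R : R))^-1 *: \sum_(i < m) x i]].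

(* [x i] is the functional x^*_(i+1). *)
Definition special_functional (R : realType) (j : nat -> nat)
    (sigma : seq (nat -> R) -> nat) (nrm : (nat -> R) -> \bar R) (k : nat) :
    set (nat -> R) :=
  [set u | exists x : nat -> nat -> R,
     [/\ [/\ forall i, (i < k)%N -> Qset (x i),
             successive k x,
             Astar nrm (j (2 * k)%N) (x 0%N) &
             forall i, (i.+1 < k)%N ->
               Astar nrm (sigma (mkseq (fun l => vabs (x l)) i.+1)) (x i.+1)] &
         u = (Num.sqrt (f (k%:R : R)))^-1 *: \sum_(i < k) x i]].

Definition next_norm (R : realType) (j : nat -> nat)
    (sigma : seq (nat -> R) -> nat) (nrm : (nat -> R) -> \bar R)
    (x : nat -> R) : \bar R :=
  maxe (sup_norm x)
    (maxe
      (ereal_sup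
        [set ((f (n%:R : R))^-1%:E *
              ereal_sup [set (\sum_(i < n) nrm (proj (E i) x))%E
                        | E in [set E | successive_sets n E]])%E
        | n in [set n | (0 < n)%N]])
      (ereal_sup
        [set a | exists k u, [/\ Kset j k, special_functional j sigma nrm k u &
                                 a = `|pairing u x|%:E]])).

Fixpoint gowers_norm_approx (R : realType) (j : nat -> nat)
    (sigma : seq (nat -> R) -> nat) (N : nat) : (nat -> R) -> \bar R :=
  if N is N'.+1 then next_norm j sigma (gowers_norm_approx j sigma N')
  else @sup_norm R.

Definition gowers_norm (R : realType) (j : nat -> nat)
    (sigma : seq (nat -> R) -> nat) (x : nat -> R) : \bar R :=
  ereal_sup [set gowers_norm_approx j sigma N x | N in [set: nat]].

(* [X] is the completion of (c_00, nrm) through the embedding [iota], of which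
   only the values on c_00 are used. *)
Definition is_completion (R : realType) (nrm : (nat -> R) -> \bar R)
    (X : completeNormedModType R) (iota : (nat -> R) -> X) : Prop :=
  [/\ forall (a : R) x y, c00 x -> c00 y ->
        iota (a *: x + y) = a *: iota x + iota y,
      forall x, c00 x -> `|iota x|%:E = nrm x &
      closure (iota @` @c00 R) = [set: X]].

(** * Operators on subspaces *)

Definition subspace_of (R : realType) (X : normedModType R) (V : set X) : Prop :=
  V 0 /\ forall (a : R) x y, V x -> V y -> V (a *: x + y).

(* Bounded linear operators V -> X are functions [X -> X] whose values outside
   V are not used. *)
Definition bounded_operator (R : realType) (X : normedModType R) (V : set X)
    (T : X -> X) : Prop :=
  (forall (a : R) x y, V x -> V y -> T (a *: x + y) = a *: T x + T y) /\
  exists C : R, forall x, V x -> `|T x| <= C * `|x|.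

Definition finite_dimensional (R : realType) (X : normedModType R)
    (V : set X) : Prop :=
  exists (n : nat) (v : 'I_n -> X),
    V = [set \sum_(i < n) a i *: v i | a in [set: 'I_n -> R]].

Definition isomorphism_onto_image (R : realType) (X : normedModType R)
    (V : set X) (T : X -> X) : Prop :=
  bounded_operator V T /\
  exists U : X -> X, bounded_operator (T @` V) U /\
    forall x, V x -> U (T x) = x.

Definition strictly_singular (R : realType) (X : normedModType R) (W : set X)
    (S : X -> X) : Prop :=
  forall V : set X, V `<=` W -> subspace_of V -> closed V ->
    ~ finite_dimensional V -> ~ isomorphism_onto_image V S.

Definition diagonal_operator (R : realType) (X : completeNormedModType R)
    (iota : (nat -> R) -> X) (D : X -> X) : Prop :=
  bounded_operator [set: X] D /\
  exists lambda : nat -> R,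
    forall i, D (iota (unit_vec R i)) = lambda i *: iota (unit_vec R i).

(* Main.v *)
From HB Require Import structures.
From mathcomp Require Import all_boot all_order all_algebra.
From mathcomp Require Import finmap.
From mathcomp Require Import all_classical all_reals all_analysis.
From mathcomp Require Import ring lra.
Require Import Defs.

(** The subspace W is the closed span of vectors w (n, k), k < K_n, whose supports
    lie in successive intervals I_n; the operator T multiplies each w (n, k) by a
    sign.

    T is bounded. For fixed n the w (n, k) are combinations of successive vectors
    u_x equivalent to the basis of a finite-dimensional l1 ([james]), with the
    coefficients of the array of [design]. Its entries behave like independent
    heavy-tailed variables: a combination is dominated at most points x by one
    single term, so that changing the signs of the terms is nearly the same as
    multiplying the combination by a function of x of modulus 1. As the basis of
    the space is unconditional, the norm is hardly affected ([signed_vec_le]).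

    T is far from every diagonal operator. The array has positive and negative
    indices whose entries have a large common part. Given a diagonal operator with
    scalars la i, the set where la i < 0, or its complement, carries a
    substantial part of that common part; so for each n there are a vector
    w_n = w (n, k_n) with sign s_n and a set Z_n on which |s_n - la i| >= 1, such
    that the wrong part a_n = Z_n w_n has norm at least 1/16 ([package],
    [wrong_choice]). Let b_n = w_n - a_n be the right part. If S = T - D, the
    coordinates of S applied to a combination of the w_n dominate those of the same
    combination of the a_n. Hence S is bounded below on the combinations for which
    the right part is no larger than the wrong part.

    Such combinations exist ([a_dominates_b]), and this is where the coding of the
    space is used. A special sequence of functionals of length k can be built on
    the supports of the wrong parts alone ([special_sequence]). The corresponding
    combination of k long averages is normed by it on the wrong parts, where the
    norm becomes of order k / sqrt (f k). It vanishes on the right parts, and every other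
    special functional of length k has indices which, the coding function being injective,
    do not match those of the averages ([special_match]); the norm is
    then governed by the lower f-estimate and of order k / f k, by an estimate for
    sums of successive vectors in the style of Gowers and Maurey
    ([upper_estimate]). The ratio tends to 0 as k grows in K.

    A sequence of such combinations with summable right parts spans a subspace on
    which S is bounded below ([coef_le], [b_part_le]); therefore S is not strictly
    singular. *)

Set Implicit Arguments.
Unset Strict Implicit.
Unset Printing Implicit Defensive.
Import Order.TTheory GRing.Theory Num.Theory.
Import numFieldNormedType.Exports.
Local Open Scope classical_set_scope.
Local Open Scope ring_scope.

(** * Means over finite probability spaces *)
Section FiniteMean.
Variable R : realType.

Definition mean (T : finType) (F : T -> R) : R := (#|T|%:R)^-1 * \sum_x F x.

Lemma meanD (T : finType) (F G : T -> R) :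
  mean (fun x => F x + G x) = mean F + mean G.
Proof. by rewrite /mean big_split mulrDr. Qed.

Lemma meanZ (T : finType) (a : R) (F : T -> R) :
  mean (fun x => a * F x) = a * mean F.
Proof. by rewrite /mean -mulr_sumr mulrCA. Qed.

Lemma mean_sum (T : finType) (I : Type) (r : seq I) (P : pred I)
    (F : I -> T -> R) :
  mean (fun x => \sum_(i <- r | P i) F i x) = \sum_(i <- r | P i) mean (F i).
Proof. by rewrite /mean exchange_big /= mulr_sumr. Qed.

Lemma eq_mean (T : finType) (F G : T -> R) : F =1 G -> mean F = mean G.
Proof. by move=> FG; rewrite /mean (eq_bigr G) // => x _; exact: FG. Qed.

Lemma ler_mean (T : finType) (F G : T -> R) :
  (forall x, F x <= G x) -> mean F <= mean G.
Proof. by move=> FG; rewrite ler_wpM2l ?invr_ge0 ?ler0n// ler_sum. Qed.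

Lemma mean_ge0 (T : finType) (F : T -> R) : (forall x, 0 <= F x) -> 0 <= mean F.
Proof. by move=> F0; rewrite mulr_ge0 ?invr_ge0 ?ler0n ?sumr_ge0. Qed.

Lemma mean_cst (T : finType) (c : R) : (0 < #|T|)%N -> mean (fun _ : T => c) = c.
Proof.
move=> T0; rewrite /mean sumr_const -[c *+ _]mulr_natl mulrA mulVf ?mul1r//.
by rewrite pnatr_eq0 -lt0n.
Qed.

Lemma mean_prod (I : finType) (K : nat) (F : 'I_K -> I -> R) :
  mean (fun h : {ffun 'I_K -> I} => \prod_k F k (h k)) = \prod_k mean (F k).
Proof.
rewrite /mean big_split /= bigA_distr_bigA /=; congr (_ * _).
by rewrite prodr_const card_ord card_ffun card_ord natrX exprVn.
Qed.

Variable I : finType.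
Hypothesis I_gt0 : (0 < #|I|)%N.

Lemma mean_coord (K : nat) (k : 'I_K) (F : I -> R) :
  mean (fun h : {ffun 'I_K -> I} => F (h k)) = mean F.
Proof.
pose G l := if l == k then F else fun=> 1.
have := mean_prod G; rewrite (bigD1 k) //= big1 ?mulr1; last first.
  by move=> l lk; rewrite /G (negPf lk) mean_cst.
rewrite /G eqxx => <-; apply: eq_mean => h.
by rewrite (bigD1 k) //= eqxx big1 ?mulr1// => l /negPf ->.
Qed.

Lemma mean_coord2 (K : nat) (k l : 'I_K) (F G : I -> R) : k != l ->
  mean (fun h : {ffun 'I_K -> I} => F (h k) * G (h l)) = mean F * mean G.
Proof.
move=> kl; pose H i := if i == k then F else if i == l then G else fun=> 1.
have lk : l != k by rewrite eq_sym.
have := mean_prod H; rewrite (bigD1 k) //= (bigD1 l) //= big1 ?mulr1; last first.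
  by move=> i /andP[ik il]; rewrite /H (negPf ik) (negPf il) mean_cst.
rewrite /H /= eqxx (negPf lk) eqxx => <-; apply: eq_mean => h.
rewrite (bigD1 k) //= eqxx; congr (_ * _).
rewrite (bigD1 l) //= (negPf lk) eqxx big1 ?mulr1//.
by move=> i /andP[/negPf -> /negPf ->].
Qed.

(** Distinct coordinates are independent, so the cross terms vanish. *)
Lemma mean_sqr_sum (K : nat) (F : 'I_K -> I -> R) :
    (forall k l, k != l -> mean (F k) * mean (F l) = 0) ->
  mean (fun h : {ffun 'I_K -> I} => (\sum_k F k (h k)) ^+ 2)
    = \sum_k mean (fun i => F k i ^+ 2).
Proof.
move=> F0.
transitivity (mean (fun h : {ffun 'I_K -> I} => \sum_k \sum_l F k (h k) * F l (h l))).
  by apply: eq_mean => h; rewrite expr2 mulr_suml; apply: eq_bigr => k _;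
     rewrite mulr_sumr.
rewrite mean_sum; apply: eq_bigr => k _; rewrite mean_sum (bigD1 k) //= big1 ?addr0.
  by rewrite (mean_coord k (fun i => F k i * F k i)).
by move=> l lk; rewrite mean_coord2 1?eq_sym// F0// eq_sym.
Qed.

(** Averaging |F| <= t / 2 + F^2 / (2 t): a first moment is traded for a second
    one, at a scale t still to be chosen. *)
Lemma mean_abs_le (T : finType) (t : R) (F : T -> R) : (0 < #|T|)%N -> 0 < t ->
  mean (fun x => `|F x|) <= t / 2 + mean (fun x => F x ^+ 2) / (2 * t).
Proof.
move=> T0 t0; rewrite -{1}(mean_cst (t / 2) T0) [X in _ <= _ + X]mulrC -meanZ -meanD.
apply: ler_mean => x; rewrite -[F x ^+ 2]real_normK ?num_real//.
set y := `|F x|; rewrite -subr_ge0.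
have -> : t / 2 + (2 * t)^-1 * y ^+ 2 - y = (y - t) ^+ 2 / (2 * t).
  by field; rewrite gt_eqF.
by rewrite divr_ge0 ?sqr_ge0//; lra.
Qed.

End FiniteMean.

(** * Heavy-tailed variables and the one big jump *)
Section Harmonic.
Variable R : realType.

Definition harm (M : nat) : R := \sum_(u < M) u.+1%:R^-1.

Lemma harm_pow2 (r : nat) : r%:R / 2 <= harm (2 ^ r).
Proof.
elim: r => [|r IH]; first by rewrite mul0r sumr_ge0.
rewrite expnS mul2n -addnn /harm big_split_ord /=.
rewrite -natr1 mulrDl lerD// mul1r.
have p0 : (0 : R) < (2 ^ r)%:R by rewrite ltr0n expn_gt0.
have : (2 ^ r)%:R * ((2 ^ r)%:R *+ 2)^-1 <= \sum_(i < 2 ^ r) (2 ^ r + i).+1%:R^-1 :> R.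
  rewrite mulr_natl -[X in _ *+ X]card_ord -sumr_const ler_sum// => i _.
  by rewrite lef_pV2 ?posrE ?ltr0n// -?mulrnA ?mulrn_wgt0// ler_nat muln2 -addnn -addnS leq_add2l.
set p := (2 ^ r)%:R in p0 *; have -> : p * (p *+ 2)^-1 = 1 / 2.
  by rewrite -mulr_natr; field; rewrite gt_eqF.
by rewrite div1r.
Qed.

Lemma harm_unbounded (B : R) : exists2 M, (0 < M)%N & B <= harm M.
Proof.
exists (2 ^ (Num.truncn (2 * `|B|)).+1)%N; first by rewrite expn_gt0.
apply: le_trans (harm_pow2 _); rewrite ler_pdivlMr// mulrC.
by apply/ltW/(le_lt_trans _ (truncnS_gt _)); rewrite ler_wpM2l ?ler_norm.
Qed.

Lemma count_le (M : nat) (y : R) : 0 <= y -> \sum_(u < M) (u.+1%:R <= y)%R%:R <= y.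
Proof.
move=> y0; have : \sum_(u < M) (u.+1%:R <= y)%R%:R <= y /\
    \sum_(u < M) (u.+1%:R <= y)%R%:R <= M%:R :> R.
  elim: M => [|M [IH1 IH2]]; first by rewrite big_ord0.
  rewrite big_ord_recr/=; case: (leP M.+1%:R y) => h; last first.
    by rewrite mulr0n addr0; split=> //; apply: le_trans IH2 _; rewrite ler_nat.
  suff h2 : \sum_(i < M) (i.+1%:R <= y)%R%:R + true%:R <= M.+1%:R :> R.
    by split => //; apply: le_trans h2 h.
  by rewrite -natr1 lerD.
by case.
Qed.

(** Comparison of 1 / u^2 with the telescoping 1 / (u - 1) - 1 / u; the induction
    carries the sharper bound 2 / y - 1 / M. *)
Lemma sum_sqr_tail (M : nat) (y : R) : 0 < y ->
  \sum_(u < M) (if y <= u.+1%:R then u.+1%:R ^- 2 else 0) <= 2 / y.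
Proof.
move=> y0.
suff : \sum_(u < M) (if y <= u.+1%:R then u.+1%:R ^- 2 else 0) <=
    if (y <= M%:R) then 2 / y - M%:R^-1 else 0.
  move/le_trans; apply; case: ifP => _; last by rewrite divr_ge0// ltW.
  by rewrite lerBlDr lerDl invr_ge0.
elim: M => [|M IH].
  by rewrite big_ord0; case: ifPn => // h; move: (lt_le_trans y0 h); rewrite ltxx.
rewrite big_ord_recr /=; case: ifPn => h2; last first.
  rewrite addr0; apply: le_trans IH _; rewrite ifN// -ltNge.
  by apply: le_lt_trans (_ : M.+1%:R < y); rewrite ?ler_nat// ltNge.
have M0 : (0:R) < M.+1%:R by rewrite ltr0n.
case: ifPn IH => h1 IH.
  have M1 : (0 : R) < M%:R by apply: lt_le_trans h1.
  apply: (@le_trans _ _ (2 / y - M%:R^-1 + M.+1%:R ^- 2)); first by rewrite lerD2r.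
  rewrite -!addrA lerD2l -natr1; set x := M%:R in M1 *.
  rewrite -subr_ge0.
  have -> : - (x + 1)^-1 - (- x^-1 + (x + 1) ^- 2) = (x * (x + 1) ^+ 2)^-1.
    by field; rewrite !gt_eqF//; lra.
  by rewrite invr_ge0 mulr_ge0 ?sqr_ge0// ltW.
apply: (@le_trans _ _ (0 + M.+1%:R ^- 2)); first by rewrite lerD2r.
rewrite add0r lerBrDr.
have h3 : M.+1%:R^-1 <= y^-1 by rewrite lef_pV2 ?posrE.
have h4 : M.+1%:R ^- 2 <= M.+1%:R^-1 :> R.
  by rewrite lef_pV2 ?posrE ?exprn_gt0// -natrX ler_nat -[X in (X <= _)%N]muln1 leq_mul.
have -> : 2 / y = y^-1 + y^-1 by field; rewrite gt_eqF.
by rewrite lerD// (le_trans h4 h3).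
Qed.

End Harmonic.

Section HeavyTail.
Variables (R : realType) (M : nat).
Hypothesis M_gt0 : (0 < M)%N.

Let I : finType := ('I_M * bool)%type.
Let H : R := harm R M.

Let M_gt0R : (0 : R) < M%:R. Proof. by rewrite ltr0n. Qed.

(** On the uniform space ['I_M * bool] this variable is symmetric and has tails
    P (|heavy| > t) <= 1 / t, the borderline where the mean modulus [harm M] is
    still unbounded in M. *)
Definition heavy (i : 'I_M * bool) : R := (-1) ^+ i.2 * (M%:R / i.1.+1%:R).

Let I_gt0 : (0 < #|I|)%N.
Proof. by rewrite card_prod card_ord card_bool muln_gt0 M_gt0. Qed.

Let mean_heavy (F : R -> R) :
  mean (fun i : I => F (heavy i)) =
  (2 * M%:R)^-1 * \sum_(u < M) (F (M%:R / u.+1%:R) + F (- (M%:R / u.+1%:R))).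
Proof.
rewrite /mean card_prod card_ord card_bool natrM [M%:R * _]mulrC; congr (_ * _).
rewrite -(pair_bigA _ (fun u b => F (heavy (u, b)))) /=; apply: eq_bigr => u _.
by rewrite big_bool /heavy /= expr1 expr0 mul1r mulN1r addrC.
Qed.

Lemma norm_heavy (i : I) : `|heavy i| = M%:R / i.1.+1%:R.
Proof. by rewrite normrM normrX normrN1 expr1n mul1r ger0_norm// divr_ge0. Qed.

Lemma mean_abs_heavy : mean (fun i : I => `|heavy i|) = H.
Proof.
rewrite (mean_heavy (fun x => `|x|)) /H /harm mulr_sumr; apply: eq_bigr => u _.
rewrite normrN ger0_norm ?divr_ge0//.
have : u.+1%:R != 0 :> R by rewrite pnatr_eq0.
set y := u.+1%:R => y0; field; rewrite ?gt_eqF//.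
Qed.

Lemma mean_odd_heavy (F : R -> R) : (forall x, F (- x) = - F x) ->
  mean (fun i : I => F (heavy i)) = 0.
Proof.
move=> F0; rewrite mean_heavy big1 ?mulr0// => u _.
by rewrite F0 subrr.
Qed.

Lemma mean_tail_heavy (t : R) : 0 < t ->
  mean (fun i : I => (t < `|heavy i|)%R%:R) <= t^-1.
Proof.
move=> t0; rewrite (mean_heavy (fun x => (t < `|x|)%R%:R)).
have y0 : 0 <= M%:R / t by rewrite divr_ge0// ltW.
rewrite mulrC ler_pdivrMr ?mulr_gt0//.
apply: (@le_trans _ _ (2 * \sum_(u < M) (u.+1%:R <= M%:R / t)%R%:R)).
  rewrite mulr_sumr; apply: ler_sum => u _; rewrite normrN ger0_norm ?divr_ge0//.
  rewrite -mulr2n -[leLHS]mulr_natl ler_wpM2l// ler_nat.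
  rewrite ltr_pdivlMr ?ltr0n// ler_pdivlMr// mulrC.
  by case: ltP => // /ltW ->.
apply: (le_trans (ler_wpM2l _ (count_le M y0))) => //.
by rewrite le_eqVlt; apply/orP; left; apply/eqP; field; rewrite gt_eqF.
Qed.

Lemma mean_sqr_heavy (t : R) : 0 < t ->
  mean (fun i : I => if `|heavy i| <= t then heavy i ^+ 2 else 0) <= 2 * t.
Proof.
move=> t0; rewrite (mean_heavy (fun x => if `|x| <= t then x ^+ 2 else 0)).
have y0 : 0 < M%:R / t by rewrite divr_gt0.
apply: (@le_trans _ _ (M%:R * (\sum_(u < M) if M%:R / t <= u.+1%:R then u.+1%:R ^- 2 else 0))).
  rewrite !mulr_sumr; apply: ler_sum => u _.
  rewrite normrN ger0_norm ?divr_ge0// sqrrN.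
  rewrite ler_pdivrMr ?ltr0n// ler_pdivrMr// [t * _]mulrC.
  case: ifP => _; last by rewrite addr0 !mulr0.
  have : u.+1%:R != 0 :> R by rewrite pnatr_eq0.
  set y := u.+1%:R => yn0; rewrite le_eqVlt; apply/orP; left; apply/eqP; field.
  by rewrite ?gt_eqF//.
apply: (le_trans (ler_wpM2l _ (sum_sqr_tail M y0))) => //.
by rewrite le_eqVlt; apply/orP; left; apply/eqP; field; rewrite !gt_eqF.
Qed.

Section Combination.
Variables (K : nat) (c : 'I_K -> R) (tau : R).
Hypothesis tau_gt0 : 0 < tau.
Let L : R := \sum_k `|c k|.
Hypothesis L_gt0 : 0 < L.
Let Omega : finType := {ffun 'I_K -> I}.
Let r (h : Omega) k := c k * heavy (h k).
Let T := tau * L.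
Let T_gt0 : 0 < T. Proof. by rewrite mulr_gt0. Qed.

Let Omega_gt0 : (0 < #|Omega|)%N.
Proof. by rewrite card_ffun expn_gt0 I_gt0. Qed.

Let big (h : Omega) k := T < `|r h k|.

Let mean_big k : mean (fun h => (big h k)%:R) <= `|c k| / T.
Proof.
rewrite /big /r (mean_coord I_gt0 k (fun i => (T < `|c k * heavy i|)%R%:R)).
have [->|ck] := eqVneq (c k) 0.
  rewrite normr0 mul0r -[leRHS](mean_cst 0 I_gt0); apply: ler_mean => i.
  by have -> : (T < `|0 * heavy i|)%R = false by rewrite mul0r normr0 ltNge ltW.
have ck0 : 0 < `|c k| by rewrite normr_gt0.
rewrite -[leRHS]invrK invf_div; apply: le_trans (mean_tail_heavy _); last first.
  by rewrite divr_gt0.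
by apply: ler_mean => i; rewrite normrM ltr_pdivrMr// mulrC.
Qed.

Let mean_small (s : 'I_K -> R) : (forall k, `|s k| = 1) ->
  mean (fun h => `|\sum_k (if big h k then 0 else s k * r h k)|) <= (tau / 2 + 1) * L.
Proof.
move=> s1.
pose F k (i : I) := if T < `|c k * heavy i| then 0 else s k * (c k * heavy i).
have F0 k : mean (F k) = 0.
  rewrite (mean_odd_heavy (F := fun x => if T < `|c k * x| then 0 else s k * (c k * x)))//.
  by move=> x; rewrite mulrN normrN; case: ifP; rewrite ?oppr0// mulrN.
have F2 k : mean (fun i => F k i ^+ 2) <= 2 * T * `|c k|.
  have [ck|ck] := eqVneq (c k) 0.
    rewrite ck normr0 mulr0 -[leRHS](mean_cst 0 I_gt0); apply: ler_mean => i.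
    by rewrite /F ck mul0r mulr0 if_same expr0n.
  have ck0 : 0 < `|c k| by rewrite normr_gt0.
  rewrite (@eq_mean _ _ _ (fun i => c k ^+ 2 *
      (if `|heavy i| <= T / `|c k| then heavy i ^+ 2 else 0))); last first.
    move=> i; rewrite /F normrM mulrC -ltr_pdivrMr// ltNge.
    case: leP => h /=; last by rewrite expr0n mulr0.
    rewrite mulrCA exprMn -[X in _ * X]real_normK ?num_real// normrM s1 mul1r.
    by rewrite real_normK ?num_real// mulrC.
  rewrite meanZ; apply: (le_trans (ler_wpM2l (sqr_ge0 _) (mean_sqr_heavy _))).
    by rewrite divr_gt0.
  rewrite -real_normK ?num_real// le_eqVlt; apply/orP; left; apply/eqP; field.
  by rewrite gt_eqF.
apply: (le_trans (mean_abs_le _ Omega_gt0 T_gt0)).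
rewrite (@eq_mean _ _ _ (fun h : Omega => (\sum_k F k (h k)) ^+ 2)) //.
rewrite mean_sqr_sum//; last by move=> k l _; rewrite F0 mul0r.
have : \sum_k mean (fun i => F k i ^+ 2) <= 2 * T * L.
  by rewrite mulr_sumr ler_sum.
move=> h. rewrite [leRHS]mulrDl mul1r; apply: lerD; first by rewrite /T mulrAC.
by rewrite ler_pdivrMr ?mulr_gt0// mulrC.
Qed.

Variable (P : pred 'I_K).
Let lam k : R := if P k then 1 else -1.

(** For most h at most one term exceeds tau * L, and it dominates the sum: flipping
    the signs of the terms then amounts to multiplying the sum by the sign of
    that term, which is the value of g. The errors are the two sums of the small
    terms, controlled by second moments, and the pairs consisting of one big term
    and another term, controlled by a tail probability times a first moment. *)
Lemma one_big_jump : exists g : Omega -> R, (forall h, `|g h| = 1) /\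
  mean (fun h => `|\sum_k lam k * r h k - g h * \sum_k r h k|)
     <= (tau + 2 + 2 * H / tau) * L.
Proof.
have lam1 k : `|lam k| = 1 by rewrite /lam; case: (P k); rewrite ?normrN1 ?normr1.
pose g h : R := if [pick k | big h k] is Some k then lam k else 1.
have g1 h : `|g h| = 1 by rewrite /g; case: pickP; rewrite ?normr1.
exists g; split=> //.
pose S1 h := `|\sum_k (if big h k then 0 else lam k * r h k)|.
pose S2 h := `|\sum_k (if big h k then 0 else 1 * r h k)|.
pose S3 h := \sum_k \sum_(l | l != k) `|r h k| * (big h l)%:R.
have key h : `|\sum_k lam k * r h k - g h * \sum_k r h k| <= S1 h + S2 h + 2 * S3 h.
  have -> : \sum_k lam k * r h k - g h * \sum_k r h k =
      \sum_k (if big h k then 0 else lam k * r h k) -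
      g h * (\sum_k (if big h k then 0 else 1 * r h k)) +
      \sum_k (if big h k then (lam k - g h) * r h k else 0).
    rewrite !mulr_sumr -!sumrB -big_split /=; apply: eq_bigr => k _.
    by case: ifP => _; rewrite ?mulr0 ?mul1r ?addr0 ?subr0 ?add0r// mulrBl.
  apply: (le_trans (ler_normD _ _)); apply: lerD.
    by apply: (le_trans (ler_normB _ _)); rewrite normrM g1 mul1r.
  apply: (le_trans (ler_norm_sum _ _ _)); rewrite mulr_sumr; apply: ler_sum => k _.
  have S0 : 0 <= \sum_(l | l != k) `|r h k| * (big h l)%:R.
    by apply: sumr_ge0 => l _; rewrite mulr_ge0.
  case: ifPn => bk; last by rewrite normr0 mulr_ge0.
  rewrite /g; case: pickP => [l bl|/(_ k)]; last by rewrite bk.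
  have [->|lk] := eqVneq l k; first by rewrite subrr mul0r normr0 mulr_ge0.
  rewrite (bigD1 l)//= bl mulr1 normrM; apply: ler_pM => //.
    by apply: (le_trans (ler_normB _ _)); rewrite !lam1.
  by rewrite lerDl; apply: sumr_ge0 => l' _; rewrite mulr_ge0.
apply: (le_trans (ler_mean key)); rewrite !meanD meanZ.
have h1 : mean S1 <= (tau / 2 + 1) * L by exact: mean_small.
have h2 : mean S2 <= (tau / 2 + 1) * L by apply: mean_small => k; rewrite normr1.
have H0 : 0 <= H by rewrite /H /harm sumr_ge0.
have h3 : mean S3 <= H / tau * L.
  rewrite /S3 mean_sum.
  apply: (@le_trans _ _ (\sum_k \sum_l (`|c k| * H) * (`|c l| / T))).
    apply: ler_sum => k _; rewrite mean_sum [leRHS](bigID (predC1 k)) /=.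
    rewrite -[leLHS]addr0; apply: lerD; last first.
      by apply: sumr_ge0 => l _; rewrite mulr_ge0 ?invr_ge0 ?mulr_ge0 ?invr_ge0 ?(ltW T_gt0).
    apply: ler_sum => l lk.
    rewrite /big /r (mean_coord2 I_gt0 (fun i => `|c k * heavy i|)
        (fun i => (T < `|c l * heavy i|)%R%:R)) 1?eq_sym//.
    apply: ler_pM; rewrite ?mean_ge0//.
      by rewrite -mean_abs_heavy -meanZ; apply: ler_mean => i; rewrite normrM.
    have := mean_big l.
    by rewrite /big /r (mean_coord I_gt0 l (fun i => (T < `|c l * heavy i|)%R%:R)).
  under eq_bigr do rewrite -mulr_sumr.
  rewrite -mulr_suml -mulr_suml -mulr_suml -/L /T.
  rewrite le_eqVlt; apply/orP; left; apply/eqP; field.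
  by rewrite !gt_eqF.
lra.
Qed.

End Combination.

End HeavyTail.

(** * Sign changes that combinations do not see *)
Section Design.
Variable R : realType.

Definition sign_of (b : bool) : R := if b then 1 else -1.

Lemma norm_sign_of b : `|sign_of b| = 1.
Proof. by case: b; rewrite /sign_of ?normrN1 ?normr1. Qed.

Section Weights.
Variables (M K' : nat).
Hypothesis M_gt0 : (0 < M)%N.
Let K := (K' + K')%N.
Hypothesis K'_gt0 : (0 < K')%N.
Hypothesis K'M : (8 * M <= K')%N.
Let I : finType := ('I_M * bool)%type.
Let Omega : finType := {ffun 'I_K -> I}.
Let H : R := harm R M.
Let P (k : 'I_K) : bool := (k < K')%N.

Let I_gt0 : (0 < #|I|)%N.
Proof. by rewrite card_prod card_ord card_bool muln_gt0 M_gt0. Qed.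

Let Omega_gt0 : (0 < #|Omega|)%N.
Proof. by rewrite card_ffun expn_gt0 I_gt0. Qed.

Lemma harm_ge1 : 1 <= H.
Proof.
rewrite /H /harm; case: M M_gt0 => // m _; rewrite big_ord_recl invr1 lerDl.
by apply: sumr_ge0 => i _; rewrite invr_ge0.
Qed.
Let H_gt0 : 0 < H. Proof. exact: lt_le_trans ltr01 harm_ge1. Qed.

Let a (h : Omega) : R := K'%:R^-1 * \sum_(k | P k) `|heavy R (h k)|.
Let b (h : Omega) : R := K'%:R^-1 * \sum_(k | ~~ P k) `|heavy R (h k)|.

Lemma card_lhalf : #|[pred k | P k]| = K'.
Proof.
rewrite -sum1_card big_split_ord /= [X in (_ + X)%N]big1 ?addn0; last first.
  by move=> i; rewrite inE /P /= ltnNge leq_addr.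
rewrite (eq_bigl predT) ?sum1_card ?card_ord// => i.
by rewrite inE /P /= ltn_ord.
Qed.

Lemma card_rhalf : #|[pred k | ~~ P k]| = K'.
Proof.
apply/eqP; rewrite -(eqn_add2l K') -{1}card_lhalf; apply/eqP.
transitivity #|'I_K|; last by rewrite card_ord.
by rewrite -(cardC [pred k | P k]); congr (_ + _)%N; apply: eq_card => k; rewrite !inE.
Qed.

Let mean_half (Q : pred 'I_K) : #|Q| = K' ->
  mean (fun h : Omega => K'%:R^-1 * \sum_(k | Q k) `|heavy R (h k)|) = H.
Proof.
move=> cQ; rewrite meanZ mean_sum (eq_bigr (fun=> H)); last first.
  by move=> k _; rewrite (mean_coord I_gt0 k (fun i => `|heavy R i|)) mean_abs_heavy.
rewrite sumr_const cQ -[H *+ _]mulr_natl mulrA mulVf ?mul1r// pnatr_eq0.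
by rewrite -lt0n.
Qed.

(** As min (a, b) = (a + b - |a - b|) / 2, it suffices that a and b, averages of
    K' >= 8 M independent copies, concentrate around their common mean H. *)
Lemma mean_min_heavy : 3 / 4 * H <= mean (fun h : Omega => Num.min (a h) (b h)).
Proof.
have -> : mean (fun h => Num.min (a h) (b h)) =
    mean (fun h => (2^-1 * (a h + b h)) + (- 2^-1) * `|a h - b h|).
  apply: eq_mean => h; case: (leP (a h) (b h)) => ab.
    by rewrite ler0_norm ?subr_le0//; lra.
  by rewrite gtr0_norm ?subr_gt0//; lra.
rewrite meanD !meanZ meanD.
rewrite (mean_half (Q := [pred k | P k])) ?card_lhalf//.
rewrite (mean_half (Q := [pred k | ~~ P k])) ?card_rhalf//.
have H20 : 0 < H / 2 by rewrite divr_gt0.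
have := mean_abs_le (fun h => a h - b h) Omega_gt0 H20.
have -> : mean (fun h => (a h - b h) ^+ 2) =
    K'%:R^-1 ^+ 2 * mean (fun h : Omega => (\sum_k sign_of (P k) * (`|heavy R (h k)| - H)) ^+ 2).
  rewrite -meanZ; apply: eq_mean => h; rewrite -exprMn; congr (_ ^+ 2).
  rewrite /a /b -mulrBr; congr (_ * _).
  rewrite [RHS](bigID P) /= [X in _ = X + _](eq_bigr (fun k => `|heavy R (h k)| - H)); last first.
    by move=> k /= Pk; rewrite /sign_of Pk mul1r.
  rewrite [X in _ = _ + X](eq_bigr (fun k => H - `|heavy R (h k)|)); last first.
    by move=> k /= Pk; rewrite /sign_of ifN // mulN1r opprB.
  rewrite !sumrB !sumr_const card_lhalf card_rhalf; ring.
rewrite (mean_sqr_sum I_gt0 (F := fun k i => sign_of (P k) * (`|heavy R i| - H))); last first.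
  move=> k l _; rewrite meanZ meanD mean_abs_heavy// (mean_cst (- H) I_gt0) /H subrr.
  by rewrite mulr0 mul0r.
have le2 k : mean (fun i : I => (sign_of (P k) * (`|heavy R i| - H)) ^+ 2) <= M%:R * H.
  apply: (@le_trans _ _ (mean (fun i : I => M%:R * `|heavy R i| + (- (2 * H)) * `|heavy R i| + H ^+ 2))).
    apply: ler_mean => i; rewrite exprMn -[sign_of _ ^+ 2]real_normK ?num_real// norm_sign_of.
    rewrite expr1n mul1r.
    have : `|heavy R i| ^+ 2 <= M%:R * `|heavy R i|.
      rewrite expr2 ler_wpM2r// norm_heavy ler_pdivrMr ?ltr0n//.
      by rewrite ler_peMr ?ler0n// ler1n.
    by move: (`|heavy R i|) => x; lra.
  rewrite !meanD (mean_cst (H ^+ 2) I_gt0) !meanZ mean_abs_heavy// -/H.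
  have := sqr_ge0 H; lra.
have : \sum_k mean (fun i : I => (sign_of (P k) * (`|heavy R i| - H)) ^+ 2) <= (K'%:R *+ 2) * (M%:R * H).
  apply: (@le_trans _ _ (\sum_(k < K) M%:R * H)); first by apply: ler_sum.
  by rewrite sumr_const card_ord -[leLHS]mulr_natl /K natrD mulr2n.
move=> le3 le1.
have K'0 : (0 : R) < K'%:R by rewrite ltr0n.
have le4 : K'%:R^-1 ^+ 2 * (\sum_k mean (fun i : I => (sign_of (P k) * (`|heavy R i| - H)) ^+ 2)) / (2 * (H / 2)) <= 4^-1.
  rewrite ler_pdivrMr; last by rewrite mulrCA divff// mulr1.
  apply: (le_trans (ler_wpM2l _ le3)); first by rewrite sqr_ge0.
  have -> : K'%:R^-1 ^+ 2 * (K'%:R *+ 2 * (M%:R * H)) = 2 * (M%:R * H) / K'%:R.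
    rewrite -[K'%:R *+ 2]mulr_natr; field; by rewrite gt_eqF.
  rewrite ler_pdivrMr//.
  have : 8 * M%:R <= K'%:R :> R by rewrite -natrM ler_nat.
  have := harm_ge1; move: (M%:R) (K'%:R) => m k' H1 mk.
  have : 0 <= H * (k' - 8 * m) by rewrite mulr_ge0 ?(ltW H_gt0)// subr_ge0.
  lra.
have := harm_ge1; lra.
Qed.

Let Y : finType := (Omega + 'I_K)%type.
(** The points [inr l] carry half of the mass of each [beta k]; they separate the
    indices and bound the L1 norm of a combination from below by half of the sum
    of the moduli of its coefficients. *)
Let beta (k : 'I_K) (y : Y) : R :=
  match y with
  | inl h => heavy R (h k) / (2 * H * #|Omega|%:R)
  | inr l => (k == l)%:R / 2
  end.

Lemma sumY (F : Y -> R) : \sum_y F y = \sum_h F (inl h) + \sum_k F (inr k).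
Proof. by rewrite big_sumType. Qed.

Let W0 : 0 < 2 * H * #|Omega|%:R. Proof. by rewrite !mulr_gt0// ltr0n. Qed.

Let sum_h (F : Omega -> R) :
  \sum_h F h / (2 * H * #|Omega|%:R) = mean F / (2 * H).
Proof. by rewrite -mulr_suml /mean invfM [(2 * H)^-1 * _]mulrC mulrA [_^-1 * \sum_x _]mulrC. Qed.

Lemma beta1 k : \sum_y `|beta k y| = 1.
Proof.
rewrite sumY /beta.
under eq_bigr do rewrite normrM [X in _ * X]gtr0_norm ?invr_gt0//.
rewrite (sum_h (fun h => `|heavy R (h k)|)) (mean_coord I_gt0 k (fun i => `|heavy R i|)).
rewrite mean_abs_heavy// (bigD1 k) //= eqxx big1 => [|l lk]; last first.
  by rewrite eq_sym (negPf lk) mul0r normr0.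
rewrite mul1r ger0_norm// addr0 -/H. field; by rewrite gt_eqF.
Qed.

Lemma beta_unconditional (eps : R) (c : 'I_K -> R) : 0 < eps ->
    2 * (4 / eps + 2) / eps <= H ->
  exists g : Y -> R, (forall y, `|g y| = 1) /\
   \sum_y `|\sum_k sign_of (P k) * (c k * beta k y) - g y * \sum_k c k * beta k y|
    <= eps * \sum_y `|\sum_k c k * beta k y|.
Proof.
move=> e0 eH; set L := \sum_k `|c k|.
have L0 : 0 <= L by apply: sumr_ge0.
have [Lz|Ln] := eqVneq L 0.
  have c0 k : c k = 0.
    apply/normr0_eq0; apply: (psumr_eq0P _ Lz) => // i _; exact: normr_ge0.
  exists (fun=> 1); split; first by move=> _; rewrite normr1.
  rewrite big1 ?mulr_ge0 ?sumr_ge0 ?(ltW e0)// => y _.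
  by rewrite !big1 ?mulr0 ?subr0 ?normr0// => k _; rewrite c0 mul0r ?mulr0.
have Lp : 0 < L by rewrite lt_neqAle eq_sym Ln.
have t0 : 0 < 4 / eps by rewrite divr_gt0.
have [g [g1 gle]] := one_big_jump M_gt0 t0 Lp P.
exists (fun y => match y with inl h => g h | inr k => sign_of (P k) end); split.
  by case=> // k; rewrite norm_sign_of.
have lower : L / 2 <= \sum_y `|\sum_k c k * beta k y|.
  rewrite sumY -[leLHS]add0r lerD ?sumr_ge0//.
  rewrite /L mulr_suml ler_sum// => l _; rewrite (bigD1 l)//= eqxx big1 => [|k kl].
    by rewrite addr0 mul1r normrM [X in _ <= _ * X]ger0_norm.
  by rewrite (negPf kl) mul0r mulr0.
apply: le_trans (ler_wpM2l (ltW e0) lower).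
rewrite sumY [X in _ + X]big1 ?addr0 => [|l _]; last first.
  rewrite (bigD1 l)//= [X in _ - _ * X](bigD1 l)//= eqxx !big1 ?addr0 ?subrr ?normr0//.
    by move=> k kl; rewrite (negPf kl) mul0r mulr0.
  by move=> k kl; rewrite (negPf kl) mul0r !mulr0.
under eq_bigr => h _.
  have -> : \sum_k sign_of (P k) * (c k * beta k (inl h)) - g h * (\sum_k c k * beta k (inl h))
    = (\sum_k sign_of (P k) * (c k * heavy R (h k)) - g h * \sum_k c k * heavy R (h k)) / (2 * H * #|Omega|%:R).
    rewrite mulrBl; congr (_ - _); last rewrite -(mulrA (g h)); rewrite mulr_suml.
      by apply: eq_bigr => k _; rewrite /= !mulrA.
    by congr (_ * _); apply: eq_bigr => k _; rewrite /= !mulrA.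
  rewrite normrM [X in _ * X]gtr0_norm ?invr_gt0//.
  over.
rewrite (sum_h (fun h => `|\sum_k sign_of (P k) * (c k * heavy R (h k)) - g h * \sum_k c k * heavy R (h k)|)).
rewrite ler_pdivrMr ?mulr_gt0//.
apply: (le_trans gle).
have -> : eps * (L / 2) * (2 * H) = (eps * H) * L by field.
rewrite ler_pM2r//.
have -> : 2 * harm R M / (4 / eps) = eps * H / 2 by rewrite -/H; field; rewrite gt_eqF.
move: eH; rewrite ler_pdivrMr// [H * _]mulrC; lra.
Qed.

Lemma beta_min : 1 / 4 <= \sum_y Num.min (K'%:R^-1 * \sum_(k | P k) `|beta k y|)
                                 (K'%:R^-1 * \sum_(k | ~~ P k) `|beta k y|).
Proof.
rewrite sumY -[leLHS]addr0; apply: lerD; last first.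
  by apply: sumr_ge0 => k _; rewrite le_min !mulr_ge0 ?invr_ge0 ?sumr_ge0.
under eq_bigr => h _.
  have E (Q : pred 'I_K) : K'%:R^-1 * (\sum_(k | Q k) `|beta k (inl h)|) =
      (K'%:R^-1 * (\sum_(k | Q k) `|heavy R (h k)|)) / (2 * H * #|Omega|%:R).
    rewrite -mulrA mulr_suml; congr (_ * _); apply: eq_bigr => k _.
    by rewrite normrM [X in _ * X]gtr0_norm ?invr_gt0.
  rewrite (E [pred k | P k]) (E [pred k | ~~ P k]) /=.
  rewrite -minr_pMl ?invr_ge0 ?(ltW W0)//.
  over.
rewrite (sum_h (fun h => Num.min (a h) (b h))) ler_pdivlMr ?mulr_gt0//.
have := mean_min_heavy; have := H_gt0; lra.
Qed.

End Weights.

(** Changing the signs of the coefficients on half of the indices has, up to a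
    small L1 error, the effect of multiplying the combination by a unimodular
    function g, but g depends on the combination. No single g can serve all of
    them, because the two halves of the array have a large common part, as the
    last clause says. The array consists of independent heavy-tailed variables
    ([one_big_jump]) on the points of a finite probability space. *)
Theorem design (eps : R) : 0 < eps ->
  exists (K N K' : nat) (P : pred 'I_K) (alpha : 'I_K -> 'I_N -> R),
  [/\ [/\ (0 < K')%N, #|[pred k | P k]| = K' & #|[pred k | ~~ P k]| = K'],
      forall k, \sum_x `|alpha k x| = 1,
      forall k x, `|alpha k x| <= eps,
      (forall c : 'I_K -> R, exists g : 'I_N -> R, (forall x, `|g x| = 1) /\
        \sum_x `|\sum_k sign_of (P k) * (c k * alpha k x) - g x * \sum_k c k * alpha k x|
         <= eps * \sum_x `|\sum_k c k * alpha k x|) &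
      1 / 4 <= \sum_x Num.min (K'%:R^-1 * \sum_(k | P k) `|alpha k x|)
                              (K'%:R^-1 * \sum_(k | ~~ P k) `|alpha k x|)].
Proof.
move=> e0; have [M M0 HM] := harm_unbounded (2 * (4 / eps + 2) / eps).
pose K' := (8 * M)%N; have K'0 : (0 < K')%N by rewrite muln_gt0.
have K'M : (8 * M <= K')%N by [].
pose K := (K' + K')%N.
pose Y : finType := ({ffun 'I_K -> 'I_M * bool} + 'I_K)%type.
pose beta : 'I_K -> Y -> R := fun k y => match y with
  | inl h => heavy R (h k) / (2 * harm R M * #|{ffun 'I_K -> 'I_M * bool}|%:R)
  | inr l => (k == l)%:R / 2
  end.
pose P (k : 'I_K) := (k < K')%N.
(* r copies of every point bring the entries of the array below eps *)
pose r := (Num.truncn (eps^-1)).+1.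
have r0 : (0 : R) < r%:R by rewrite ltr0n.
have re : r%:R^-1 <= eps.
  by rewrite -[leRHS]invrK lef_pV2 ?posrE ?invr_gt0//; apply/ltW/truncnS_gt.
pose X : finType := (Y * 'I_r)%type.
pose al k (x : 'I_#|X|) : R := beta k (enum_val x).1 / r%:R.
have sumX (F : Y -> R) : \sum_(x < #|X|) (F (enum_val x).1) = r%:R * \sum_y F y.
  transitivity (\sum_(x : X) F x.1).
    by rewrite [RHS](reindex (@enum_val X X)) //; apply: onW_bij; exact: enum_val_bij.
  rewrite -(pair_bigA _ (fun y (_ : 'I_r) => F y)) /= mulr_sumr; apply: eq_bigr => y _.
  by rewrite sumr_const card_ord mulr_natl.
have sumX1 (F : Y -> R) : \sum_(x < #|X|) (F (enum_val x).1 / r%:R) = \sum_y F y.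
  by rewrite -mulr_suml sumX mulrAC divff ?mul1r// gt_eqF.
have alE k x : `|al k x| = `|beta k (enum_val x).1| / r%:R.
  by rewrite normrM [X in _ * X]gtr0_norm// invr_gt0.
exists K, #|X|, K', P, al; split.
- by split=> //; [exact: card_lhalf|exact: card_rhalf].
- move=> k; under eq_bigr do rewrite alE.
  by rewrite (sumX1 (fun y => `|beta k y|)); apply: beta1.
- move=> k x; rewrite alE ler_pdivrMr//.
  have : `|beta k (enum_val x).1| <= 1.
    rewrite -(beta1 M0 k) /= (bigD1 (enum_val x).1)//= lerDl.
    by apply: sumr_ge0.
  move/le_trans; apply; rewrite -ler_pdivrMr//; apply: le_trans re.
  by rewrite div1r.
- move=> c; have [g [g1 gle]] := beta_unconditional M0 c e0 HM.
  exists (fun x => g (enum_val x).1); split=> //.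
  have E x : \sum_k c k * al k x = (\sum_k c k * beta k (enum_val x).1) / r%:R.
    by rewrite mulr_suml; apply: eq_bigr => k _; rewrite mulrA.
  have E' x : \sum_k sign_of (P k) * (c k * al k x) = (\sum_k sign_of (P k) * (c k * beta k (enum_val x).1)) / r%:R.
    by rewrite mulr_suml; apply: eq_bigr => k _; rewrite !mulrA.
  under eq_bigr do rewrite E E' mulrA -mulrBl normrM [X in _ * X]gtr0_norm ?invr_gt0//.
  under [X in _ <= _ * X]eq_bigr do rewrite E normrM [X in _ * X]gtr0_norm ?invr_gt0//.
  by rewrite (sumX1 (fun y => `|\sum_k sign_of (P k) * (c k * beta k y) - g y * \sum_k c k * beta k y|))
     (sumX1 (fun y => `|\sum_k c k * beta k y|)).
- have E (Q : pred 'I_K) x : K'%:R^-1 * (\sum_(k | Q k) `|al k x|) =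
     (K'%:R^-1 * (\sum_(k | Q k) `|beta k (enum_val x).1|)) / r%:R.
    by rewrite -mulrA mulr_suml; congr (_ * _); apply: eq_bigr => k _; rewrite alE.
  under eq_bigr => x _.
    rewrite (E [pred k | P k]) (E [pred k | ~~ P k]) /= -minr_pMl ?invr_ge0 ?(ltW r0)//.
    over.
  rewrite (sumX1 (fun y => Num.min (K'%:R^-1 * (\sum_(k | P k) `|beta k y|))
     (K'%:R^-1 * (\sum_(k | ~~ P k) `|beta k y|)))).
  by apply: beta_min.
Qed.

End Design.

(** * The function f, finitely supported vectors and the pairing *)
Section FunctionF.
Variable R : realType.
Implicit Types x y : R.

Lemma ln2_gt0' : (0 : R) < ln 2. Proof. by rewrite ln_gt0// ltr1n. Qed.

Lemma f1 : f (1 : R) = 1.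
Proof. by rewrite /f -[1 + 1]/(2%:R) divff// gt_eqF// ln2_gt0'. Qed.

Lemma f0 : f (0 : R) = 0. Proof. by rewrite /f add0r ln1 mul0r. Qed.

Lemma ler_f x y : 0 <= x -> x <= y -> f x <= f y.
Proof.
move=> x0 xy; rewrite /f ler_pM2r ?invr_gt0 ?ln2_gt0'// ler_ln ?posrE; lra.
Qed.

Lemma ltr_f x y : 0 <= x -> x < y -> f x < f y.
Proof.
move=> x0 xy; rewrite /f ltr_pM2r ?invr_gt0 ?ln2_gt0'// ltr_ln ?posrE; lra.
Qed.

Lemma f_ge0 x : 0 <= x -> 0 <= f x.
Proof. by move=> x0; rewrite -f0 ler_f. Qed.

Lemma f_ge1 x : 1 <= x -> 1 <= f x.
Proof. by move=> x0; rewrite -[leLHS]f1 ler_f. Qed.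

Lemma f_gt0 x : 0 < x -> 0 < f x.
Proof. by move=> x0; rewrite -f0 ltr_f. Qed.

Lemma fn_ge1 n : (0 < n)%N -> 1 <= f (n%:R : R).
Proof. by move=> n0; apply: f_ge1; rewrite ler1n. Qed.

Lemma fn_gt0 n : (0 < n)%N -> 0 < f (n%:R : R).
Proof. by move=> n0; apply: f_gt0; rewrite ltr0n. Qed.

End FunctionF.

Section C00.
Variable R : realType.
Implicit Types x y u : nat -> R.

Lemma c00P x : c00 x <-> exists B, forall i, (B <= i)%N -> x i = 0.
Proof.
split.
  move=> /finite_seqP[s sE]; exists (\max_(i <- s) i).+1 => i.
  move=> Bi; apply: contraPP Bi => /eqP xi.
  have : supp x i by [].
  rewrite sE /= => iS; apply/negP; rewrite -ltnNge ltnS.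
  by rewrite (big_rem i) //= leq_maxl.
move=> [B xB]; apply: (sub_finite_set _ (finite_II B)) => i /= xi.
by rewrite ltnNge; apply: contra xi => /xB ->.
Qed.

Lemma c00_le x y : (forall i, `|x i| <= `|y i|) -> c00 y -> c00 x.
Proof.
move=> xy /c00P[B yB]; apply/c00P; exists B => i /yB yi.
by apply/normr0_eq0/le_anti; rewrite normr_ge0 andbT -(normr0 R) -yi xy.
Qed.

Lemma c00_0 : c00 (0 : nat -> R).
Proof. by apply/c00P; exists 0%N. Qed.

Lemma c00D x y : c00 x -> c00 y -> c00 (x + y).
Proof.
move=> /c00P[A xA] /c00P[B yB]; apply/c00P; exists (maxn A B) => i.
by rewrite geq_max => /andP[/xA xi /yB yi]; rewrite addrfctE xi yi addr0.
Qed.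

Lemma c00Z a x : c00 x -> c00 (a *: x).
Proof.
move=> /c00P[A xA]; apply/c00P; exists A => i /xA xi.
by rewrite scalrfctE xi scaler0.
Qed.

Lemma c00_sum (I : Type) (r : seq I) (P : pred I) (F : I -> nat -> R) :
  (forall i, P i -> c00 (F i)) -> c00 (\sum_(i <- r | P i) F i).
Proof. by move=> FP; apply: big_ind => //; [exact: c00_0|exact: c00D]. Qed.

Lemma c00_unit i : c00 (unit_vec R i).
Proof.
apply/c00P; exists i.+1 => n ni; rewrite /unit_vec (_ : (n == i) = false)//.
by apply/eqP => ni'; move: ni; rewrite ni' ltnn.
Qed.

Lemma proj_in (E : set nat) x i : E i -> proj E x i = x i.
Proof. by move=> Ei; rewrite /proj mem_set. Qed.

Lemma proj_notin (E : set nat) x i : ~ E i -> proj E x i = 0.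
Proof. by move=> Ei; rewrite /proj memNset. Qed.

Lemma proj_abs (E : set nat) x i : `|proj E x i| <= `|x i|.
Proof. by rewrite /proj; case: ifP => // _; rewrite normr0. Qed.

Lemma c00_proj (E : set nat) x : c00 x -> c00 (proj E x).
Proof. by apply: c00_le => i; exact: proj_abs. Qed.

Lemma projD E x y : proj E (x + y) = proj E x + proj E y.
Proof. by apply/funext => i; rewrite /proj !addrfctE; case: ifP; rewrite ?addr0. Qed.

Lemma projZ E a x : proj E (a *: x) = a *: proj E x.
Proof. by apply/funext => i; rewrite /proj !scalrfctE; case: ifP; rewrite ?scaler0. Qed.

Lemma proj0 E : proj E (0 : nat -> R) = 0.
Proof. by apply/funext => i; rewrite /proj; case: ifP. Qed.

Lemma proj_sum (I : Type) (r : seq I) (P : pred I) (F : I -> nat -> R) E :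
  proj E (\sum_(i <- r | P i) F i) = \sum_(i <- r | P i) proj E (F i).
Proof.
by apply: (big_morph (proj E)); [exact: projD|exact: proj0].
Qed.

Lemma proj_proj E F x : proj E (proj F x) = proj (E `&` F) x.
Proof.
apply/funext => i; rewrite /proj; have [iE|iE] := boolP (i \in E).
  have [iF|iF] := boolP (i \in F).
    by rewrite mem_set//; split; apply/set_mem.
  by rewrite memNset// => -[_ /mem_set]; rewrite (negPf iF).
by rewrite memNset// => -[/mem_set]; rewrite (negPf iE).
Qed.

Lemma proj_id E x : supp x `<=` E -> proj E x = x.
Proof.
move=> xE; apply/funext => i; have [xi|xi] := eqVneq (x i) 0.
  by rewrite /proj xi if_same.
by rewrite proj_in//; apply: xE.
Qed.

Lemma projT x : proj setT x = x. Proof. exact: proj_id. Qed.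

Lemma proj_disj E x : (forall i, E i -> x i = 0) -> proj E x = 0.
Proof.
move=> xE; apply/funext => i; rewrite /proj; case: ifP => // /set_mem /xE.
by [].
Qed.

Lemma supp_proj E x i : supp (proj E x) i -> E i /\ supp x i.
Proof.
rewrite /supp /proj /=; case: ifP; last by rewrite eqxx.
by move=> /set_mem.
Qed.

Lemma sumfE (I : Type) (r : seq I) (P : pred I) (F : I -> nat -> R) i :
  (\sum_(k <- r | P k) F k) i = \sum_(k <- r | P k) F k i.
Proof. by rewrite fct_sumE. Qed.

Lemma pairing_ext u x u' x' : (forall i, u i * x i = u' i * x' i) ->
  pairing u x = pairing u' x'.
Proof. by move=> E; rewrite /pairing; apply: eq_fsbigr => i _; exact: E. Qed.

Lemma pairingE u x B : (forall i, (B <= i)%N -> u i * x i = 0) ->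
  pairing u x = \sum_(i < B) u i * x i.
Proof.
move=> uxB; rewrite (fsbig_ord _ B (fun i => u i * x i)) /pairing.
by apply/esym/fsbig_widen => // i [_ /= /negP]; rewrite -leqNgt => /uxB.
Qed.

Lemma pairingDr u x y : c00 x -> c00 y ->
  pairing u (x + y) = pairing u x + pairing u y.
Proof.
move=> /c00P[A xA] /c00P[B yB]; set C := maxn A B.
have cA i : (C <= i)%N -> x i = 0 by rewrite geq_max => /andP[/xA].
have cB i : (C <= i)%N -> y i = 0 by rewrite geq_max => /andP[_ /yB].
rewrite (@pairingE _ x C) => [|i /cA ->]; last by rewrite mulr0.
rewrite (@pairingE _ y C) => [|i /cB ->]; last by rewrite mulr0.
rewrite (@pairingE _ _ C) => [|i iC]; last by rewrite addrfctE cA// cB// addr0 mulr0.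
by rewrite -big_split; apply: eq_bigr => i _; rewrite addrfctE mulrDr.
Qed.

Lemma pairingDl u v x : c00 x ->
  pairing (u + v) x = pairing u x + pairing v x.
Proof.
move=> /c00P[C xC]; rewrite !(@pairingE _ x C) => [||i iC|i iC]; last first.
- by rewrite xC// mulr0.
- by rewrite xC// mulr0.
- by move=> i iC; rewrite xC// mulr0.
by rewrite -big_split; apply: eq_bigr => i _; rewrite addrfctE mulrDl.
Qed.

Lemma pairingZl a u x : c00 x -> pairing (a *: u) x = a * pairing u x.
Proof.
move=> /c00P[C xC]; rewrite !(@pairingE _ x C) => [|i iC|i iC]; last first.
- by rewrite xC// mulr0.
- by rewrite xC// mulr0.
by rewrite mulr_sumr; apply: eq_bigr => i _; rewrite scalrfctE -mulrA.
Qed.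

Lemma pairingZr a u x : c00 x -> pairing u (a *: x) = a * pairing u x.
Proof.
move=> cx; rewrite -pairingZl//; apply: pairing_ext => i.
by rewrite !scalrfctE /GRing.scale /= mulrCA mulrA.
Qed.

Lemma pairing0l x : pairing 0 x = 0.
Proof.
by rewrite (@pairingE _ _ 0%N) ?big_ord0// => i _; rewrite mul0r.
Qed.

Lemma pairing0r u : pairing u 0 = 0.
Proof.
by rewrite (@pairingE _ _ 0%N) ?big_ord0// => i _; rewrite mulr0.
Qed.

Lemma pairing_suml (I : Type) (r : seq I) (P : pred I) (F : I -> nat -> R) x :
  c00 x ->
  pairing (\sum_(i <- r | P i) F i) x = \sum_(i <- r | P i) pairing (F i) x.
Proof.
move=> cx; apply: (big_morph (fun u => pairing u x)); last exact: pairing0l.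
by move=> u v; exact: pairingDl.
Qed.

Lemma pairing_sumr (I : Type) (r : seq I) (P : pred I) (F : I -> nat -> R) u :
  (forall i, P i -> c00 (F i)) ->
  pairing u (\sum_(i <- r | P i) F i) = \sum_(i <- r | P i) pairing u (F i).
Proof.
move=> cF; suff [] : c00 (\sum_(i <- r | P i) F i) /\
  pairing u (\sum_(i <- r | P i) F i) = \sum_(i <- r | P i) pairing u (F i) by [].
apply: (big_rec2 (fun a b => c00 a /\ pairing u a = b)).
  by split; [exact: c00_0|exact: pairing0r].
by move=> i a b Pi [ca <-]; split; [apply: c00D => //; exact: cF|rewrite pairingDr//; exact: cF].
Qed.

Lemma pairing_proj u E x : pairing u (proj E x) = pairing (proj E u) x.
Proof.
by apply: pairing_ext => i; rewrite /proj; case: ifP; rewrite ?mulr0 ?mul0r.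
Qed.

Lemma pairing_supp u E x : supp u `<=` E -> pairing u x = pairing u (proj E x).
Proof. by move=> uE; rewrite pairing_proj proj_id. Qed.

Lemma pairing_unit u i : pairing u (unit_vec R i) = u i.
Proof.
rewrite (@pairingE _ _ i.+1) => [|k ki]; last first.
  by rewrite /unit_vec (gtn_eqF ki) mulr0.
rewrite (bigD1 ord_max)//= /unit_vec eqxx mulr1 big1 ?addr0// => k kn.
by rewrite (_ : (k == i :> nat) = false) ?mulr0//; apply/negbTE.
Qed.

End C00.

(** * Lattice properties of the approximating norms *)
Section Approximants.
Variables (R : realType) (j : nat -> nat) (sigma : seq (nat -> R) -> nat).
Implicit Types x y u : nat -> R.

Notation apx := (gowers_norm_approx j sigma).

Lemma sup_norm_ge x i : (`|x i|%:E <= sup_norm x)%E.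
Proof. by apply: ereal_sup_ubound; exists i. Qed.

Lemma apx_sup N x : (sup_norm x <= apx N x)%E.
Proof. by case: N => [//|N] /=; rewrite /next_norm le_max lexx. Qed.

Lemma apx_ge0 N x : (0 <= apx N x)%E.
Proof.
apply: le_trans (apx_sup N x); apply: le_trans (sup_norm_ge x 0).
by rewrite lee_fin.
Qed.

Lemma next_normP (nrm : (nat -> R) -> \bar R) x (B : R) :
  (next_norm j sigma nrm x <= B%:E)%E <->
  [/\ forall i, `|x i| <= B,
      forall n E, (0 < n)%N -> successive_sets n E ->
        (\sum_(i < n) nrm (proj (E i) x) <= (f (n%:R : R) * B)%:E)%E &
      forall k u, Kset j k -> special_functional j sigma nrm k u ->
        `|pairing u x| <= B].
Proof.
rewrite /next_norm !ge_max; split.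
  move=> /andP[/ereal_supP h1 /andP[/ereal_supP h2 /ereal_supP h3]]; split.
  - by move=> i; rewrite -lee_fin; apply: h1; exists i.
  - move=> n E n0 sE; have fn := fn_gt0 R n0.
    have {}h2 := h2 _ (ex_intro2 _ _ n n0 erefl).
    rewrite EFinM -lee_pdivrMl//; apply: le_trans h2.
    rewrite lee_pmul2l//; last by rewrite lte_fin invr_gt0.
    by apply: ereal_sup_ubound; exists E.
  - by move=> k u kK su; rewrite -lee_fin; apply: h3; exists k, u.
move=> [h1 h2 h3]; apply/andP; split.
  by apply/ereal_supP => _ [i _ <-]; rewrite lee_fin.
apply/andP; split; apply/ereal_supP.
  move=> _ [n n0 <-]; have fn := fn_gt0 R n0.
  rewrite lee_pdivrMl// -EFinM; apply/ereal_supP => _ [E sE <-].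
  exact: h2.
by move=> _ [k [u [kK su ->]]]; rewrite lee_fin; exact: h3 su.
Qed.

Lemma le_dual_norm (nrm nrm' : (nat -> R) -> \bar R) u :
  (forall x, nrm x <= nrm' x)%E -> (dual_norm nrm' u <= dual_norm nrm u)%E.
Proof.
move=> le; apply/ereal_supP => _ [y [cy y1] <-].
by apply: ereal_sup_ubound; exists y => //; split=> //; exact: le_trans y1.
Qed.

Lemma le_Astar (nrm nrm' : (nat -> R) -> \bar R) m u :
  (forall x, nrm x <= nrm' x)%E -> Astar nrm m u -> Astar nrm' m u.
Proof.
move=> le [x [h1 h2 h3]]; exists x; split=> // i im; have [ci di] := h1 i im.
by split=> //; apply: le_trans di; exact: le_dual_norm.
Qed.

Lemma le_special (nrm nrm' : (nat -> R) -> \bar R) k u :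
  (forall x, nrm x <= nrm' x)%E ->
  special_functional j sigma nrm k u -> special_functional j sigma nrm' k u.
Proof.
move=> le [x [[h1 h2 h3 h4] ->]]; exists x; split=> //; split=> //.
  exact: le_Astar h3.
by move=> i ik; apply: le_Astar (h4 i ik).
Qed.

Lemma le_next_norm (nrm nrm' : (nat -> R) -> \bar R) x :
  (forall x, nrm x <= nrm' x)%E ->
  (next_norm j sigma nrm x <= next_norm j sigma nrm' x)%E.
Proof.
move=> le; rewrite /next_norm le_max2 ?le_max2//.
  apply/ereal_supP => _ [n n0 <-]; have fn := fn_gt0 R n0.
  apply: (@le_trans _ _ ((f (n%:R : R))^-1%:E *
        ereal_sup [set (\sum_(i < n) nrm' (proj (E i) x))%E
                  | E in [set E | successive_sets n E]])%E).
    rewrite lee_pmul2l//; last by rewrite lte_fin invr_gt0.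
    apply/ereal_supP => _ [E sE <-]; apply: le_trans (lee_sum _ _) _ => [i _|].
      exact: le.
    by apply: ereal_sup_ubound; exists E.
  by apply: ereal_sup_ubound; exists n.
apply/ereal_supP => _ [k [u [kK su ->]]]; apply: ereal_sup_ubound.
by exists k, u; split=> //; exact: le_special su.
Qed.

Lemma apx_monoS N x : (apx N x <= apx N.+1 x)%E.
Proof.
elim: N x => [|N IH] x; first exact: (apx_sup 1).
exact: le_next_norm.
Qed.

Lemma apx_mono N N' x : (N <= N')%N -> (apx N x <= apx N' x)%E.
Proof.
move=> /subnK <-; elim: (N' - N)%N => [//|d IH].
by rewrite addSn; apply: le_trans IH _; exact: apx_monoS.
Qed.

Lemma apx_le_norm N x : (apx N x <= gowers_norm j sigma x)%E.
Proof. by apply: ereal_sup_ubound; exists N. Qed.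

End Approximants.

Section RealNorm.
Variables (R : realType) (j : nat -> nat) (sigma : seq (nat -> R) -> nat).
Variables (X : completeNormedModType R) (iota : (nat -> R) -> X).
Hypothesis hX : is_completion (gowers_norm j sigma) iota.
Implicit Types x y u : nat -> R.

Notation apx := (gowers_norm_approx j sigma).

(** [gowers_norm] and its approximants are extended-real valued; [nm] and [na] are
    the real numbers that they take as values on c_00. *)
Definition nm x : R := `|iota x|.
Definition na N x : R := fine (apx N x).

Lemma nmE x : c00 x -> gowers_norm j sigma x = (nm x)%:E.
Proof. by move=> cx; case: hX => _ h _; rewrite -h. Qed.

Lemma apxE N x : c00 x -> apx N x = (na N x)%:E.
Proof.
move=> cx; rewrite fineK// ge0_fin_numE ?apx_ge0//.
by apply: le_lt_trans (apx_le_norm _ _ _ _) _; rewrite nmE// ltry.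
Qed.

Lemma na_ge0 N x : 0 <= na N x.
Proof. by rewrite fine_ge0// apx_ge0. Qed.

Lemma na_le_nm N x : c00 x -> na N x <= nm x.
Proof. by move=> cx; rewrite -lee_fin -apxE// -nmE// apx_le_norm. Qed.

Lemma na_mono N N' x : c00 x -> (N <= N')%N -> na N x <= na N' x.
Proof. by move=> cx NN; rewrite -lee_fin -!apxE// apx_mono. Qed.

Lemma nm_le x B : c00 x -> (forall N, na N x <= B) -> nm x <= B.
Proof.
move=> cx h; rewrite -lee_fin -nmE//; apply/ereal_supP => _ [N _ <-].
by rewrite apxE// lee_fin.
Qed.

Lemma na_approx x e : c00 x -> 0 < e -> exists N, nm x - e <= na N x.
Proof.
move=> cx e0; apply: contrapT => /forallNP h.
suff : nm x <= nm x - e by lra.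
by apply: nm_le => // N; have := h N => /negP; rewrite -ltNge => /ltW.
Qed.

Lemma nmD x y : c00 x -> c00 y -> nm (x + y) <= nm x + nm y.
Proof.
move=> cx cy; case: hX => lin _ _; rewrite /nm.
have := lin 1 x y cx cy; rewrite !scale1r => ->.
exact: ler_normD.
Qed.

Lemma iota0 : iota 0 = 0.
Proof.
case: hX => lin _ _; have := lin 1 0 0 (@c00_0 R) (@c00_0 R).
by rewrite !scale1r addr0 => /eqP; rewrite -subr_eq subrr => /eqP <-.
Qed.

Lemma iotaZ a x : c00 x -> iota (a *: x) = a *: iota x.
Proof.
move=> cx; case: hX => lin _ _; have := lin a x 0 cx (@c00_0 R).
by rewrite addr0 iota0 addr0.
Qed.

Lemma iotaD x y : c00 x -> c00 y -> iota (x + y) = iota x + iota y.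
Proof.
move=> cx cy; case: hX => lin _ _; have := lin 1 x y cx cy.
by rewrite !scale1r.
Qed.

Lemma iota_sum (I : Type) (r : seq I) (P : pred I) (F : I -> nat -> R) :
  (forall i, P i -> c00 (F i)) ->
  iota (\sum_(i <- r | P i) F i) = \sum_(i <- r | P i) iota (F i).
Proof.
move=> cF; suff [] : c00 (\sum_(i <- r | P i) F i) /\
  iota (\sum_(i <- r | P i) F i) = \sum_(i <- r | P i) iota (F i) by [].
apply: (big_rec2 (fun a b => c00 a /\ iota a = b)).
  by split; [exact: c00_0|exact: iota0].
move=> i a b Pi [ca <-]; split; first by apply: c00D => //; exact: cF.
by rewrite iotaD//; exact: cF.
Qed.

Lemma nm0 : nm 0 = 0. Proof. by rewrite /nm iota0 normr0. Qed.

Lemma nmZ a x : c00 x -> nm (a *: x) = `|a| * nm x.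
Proof. by move=> cx; rewrite /nm iotaZ// normrZ. Qed.

Lemma nm_ge0 x : 0 <= nm x. Proof. exact: normr_ge0. Qed.

Lemma nm_sum (I : Type) (r : seq I) (P : pred I) (F : I -> nat -> R) :
  (forall i, P i -> c00 (F i)) ->
  nm (\sum_(i <- r | P i) F i) <= \sum_(i <- r | P i) nm (F i).
Proof. by move=> cF; rewrite /nm iota_sum//; exact: ler_norm_sum. Qed.

Lemma na_coord N x i : c00 x -> `|x i| <= na N x.
Proof.
move=> cx; rewrite -lee_fin -apxE//; apply: le_trans (apx_sup _ _ _ _).
exact: sup_norm_ge.
Qed.

Lemma nm_coord x i : c00 x -> `|x i| <= nm x.
Proof. by move=> cx; apply: le_trans (na_coord 0 i cx) (na_le_nm 0 cx). Qed.

Lemma naSP N x B : c00 x ->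
  na N.+1 x <= B <->
  [/\ forall i, `|x i| <= B,
      forall n E, (0 < n)%N -> successive_sets n E ->
        \sum_(i < n) na N (proj (E i) x) <= f (n%:R : R) * B &
      forall k u, Kset j k -> special_functional j sigma (apx N) k u ->
        `|pairing u x| <= B].
Proof.
move=> cx; rewrite -lee_fin -apxE//=.
have sumE n (E : nat -> set nat) : (\sum_(i < n) apx N (proj (E i) x))%E =
    (\sum_(i < n) na N (proj (E i) x))%:E.
  by rewrite -sumEFin; apply: eq_bigr => i _; rewrite apxE//; exact: c00_proj.
split.
  move=> /next_normP[h1 h2 h3]; split=> // n E n0 sE.
  by rewrite -lee_fin -sumE; exact: h2.
move=> [h1 h2 h3]; apply/next_normP; split=> // n E n0 sE.
by rewrite sumE lee_fin; exact: h2.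
Qed.

Lemma na_split N n E x : c00 x -> (0 < n)%N -> successive_sets n E ->
  \sum_(i < n) na N (proj (E i) x) <= f (n%:R : R) * na N.+1 x.
Proof. by move=> cx n0 sE; have [/(_ (lexx _))[_ h _] _] := naSP N (na N.+1 x) cx; exact: h. Qed.

Lemma na_special N k u x : c00 x -> Kset j k ->
  special_functional j sigma (apx N) k u -> `|pairing u x| <= na N.+1 x.
Proof. by move=> cx kK su; have [/(_ (lexx _))[_ _ h] _] := naSP N (na N.+1 x) cx; exact: h su. Qed.

Lemma nm_special N k u x : c00 x -> Kset j k ->
  special_functional j sigma (apx N) k u -> `|pairing u x| <= nm x.
Proof. by move=> cx kK su; apply: le_trans (na_special cx kK su) (na_le_nm _ cx). Qed.

Lemma na_approx_fin n (y : nat -> nat -> R) e :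
  (forall i, (i < n)%N -> c00 (y i)) -> 0 < e ->
  exists N, forall i, (i < n)%N -> nm (y i) - e <= na N (y i).
Proof.
elim: n => [|n IH] cy e0; first by exists 0%N.
have [|//|N hN] := IH; first by move=> i i_n; apply: cy; rewrite ltnS ltnW.
have cn : c00 (y n) by apply: cy.
have [N' hN'] := na_approx cn e0.
exists (maxn N N') => i; rewrite ltnS leq_eqVlt => /orP[/eqP ->|i_n].
  by apply: le_trans hN' _; rewrite na_mono// leq_maxr.
apply: le_trans (hN i i_n) _; rewrite na_mono// ?leq_maxl//.
by apply: cy; rewrite ltnS ltnW.
Qed.

(** The lower f-estimate relates the approximants N and N + 1; it passes to the
    limit since finitely many vectors are approximated at a common level. *)
Lemma nm_split n E x : c00 x -> (0 < n)%N -> successive_sets n E ->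
  \sum_(i < n) nm (proj (E i) x) <= f (n%:R : R) * nm x.
Proof.
move=> cx n0 sE; apply/ler_addgt0Pr => e e0.
have n0R : (0 : R) < n%:R by rewrite ltr0n.
have [N hN] : exists N, forall i, (i < n)%N ->
    nm (proj (E i) x) - e / n%:R <= na N (proj (E i) x).
  apply: na_approx_fin; last by rewrite divr_gt0.
  by move=> i _; exact: c00_proj.
apply: (@le_trans _ _ (\sum_(i < n) (na N (proj (E i) x) + e / n%:R))).
  by apply: ler_sum => i _; rewrite -lerBlDr; apply: hN.
rewrite big_split /= sumr_const card_ord -[X in _ + X <= _]mulr_natl mulrC divfK ?gt_eqF//.
rewrite lerD2r; apply: le_trans (na_split N cx n0 sE) _.
by rewrite ler_wpM2l ?na_le_nm// ltW// fn_gt0.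
Qed.

Definition flip (s : nat -> R) x : nat -> R := fun i => s i * x i.

Lemma supp_flip s x : (forall i, `|s i| = 1) -> supp (flip s x) = supp x.
Proof.
move=> s1; apply/seteqP; split => i; rewrite /supp /= /flip mulf_eq0 negb_or.
  by move=> /andP[].
by move=> ->; rewrite andbT -normr_eq0 s1 oner_eq0.
Qed.

Lemma vabs_flip s x : (forall i, `|s i| = 1) -> vabs (flip s x) = vabs x.
Proof. by move=> s1; apply/funext => i; rewrite /vabs /flip normrM s1 mul1r. Qed.

Lemma c00_flip s x : (forall i, `|s i| = 1) -> c00 x -> c00 (flip s x).
Proof. by move=> s1 cx; rewrite /c00 /= supp_flip. Qed.

Lemma pairing_flip s u x : pairing (flip s u) x = pairing u (flip s x).
Proof. by apply: pairing_ext => i; rewrite /flip mulrA [u i * s i]mulrC. Qed.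

Lemma flip_sum s (I : Type) (r : seq I) (P : pred I) (F : I -> nat -> R) :
  flip s (\sum_(i <- r | P i) F i) = \sum_(i <- r | P i) flip s (F i).
Proof. by apply/funext => i; rewrite /flip !sumfE mulr_sumr. Qed.

Lemma flipZ s a x : flip s (a *: x) = a *: flip s x.
Proof. by apply/funext => i; rewrite /flip !scalrfctE /GRing.scale /= mulrCA. Qed.

Definition sign_fun (s : nat -> R) := forall i, s i = 1 \/ s i = -1.

Lemma sign_fun1 s : sign_fun s -> forall i, `|s i| = 1.
Proof. by move=> hs i; case: (hs i) => ->; rewrite ?normrN1 ?normr1. Qed.

Section FlipInvariance.
Variable N : nat.
Hypothesis naflip : forall s y, sign_fun s -> c00 y -> na N (flip s y) <= na N y.

Lemma dual_flip s u : sign_fun s -> (dual_norm (apx N) u <= 1)%E ->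
  (dual_norm (apx N) (flip s u) <= 1)%E.
Proof.
move=> hs /ereal_supP h; apply/ereal_supP => _ [y [cy y1] <-].
have cfy := c00_flip (sign_fun1 hs) cy.
rewrite pairing_flip; apply: h; exists (flip s y) => //; split=> //.
by apply: le_trans y1; rewrite !apxE// lee_fin; exact: naflip.
Qed.

Lemma Astar_flip s m u : sign_fun s -> Astar (apx N) m u -> Astar (apx N) m (flip s u).
Proof.
move=> hs [x [h1 h2 ->]]; exists (fun i => flip s (x i)); split.
- move=> i im; have [ci di] := h1 i im; split; last exact: dual_flip.
  exact: c00_flip (sign_fun1 hs) ci.
- by move=> i i' ii im /=; rewrite !(supp_flip _ (sign_fun1 hs)); exact: h2.
- by rewrite flipZ flip_sum.
Qed.

(** The codes involve only the moduli of the functionals, so a change of signs does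
    not affect the indices required in a special sequence. *)
Lemma special_flip s k u : sign_fun s ->
  special_functional j sigma (apx N) k u ->
  special_functional j sigma (apx N) k (flip s u).
Proof.
move=> hs [x [[h1 h2 h3 h4] ->]]; have s1 := sign_fun1 hs.
exists (fun i => flip s (x i)); split; last by rewrite flipZ flip_sum.
split.
- move=> i ik; have [ci qi] := h1 i ik; split; first exact: c00_flip.
  move=> n; have [[q qE] xn] := qi n; split; last by rewrite /flip normrM s1 mul1r.
  rewrite /flip; case: (hs n) => ->; first by exists q; rewrite mul1r.
  by exists (- q); rewrite mulN1r qE rmorphN.
- by move=> i i' ii im /=; rewrite !(supp_flip _ s1); exact: h2.
- exact: Astar_flip.
- move=> i ik; rewrite (_ : mkseq _ _ = mkseq (fun l => vabs (x l)) i.+1).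
    by apply: Astar_flip => //; exact: h4.
  by apply: eq_mkseq => l; rewrite vabs_flip.
Qed.

End FlipInvariance.

(** The sets that define the norms are stable under changes of signs
    ([special_flip]); one may thus choose signs making all terms of a pairing
    nonnegative. *)
Lemma na_abs N x y : (forall i, `|x i| <= `|y i|) -> c00 y -> na N x <= na N y.
Proof.
elim: N x y => [|N IH] x y xy cy; have cx := c00_le xy cy.
  rewrite -lee_fin -!apxE//=; apply/ereal_supP => _ [i _ <-].
  by apply: le_trans (sup_norm_ge y i); rewrite lee_fin.
have naflip s z : sign_fun s -> c00 z -> na N (flip s z) <= na N z.
  by move=> hs cz; apply: IH => // i; rewrite /flip normrM (sign_fun1 hs) mul1r.
have [/(_ (lexx _)) [h1 h2 h3] _] := naSP N (na N.+1 y) cy.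
apply/naSP => //; split.
- by move=> i; apply: le_trans (xy i) (h1 i).
- move=> n E n0 sE; apply: le_trans (h2 n E n0 sE); apply: ler_sum => i _.
  apply: IH; last exact: c00_proj.
  by move=> l; rewrite /proj; case: ifP => // _; rewrite normr0.
move=> k u kK su.
pose s i : R := if 0 <= u i * y i then 1 else -1.
have hs : sign_fun s by move=> i; rewrite /s; case: ifP; [left|right].
apply: le_trans (h3 _ _ kK (special_flip naflip hs su)).
have [C xC] : exists C, forall i, (C <= i)%N -> y i = 0 by apply/c00P.
have xC' i : (C <= i)%N -> x i = 0.
  by move=> /xC yi; apply/normr0_eq0/le_anti; rewrite normr_ge0 andbT -(normr0 R) -yi xy.
rewrite (@pairingE _ _ x C) => [|i /xC' ->]; last by rewrite mulr0.
rewrite (@pairingE _ _ y C) => [|i /xC ->]; last by rewrite mulr0.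
apply: le_trans (ler_norm _).
apply: (le_trans (ler_norm_sum _ _ _)); apply: ler_sum => i _.
rewrite normrM; apply: (@le_trans _ _ (`|u i| * `|y i|)); first by rewrite ler_wpM2l.
rewrite -normrM /flip -mulrA /s; case: ifPn => h; first by rewrite mul1r ger0_norm.
by rewrite mulN1r ltr0_norm// ltNge.
Qed.

Lemma nm_abs x y : (forall i, `|x i| <= `|y i|) -> c00 y -> nm x <= nm y.
Proof.
move=> xy cy; have cx := c00_le xy cy; apply: nm_le => // N.
by apply: le_trans (na_abs N xy cy) _; exact: na_le_nm.
Qed.

Lemma nm_proj E x : c00 x -> nm (proj E x) <= nm x.
Proof. by apply: nm_abs => i; exact: proj_abs. Qed.

Lemma na_proj N E x : c00 x -> na N (proj E x) <= na N x.
Proof. by apply: na_abs => i; exact: proj_abs. Qed.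

Lemma naZ_le N a x : c00 x -> na N (a *: x) <= `|a| * na N x.
Proof.
elim: N x => [|N IH] x cx; have cax := c00Z a cx.
  rewrite -lee_fin -apxE//=; apply/ereal_supP => _ [i _ <-].
  by rewrite lee_fin scalrfctE normrM ler_wpM2l// na_coord.
apply/naSP => //; split.
- by move=> i; rewrite scalrfctE normrM ler_wpM2l// na_coord.
- move=> n E n0 sE; apply: (@le_trans _ _ (\sum_(i < n) `|a| * na N (proj (E i) x))).
    by apply: ler_sum => i _; rewrite projZ; apply: IH; exact: c00_proj.
  by rewrite -mulr_sumr mulrCA ler_wpM2l// na_split.
- by move=> k u kK su; rewrite pairingZr// normrM ler_wpM2l// (na_special cx kK su).
Qed.

Lemma dual_le N u y : (dual_norm (apx N) u <= 1)%E -> c00 y -> `|pairing u y| <= na N y.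
Proof.
move=> /ereal_supP h cy.
have [n0|n0] := eqVneq (na N y) 0.
  have -> : y = 0.
    apply/funext => i; apply/normr0_eq0/le_anti; rewrite normr_ge0 andbT.
    by rewrite -n0 na_coord.
  by rewrite pairing0r normr0 na_ge0.
have p0 : 0 < na N y by rewrite lt_neqAle eq_sym n0 na_ge0.
have cz := c00Z (na N y)^-1 cy.
have : (`|pairing u ((na N y)^-1 *: y)|%:E <= 1)%E.
  apply: h; exists ((na N y)^-1 *: y) => //; split=> //.
  rewrite apxE// lee_fin; apply: le_trans (naZ_le _ _ cy) _.
  by rewrite gtr0_norm ?invr_gt0// mulVf.
rewrite lee_fin pairingZr// normrM gtr0_norm ?invr_gt0//.
by rewrite ler_pdivrMl// mulr1.
Qed.

Lemma dualP N u : (forall y, c00 y -> `|pairing u y| <= na N y) ->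
  (dual_norm (apx N) u <= 1)%E.
Proof.
move=> h; apply/ereal_supP => _ [y [cy y1] <-].
by apply: le_trans y1; rewrite apxE// lee_fin h.
Qed.

Lemma dual_abs N u v : (forall i, `|v i| <= `|u i|) ->
  (dual_norm (apx N) u <= 1)%E -> (dual_norm (apx N) v <= 1)%E.
Proof.
move=> uv du; apply: dualP => y cy.
pose s i : R := if 0 <= u i then 1 else -1.
have hs : sign_fun s by move=> i; rewrite /s; case: ifP; [left|right].
pose z i := s i * `|y i|.
have cz : c00 z.
  by apply: c00_le cy => i; rewrite /z normrM (sign_fun1 hs) mul1r normr_id.
apply: le_trans (_ : na N z <= _); last first.
  by apply: na_abs => // i; rewrite /z normrM (sign_fun1 hs) mul1r normr_id.
apply: le_trans (dual_le du cz).
have [C xC] : exists C, forall i, (C <= i)%N -> y i = 0 by apply/c00P.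
rewrite (@pairingE _ _ y C) => [|i /xC ->]; last by rewrite mulr0.
rewrite (@pairingE _ _ z C) => [|i /xC zi]; last by rewrite /z zi normr0 !mulr0.
apply: le_trans (ler_norm _).
apply: (le_trans (ler_norm_sum _ _ _)); apply: ler_sum => i _.
rewrite normrM; apply: (@le_trans _ _ (`|u i| * `|y i|)); first by rewrite ler_wpM2r.
rewrite /z mulrA /s; case: ifPn => h; first by rewrite mulr1 ger0_norm.
by rewrite mulrN1 ltr0_norm// ltNge.
Qed.

End RealNorm.

(** * Norming functionals *)
Lemma sum_atmost1 (R : realType) n (F : nat -> R) B : 0 <= B ->
  (forall l, (l < n)%N -> F l <= B) ->
  (forall l l', (l < l')%N -> (l' < n)%N -> F l = 0 \/ F l' = 0) ->
  \sum_(l < n) F l <= B.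
Proof.
move=> B0 FB Fd.
have [/existsP[l Fl]|/existsPn h] := boolP [exists l : 'I_n, F l != 0]; last first.
  by rewrite big1// => l _; apply/eqP; move: (h l); rewrite negbK.
rewrite (bigD1 l)//= big1 ?addr0; first exact: FB.
move=> l' l'l; apply/eqP; move: l'l; apply: contraLR => Fl'; rewrite negbK.
apply/eqP/val_inj => /=; case: (ltngtP l l') => // ll.
  by case: (Fd _ _ ll (ltn_ord _)) => h; [rewrite h eqxx in Fl|rewrite h eqxx in Fl'].
by case: (Fd _ _ ll (ltn_ord _)) => h; [rewrite h eqxx in Fl'|rewrite h eqxx in Fl].
Qed.

Section Norming.
Variables (R : realType) (j : nat -> nat) (sigma : seq (nat -> R) -> nat).
Variables (X : completeNormedModType R) (iota : (nat -> R) -> X).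
Hypothesis hj : admissible R j.
Hypothesis hX : is_completion (gowers_norm j sigma) iota.
Implicit Types x y u : nat -> R.

Notation apx := (gowers_norm_approx j sigma).
Notation na := (na j sigma).
Notation nm := (nm iota).

Lemma Jset_f k : Jset j k -> 256 < f (k%:R : R).
Proof.
move=> [i /= i0 <-]; case: hj => inc h _; apply: lt_le_trans h _.
apply: ler_f; first by rewrite ler0n.
by rewrite ler_nat; move: i0; rewrite leq_eqVlt => /orP[/eqP <-//|i1]; apply/ltnW/inc.
Qed.

Lemma KJ k : Kset j k -> Jset j k.
Proof. by move=> [i /= oi <-]; exists i => //=; case: i oi. Qed.

Lemma LJ k : Lset j k -> Jset j k.
Proof. by move=> [i /= /andP[i0 oi] <-]; exists i. Qed.

Lemma Jset_gt0 k : Jset j k -> (0 < k)%N.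
Proof.
move=> /Jset_f; rewrite lt0n; apply: contraTneq => ->.
by rewrite f0 ltNge ler0n.
Qed.

Lemma sqrtf_ge16 k : Kset j k -> 16 <= Num.sqrt (f (k%:R : R)).
Proof.
move=> /KJ/Jset_f fk; have -> : 16 = Num.sqrt (256 : R).
  by rewrite (_ : 256 = 16 ^+ 2) ?sqrtr_sqr ?ger0_norm//; ring.
by rewrite ler_wsqrtr// ltW.
Qed.

Lemma sqrtf_gt0 k : Kset j k -> 0 < Num.sqrt (f (k%:R : R)).
Proof. by move=> /sqrtf_ge16; apply: lt_le_trans. Qed.

Lemma successive_sets_disj m (E : nat -> set nat) l l' i :
  successive_sets m E -> (l < m)%N -> (l' < m)%N -> E l i -> E l' i -> l = l'.
Proof.
move=> sE lm lm' El El'; case: (ltngtP l l') => // ll.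
  by have [_ _ /(_ _ _ El El')] := sE _ _ ll lm'; rewrite ltnn.
by have [_ _ /(_ _ _ El' El)] := sE _ _ ll lm; rewrite ltnn.
Qed.

Lemma special_coord nrm k u i : Kset j k ->
  special_functional j sigma nrm k u -> `|u i| <= 1.
Proof.
move=> kK [x [[h1 h2 _ _] ->]]; rewrite scalrfctE normrM.
rewrite ger0_norm ?invr_ge0// ?(ltW (sqrtf_gt0 kK))// ler_pdivrMl ?sqrtf_gt0// mulr1.
apply: le_trans (_ : 1 <= _); last first.
  by apply: le_trans (sqrtf_ge16 kK); rewrite ler1n.
rewrite sumfE; apply: (le_trans (ler_norm_sum _ _ _)).
apply: (sum_atmost1 (F := fun l => `|x l i|)) => //.
  by move=> l lk; have [_ /(_ i) [_ ]] := h1 l lk.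
move=> l l' ll lk; have [xl|xl] := eqVneq (x l i) 0; first by rewrite xl normr0; left.
have [xl'|xl'] := eqVneq (x l' i) 0; first by rewrite xl' normr0; right.
have e := successive_sets_disj h2 (ltn_trans ll lk) lk xl xl'.
by move: ll; rewrite e ltnn.
Qed.

Lemma na0 N : na N 0 = 0.
Proof.
apply/le_anti; rewrite na_ge0 andbT.
have := naZ_le hX N 0 (@c00_0 R); rewrite scale0r normr0 mul0r.
by [].
Qed.

Lemma na_unit N i : na N (unit_vec R i) <= 1.
Proof.
elim: N => [|N IH]; have ci := c00_unit R i.
  rewrite -lee_fin -(apxE hX)//=; apply/ereal_supP => _ [n _ <-].
  by rewrite lee_fin /unit_vec; case: eqP; rewrite ?normr1 ?normr0.
apply/(naSP hX) => //; split.
- by move=> n; rewrite /unit_vec; case: eqP; rewrite ?normr1 ?normr0.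
- move=> n E n0 sE; rewrite mulr1.
  have f1n : 1 <= f (n%:R : R) by exact: fn_ge1.
  apply: le_trans f1n; apply: (sum_atmost1 (F := fun l => na N (proj (E l) (unit_vec R i)))) => //.
    by move=> l ln; apply: le_trans IH; exact: (na_proj hX N (E l) ci).
  have z l : ~ E l i -> na N (proj (E l) (unit_vec R i)) = 0.
    move=> Eli; rewrite proj_disj ?na0// => n' En'; rewrite /unit_vec.
    by case: eqP => // e; rewrite e in En'.
  move=> l l' ll ln.
  have [El|/z] := pselect (E l i); last by left.
  have [El'|/z] := pselect (E l' i); last by right.
  have e := successive_sets_disj sE (ltn_trans ll ln) ln El El'.
  by move: ll; rewrite e ltnn.
- by move=> k u kK su; rewrite pairing_unit; exact: special_coord su.
Qed.

Lemma nm_unit i : nm (unit_vec R i) = 1.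
Proof.
apply/le_anti/andP; split.
  by apply: (nm_le hX (c00_unit R i)) => N; exact: na_unit.
have := nm_coord hX i (c00_unit R i); rewrite /unit_vec eqxx normr1.
by [].
Qed.

Lemma Astar_le N m z y : (0 < m)%N -> Astar (apx N) m z -> c00 y ->
  exists2 F, successive_sets m F &
    forall y, c00 y -> `|pairing z y| <= (f (m%:R : R))^-1 * \sum_(l < m) na N (proj (F l) y).
Proof.
move=> m0 [x [h1 h2 ->]] _; exists (fun l => supp (x l)) => // {}y cy.
rewrite pairingZl// normrM ger0_norm ?invr_ge0 ?(ltW (fn_gt0 R m0))//.
rewrite ler_wpM2l ?invr_ge0 ?(ltW (fn_gt0 R m0))// pairing_suml//.
apply: (le_trans (ler_norm_sum _ _ _)); apply: ler_sum => l _.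
have [cl dl] := h1 l (ltn_ord l).
rewrite (pairing_supp (E := supp (x l)))//.
by apply: (dual_le hX) => //; exact: c00_proj.
Qed.

Lemma Astar_dual N m z : (0 < m)%N -> Astar (apx N) m z ->
  (dual_norm (apx N.+1) z <= 1)%E.
Proof.
move=> m0 zA; apply: (dualP hX) => y cy.
have [F sF zF] := Astar_le m0 zA cy.
apply: le_trans (zF y cy) _; rewrite ler_pdivrMl ?fn_gt0//.
exact: (na_split hX).
Qed.

Lemma Astar_nm N m z y : (0 < m)%N -> Astar (apx N) m z -> c00 y ->
  `|pairing z y| <= nm y.
Proof.
move=> m0 zA cy; apply: le_trans (na_le_nm hX N.+1 cy).
by apply: (dual_le hX) => //; exact: Astar_dual zA.
Qed.

Lemma supp_coord_functional N x i r : c00 x -> r < `|x i| -> 0 <= r ->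
  exists u, [/\ c00 u, (dual_norm (apx N) u <= 1)%E, supp u `<=` supp x & r < pairing u x].
Proof.
move=> cx rx r0; pose s : R := if 0 <= x i then 1 else -1.
have s1 : `|s| = 1 by rewrite /s; case: ifP; rewrite ?normrN1 ?normr1.
exists (s *: unit_vec R i); split.
- by apply: c00Z; exact: c00_unit.
- apply: (dualP hX) => y cy; rewrite pairingZl// normrM s1 mul1r.
  have -> : pairing (unit_vec R i) y = y i.
    rewrite -(pairing_unit y i); apply: pairing_ext => n.
    by rewrite /unit_vec mulrC.
  exact: (na_coord hX N i cy).
- move=> n; rewrite /supp /= scalrfctE /unit_vec; case: (n =P i) => [-> _|_]; last first.
    by rewrite scaler0 eqxx.
  by rewrite -normr_gt0; apply: le_lt_trans rx.
- rewrite pairingZl//.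
  have -> : pairing (unit_vec R i) x = x i.
    rewrite -(pairing_unit x i); apply: pairing_ext => n.
    by rewrite /unit_vec mulrC.
  apply: lt_le_trans rx _; rewrite /s; case: ifPn => h; first by rewrite mul1r ger0_norm.
  by rewrite mulN1r ltr0_norm// ltNge.
Qed.

(** Induction on N: functionals norming n pieces are added and divided by f n, and
    a special functional of the norm at level N is itself in the dual ball at
    level N + 1. *)
Lemma norming N x r : c00 x -> 0 <= r -> r < na N x ->
  exists u, [/\ c00 u, (dual_norm (apx N) u <= 1)%E, supp u `<=` supp x & r < pairing u x].
Proof.
elim: N x r => [|N IH] x r cx r0 rx.
  apply: contrapT => hn; suff : na 0 x <= r by rewrite leNgt rx.
  rewrite -lee_fin -(apxE hX)//=; apply/ereal_supP => _ [i _ <-].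
  rewrite lee_fin leNgt; apply/negP => ri; apply: hn.
  exact: supp_coord_functional ri r0.
apply: contrapT => hn; suff : na N.+1 x <= r by rewrite leNgt rx.
apply/(naSP hX) => //; split.
- move=> i; rewrite leNgt; apply/negP => ri; apply: hn.
  exact: supp_coord_functional ri r0.
- move=> n E n0 sE; rewrite leNgt; apply/negP => hr; apply: hn.
  have fn := fn_gt0 R n0.
  have nR : (0 : R) < n%:R by rewrite ltr0n.
  set s := \sum_(i < n) na N (proj (E i) x) in hr.
  pose d := (s - f (n%:R : R) * r) / (2 * n%:R).
  have d0 : 0 < d by rewrite divr_gt0 ?subr_gt0 ?mulr_gt0.
  have /choice[v hv] : forall i, exists v, [/\ c00 v, (dual_norm (apx N) v <= 1)%E,
      supp v `<=` supp (proj (E i) x) & na N (proj (E i) x) - d <= pairing v (proj (E i) x)].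
    move=> i; have [ni|ni] := leP (na N (proj (E i) x)) 0.
      exists 0; split.
      - exact: c00_0.
      - by apply: (dualP hX) => y cy; rewrite pairing0l normr0 na_ge0.
      - by move=> l; rewrite /supp /= eqxx.
      - by rewrite pairing0l; lra.
    have [|||v [cv dv sv pv]] := IH (proj (E i) x) (Num.max 0 (na N (proj (E i) x) - d)).
    - exact: c00_proj.
    - by rewrite le_max lexx.
    - by rewrite gt_max ni /= ltrBlDr ltrDl.
    exists v; split=> //; apply: le_trans (ltW pv).
    by rewrite le_max lexx orbT.
  have vE i y : c00 y -> pairing (v i) y = pairing (v i) (proj (E i) y).
    move=> cy; apply: pairing_supp; have [_ _ sv _] := hv i.
    by move=> l /sv /supp_proj[].
  exists ((f (n%:R : R))^-1 *: \sum_(i < n) v i); split.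
  - by apply: c00Z; apply: c00_sum => i _; have [] := hv i.
  - apply: (dualP hX) => y cy; rewrite pairingZl// normrM gtr0_norm ?invr_gt0//.
    rewrite ler_pdivrMl// pairing_suml//; apply: (le_trans (ler_norm_sum _ _ _)).
    apply: le_trans (na_split hX N cy n0 sE); apply: ler_sum => i _.
    rewrite vE//; apply: (dual_le hX); first by have [] := hv i.
    exact: c00_proj.
  - move=> l; rewrite /supp /= scalrfctE sumfE scaler_eq0 invr_eq0 gt_eqF//=.
    apply: contra => /eqP xl; apply/eqP; apply: big1 => i _.
    apply/eqP; apply/negPn/negP => /= vl; have [_ _ sv _] := hv i.
    by have /supp_proj[_] := sv _ vl; rewrite /supp /= xl eqxx.
  - rewrite pairingZl// ltr_pdivlMl// pairing_suml//.
    apply: (@lt_le_trans _ _ (\sum_(i < n) (na N (proj (E i) x) - d))).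
      rewrite sumrB sumr_const card_ord -/s -[X in _ < _ - X]mulr_natl /d.
      have -> : n%:R * ((s - f (n%:R : R) * r) / (2 * n%:R)) = (s - f (n%:R : R) * r) / 2.
        by field; rewrite gt_eqF.
      lra.
    by apply: ler_sum => i _; rewrite vE//; have [] := hv i.
- move=> k u kK su; rewrite leNgt; apply/negP => hr; apply: hn.
  pose s : R := if 0 <= pairing u x then 1 else -1.
  have s1 : `|s| = 1 by rewrite /s; case: ifP; rewrite ?normrN1 ?normr1.
  exists (s *: proj (supp x) u); split.
  - apply: (sub_finite_set _ cx) => l; rewrite /supp /= scalrfctE.
    rewrite scaler_eq0 negb_or => /andP[_ pl].
    by have [] := supp_proj pl.
  - apply: (dualP hX) => y cy; rewrite pairingZl// normrM s1 mul1r -pairing_proj.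
    have cpy := c00_proj (supp x) cy.
    by apply: le_trans (na_special hX cpy kK su) _; exact: (na_proj hX _ _ cy).
  - move=> l; rewrite /supp /= scalrfctE scaler_eq0 negb_or => /andP[_ pl].
    by have [] := supp_proj pl.
  - rewrite pairingZl// -pairing_proj proj_id//.
    apply: lt_le_trans hr _; rewrite /s; case: ifPn => h; first by rewrite mul1r ger0_norm.
    by rewrite mulN1r ltr0_norm// ltNge.
Qed.

End Norming.

(** * Blocks equivalent to the basis of l1 *)
Definition ordered (R : realType) (m : nat) (x : nat -> nat -> R) : Prop :=
  forall i i', (i < i')%N -> (i' < m)%N ->
    forall a b, supp (x i) a -> supp (x i') b -> (a < b)%N.

(** Successive supports are disjoint: at each coordinate at most one term lives. *)
Lemma ordered_one (R : realType) m (x : nat -> nat -> R) n : (0 < m)%N ->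
  ordered m x -> exists l : 'I_m, forall i : 'I_m, i != l -> x i n = 0.
Proof.
move=> m0 xo.
have [/existsP[l xl]|/existsPn h] := boolP [exists l : 'I_m, x l n != 0]; last first.
  by exists (Ordinal m0) => i _; apply/eqP; move: (h i); rewrite negbK.
exists l => i il; apply/eqP; move: il; apply: contraLR => xi; rewrite negbK.
apply/eqP/val_inj; case: (ltngtP i l) => // h.
  by have := xo _ _ h (ltn_ord _) n n xi xl; rewrite ltnn.
by have := xo _ _ h (ltn_ord _) n n xl xi; rewrite ltnn.
Qed.

Lemma ordered_sum_abs (R : realType) m (x y : nat -> nat -> R) n : (0 < m)%N ->
  ordered m y -> (forall i, (i < m)%N -> `|x i n| <= `|y i n|) ->
  `|(\sum_(i < m) x i) n| <= `|(\sum_(i < m) y i) n|.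
Proof.
move=> m0 yo xy; have [l yl] := ordered_one n m0 yo.
rewrite !sumfE (bigD1 l)//= [X in _ <= `|X|](bigD1 l)//= !big1 ?addr0; first exact: xy.
- by move=> i il; exact: yl.
- move=> i il; apply/normr0_eq0/le_anti; rewrite normr_ge0 andbT.
  by rewrite -(normr0 R) -(yl i il) xy.
Qed.

Lemma orderedZ (R : realType) m (a : nat -> R) (x : nat -> nat -> R) :
  ordered m x -> ordered m (fun i => a i *: x i).
Proof.
move=> xo i i' ii im c d; rewrite /supp /= !scalrfctE !scaler_eq0 !negb_or.
by move=> /andP[_ xc] /andP[_ xd]; exact: (xo i i').
Qed.

Lemma f_le_pow (R : realType) (x : R) n : 0 <= x -> x + 1 <= 2 ^+ n -> f x <= n%:R.
Proof.
move=> x0 xn; rewrite /f ler_pdivrMr ?ln2_gt0'// mulr_natl -lnXn//.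
by rewrite ler_ln ?posrE//; lra.
Qed.

Section James.
Variables (R : realType) (j : nat -> nat) (sigma : seq (nat -> R) -> nat).
Variables (X : completeNormedModType R) (iota : (nat -> R) -> X).
Hypothesis hj : admissible R j.
Hypothesis hX : is_completion (gowers_norm j sigma) iota.
Notation nm := (nm iota).

(** Scale the coefficients so that the largest modulus is 1. Replacing the
    coefficient 1 of the i-th vector by b_i costs at most 1 - b_i, so that the
    norm is at least the sum of the b_i minus 1/2, and this sum is at least 1. *)
Lemma l1_of_flat N (u : nat -> nat -> R) (a : nat -> R) : (0 < N)%N ->
  (forall i, (i < N)%N -> c00 (u i)) -> ordered N u ->
  (forall i, (i < N)%N -> nm (u i) <= 1) ->
  N%:R - 2^-1 <= nm (\sum_(i < N) u i) ->
  2^-1 * \sum_(i < N) `|a i| <= nm (\sum_(i < N) a i *: u i).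
Proof.
move=> N0 cu uo u1 flat.
have cs (b : nat -> R) : c00 (\sum_(i < N) b i *: u i).
  by apply: c00_sum => i _; apply: c00Z; exact: cu.
have [l _ lmax] := @arg_maxP _ _ _ (Ordinal N0) predT (fun i : 'I_N => `|a i|) erefl.
set M := `|a l| in lmax.
have [M0|M0] := eqVneq M 0.
  rewrite big1 ?mulr0 ?nm_ge0// => i _; apply/le_anti; rewrite normr_ge0 andbT -M0.
  exact: lmax.
have Mp : 0 < M by rewrite lt_neqAle eq_sym M0 /= normr_ge0.
apply: le_trans (_ : nm (\sum_(i < N) `|a i| *: u i) <= _); last first.
  apply: (nm_abs hX) => // n; apply: (ordered_sum_abs (x := fun i => `|a i| *: u i) (y := fun i => a i *: u i)) => //; first exact: orderedZ.
  by move=> i _; rewrite !scalrfctE !normrM normr_id.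
pose b i := `|a i| / M.
have -> : \sum_(i < N) `|a i| *: u i = M *: \sum_(i < N) b i *: u i.
  rewrite scaler_sumr; apply: eq_bigr => i _; rewrite scalerA /b; congr (_ *: _).
  by rewrite mulrC divfK.
rewrite (nmZ hX)// gtr0_norm//.
have bN (i : 'I_N) : 0 <= b i <= 1.
  by rewrite /b divr_ge0 ?(ltW Mp)//= ler_pdivrMr// mul1r; exact: lmax.
have sb : 1 <= \sum_(i < N) b i.
  rewrite (bigD1 l)//= {1}/b divff// lerDl; apply: sumr_ge0 => i _.
  by have /andP[] := bN i.
have low : \sum_(i < N) b i - 2^-1 <= nm (\sum_(i < N) b i *: u i).
  have e : \sum_(i < N) u i = \sum_(i < N) b i *: u i + \sum_(i < N) (1 - b i) *: u i.
    by rewrite -big_split; apply: eq_bigr => i _ /=; rewrite -scalerDl [b i + _]addrC subrK scale1r.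
  have : nm (\sum_(i < N) u i) <= nm (\sum_(i < N) b i *: u i) + \sum_(i < N) (1 - b i).
    rewrite {1}e; apply: (le_trans (nmD hX (cs b) (cs (fun i => 1 - b i)))).
    have cb (i : 'I_N) : true -> c00 ((1 - b i) *: u i) by move=> _; apply: c00Z; exact: cu.
    rewrite lerD2l; apply: (le_trans (nm_sum hX _ cb)).
    apply: ler_sum => i _; rewrite (nmZ hX) ?cu//; last exact: cu.
    have /andP[b0 b1] := bN i; rewrite ger0_norm ?subr_ge0//.
    by rewrite ler_piMr ?subr_ge0// u1.
  rewrite sumrB sumr_const card_ord; lra.
have -> : \sum_(i < N) `|a i| = M * \sum_(i < N) b i.
  by rewrite mulr_sumr; apply: eq_bigr => i _; rewrite /b mulrC divfK.
rewrite mulrCA ler_pM2l//; lra.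
Qed.

Definition blk (p n : nat) : nat -> R := fun i => ((p <= i) && (i < p + n))%N%:R.

Lemma c00_blk p n : c00 (blk p n).
Proof.
apply/c00P; exists (p + n)%N => i ni; rewrite /blk.
by rewrite [(i < _)%N]ltnNge ni andbF.
Qed.

Lemma supp_blk p n i : supp (blk p n) i <-> (p <= i < p + n)%N.
Proof.
rewrite /supp /blk /=; case: (_ && _); split => //; first by rewrite oner_neq0.
by rewrite eqxx.
Qed.

Lemma blk_sum p n N : blk p (N * n) = \sum_(i < N) blk (p + i * n) n.
Proof.
elim: N => [|N IH].
  rewrite big_ord0; apply/funext => i; rewrite /blk mul0n addn0.
  by rewrite [(i < _)%N]ltnNge andbN.
rewrite big_ord_recr /= -IH; apply/funext => i; rewrite addrfctE /blk mulSn.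
rewrite -addnA [(N * n + n)%N]addnC.
have [pi|ip] /= := leqP p i; last first.
  by rewrite [X in (X && _)](_ : _ = false) ?addr0//; apply/negbTE; rewrite -ltnNge (leq_trans ip)// leq_addr.
have [h|h] := ltnP i (p + N * n).
  rewrite (_ : (i < _)%N = true); last by apply: leq_trans h _; rewrite leq_add2l leq_addl.
  by rewrite addr0.
by rewrite add0r.
Qed.

Lemma blk_lower p n : (0 < n)%N -> n%:R <= f (n%:R : R) * nm (blk p n).
Proof.
move=> n0.
have := @nm_split _ _ _ _ _ hX n (fun i => [set (p + i)%N]) (blk p n) (c00_blk p n) n0.
move=> h; apply: le_trans (h _).
  rewrite (eq_bigr (fun=> 1)) ?sumr_const ?card_ord// => i _.
  rewrite (_ : proj _ _ = unit_vec R (p + i)) ?(nm_unit hj hX)//.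
  apply/funext => l; rewrite /unit_vec; case: eqP => [->|li].
    by rewrite proj_in// /blk leq_addr ltn_add2l ltn_ord.
  by rewrite proj_notin.
move=> i i' ii _; split; [by exists (p + i)%N|by exists (p + i')%N|].
by move=> _ _ -> ->; rewrite ltn_add2l.
Qed.

(** If no such vectors existed, [l1_of_flat] would bound the norm of the indicator
    of N^r consecutive integers by (N - 1/2)^r, for every r; but this norm is at
    least N^r / f (N^r), and f (N^r) grows only linearly in r. *)
Theorem james N q : (0 < N)%N -> exists u : nat -> nat -> R,
  [/\ forall i, (i < N)%N -> c00 (u i), ordered N u,
      forall i n, (i < N)%N -> supp (u i) n -> (q <= n)%N,
      forall i, (i < N)%N -> nm (u i) <= 1 &
      forall a : nat -> R, 2^-1 * \sum_(i < N) `|a i| <= nm (\sum_(i < N) a i *: u i)].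
Proof.
move=> N0; apply: contrapT => hn.
have NR : 1 <= N%:R :> R by rewrite ler1n.
pose c : R := N%:R - 2^-1.
have c0 : 0 < c by rewrite /c; lra.
have up r p : (q <= p)%N -> nm (blk p (N ^ r)) <= c ^+ r.
  elim: r p => [|r IH] p qp.
    rewrite expn0 expr0 -[leRHS](nm_unit hj hX p) le_eqVlt; apply/orP; left.
    apply/eqP; congr nm; apply/funext => i.
    by rewrite /blk /unit_vec addn1 ltnS -eqn_leq eq_sym.
  pose u i := (c ^+ r)^-1 *: blk (p + i * N ^ r) (N ^ r).
  have cr : 0 < c ^+ r by rewrite exprn_gt0.
  have cu i : c00 (u i) by apply: c00Z; exact: c00_blk.
  have uo : ordered N u.
    apply: orderedZ => i i' ii _ a b /supp_blk/andP[_ ha] /supp_blk/andP[hb _].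
    apply: leq_trans ha (leq_trans _ hb); rewrite -addnA leq_add2l addnC -mulSn.
    by rewrite leq_mul2r ii orbT.
  have u1 i : (i < N)%N -> nm (u i) <= 1.
    move=> _; rewrite (nmZ hX) ?gtr0_norm ?invr_gt0 ?ler_pdivrMl ?mulr1//; last exact: c00_blk.
    by apply: IH; apply: leq_trans qp _; exact: leq_addr.
  have su : \sum_(i < N) u i = (c ^+ r)^-1 *: blk p (N ^ r.+1).
    by rewrite expnS blk_sum scaler_sumr.
  rewrite leNgt; apply/negP => big; apply: hn; exists u; split=> //.
    move=> i n iN; rewrite /supp /u /= scalrfctE scaler_eq0 negb_or => /andP[_].
    move=> /supp_blk/andP[h _]; apply: leq_trans qp (leq_trans _ h).
    exact: leq_addr.
  move=> a; apply: (l1_of_flat (u := u)) => //; rewrite su (nmZ hX); last exact: c00_blk.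
  by rewrite gtr0_norm ?invr_gt0// ler_pdivlMl// -exprSr ltW.
have key r : (0 < r)%N -> (N ^ r)%:R <= (r * N + 1)%:R * c ^+ r.
  move=> r0; have Nr : (0 < N ^ r)%N by rewrite expn_gt0 N0.
  apply: le_trans (blk_lower q Nr) _; apply: ler_pM; rewrite ?nm_ge0 ?f_ge0 ?ler0n//.
    apply: f_le_pow; first by rewrite ler0n.
    rewrite addn1 exprS natr1 -natrX -natrM ler_nat.
    have : (N ^ r <= 2 ^ (r * N))%N.
      by rewrite mulnC expnM leq_exp2r// ltnW// ltn_expl.
    move=> h; apply: leq_trans (_ : 2 ^ (r * N) + 2 ^ (r * N) <= _)%N; last by rewrite addnn mul2n.
    by rewrite -addn1 leq_add// expn_gt0.
  exact: up.
pose h : R := (2 * N%:R)^-1.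
have h0 : 0 < h by rewrite invr_gt0 mulr_gt0//; lra.
have ch : c * (1 + h) <= N%:R.
  rewrite /c mulrDr mulr1 mulrBl.
  have -> : N%:R * h = 2^-1 by rewrite /h; field; lra.
  have := h0; lra.
have key2 r : (0 < r)%N -> (1 + h) ^+ r <= (r * N + 1)%:R.
  move=> r0; have cr : 0 < c ^+ r by rewrite exprn_gt0.
  rewrite -(ler_pM2r cr); apply: le_trans (key r r0).
  rewrite -exprMn natrX [_ * c]mulrC; apply: lerXn2r => //; rewrite nnegrE ?ler0n//.
  by rewrite mulr_ge0 ?(ltW c0)//; lra.
have bern r : 1 + r%:R * h <= (1 + h) ^+ r.
  elim: r => [|r IH]; first by rewrite mul0r addr0.
  rewrite exprS; apply: le_trans (_ : (1 + h) * (1 + r%:R * h) <= _); last first.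
    by rewrite ler_wpM2l//; lra.
  rewrite -natr1 !mulrDr !mulrDl !mul1r mulr1.
  have : 0 <= h * (r%:R * h) by rewrite !mulr_ge0 ?ler0n// ltW.
  lra.
pose r := (Num.truncn ((2 * N%:R + 1) / h ^+ 2)).+1.
have r0 : (0 < r)%N by [].
have rR : 1 <= r%:R :> R by rewrite ler1n.
have rb : (2 * N%:R + 1) < r%:R * h ^+ 2.
  by rewrite -ltr_pdivrMr ?exprn_gt0//; exact: truncnS_gt.
have := key2 (2 * r)%N; rewrite muln_gt0 /= => /(_ r0).
rewrite mulnC exprM => k2.
have : (r%:R * h) ^+ 2 <= (2 * r%:R * N%:R + 1).
  apply: le_trans (_ : ((1 + h) ^+ r) ^+ 2 <= _).
    apply: lerXn2r; rewrite ?nnegrE ?mulr_ge0 ?ler0n ?exprn_ge0 ?(ltW h0)//; first by lra.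
    by apply: le_trans (bern r); rewrite lerDr.
  by apply: le_trans k2 _; rewrite natrD !natrM [X in X * _ + _]mulrC.
have : r%:R * (2 * N%:R + 1) < r%:R * (r%:R * h ^+ 2) by rewrite ltr_pM2l//; lra.
rewrite exprMn; lra.
Qed.

End James.

(** * Growth of the codes *)
Section Coding.
Variables (R : realType) (j : nat -> nat) (sigma : seq (nat -> R) -> nat).
Hypothesis hj : admissible R j.
Hypothesis hsigma : coding_function j sigma.
Implicit Types x y u : nat -> R.

Lemma ln2_ge : 2^-1 <= ln (2 : R).
Proof.
have := expR_ge1Dx (- 2^-1 : R).
rewrite expRN => h.
have e0 : 0 < expR (2^-1 : R) by exact: expR_gt0.
have h2 : expR (2^-1 : R) <= 2.
  have : (1 + - 2^-1) * expR 2^-1 <= 1 :> R.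
    by rewrite -ler_pdivlMr// div1r.
  lra.
by rewrite -[leLHS]expRK ler_ln ?posrE.
Qed.


Lemma f_le_double (x : R) : 0 <= x -> f x <= 2 * x.
Proof.
move=> x0; have l2 := ln2_ge; rewrite /f ler_pdivrMr; last by lra.
rewrite addrC; apply: le_trans (le_ln1Dx _) _; first by lra.
have : 0 <= x * (2 * ln 2 - 1) by rewrite mulr_ge0//; lra.
lra.
Qed.

Lemma Qset_vabs x : Qset x -> Qset (vabs x).
Proof.
move=> [cx hx]; split.
  by apply: c00_le cx => i; rewrite /vabs normr_id.
move=> i; have [[q qE] x1] := hx i; split; last by rewrite /vabs normr_id.
by exists `|q|; rewrite /vabs qE ratr_norm.
Qed.

Lemma supp_vabs x : supp (vabs x) = supp x.
Proof.
by apply/seteqP; split => i; rewrite /supp /vabs /= normr_eq0.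
Qed.

Lemma Qseqs_mkseq (z : nat -> nat -> R) n : (0 < n)%N ->
  (forall i, (i < n)%N -> Qset (z i)) -> successive n z ->
  Qseqs (mkseq (fun l => vabs (z l)) n).
Proof.
move=> n0 zQ zs; split; rewrite size_mkseq//.
  by move=> i i_n; rewrite nth_mkseq//; apply/Qset_vabs/zQ.
move=> i i' ii i'n /=; rewrite !nth_mkseq ?(ltn_trans ii)// !supp_vabs.
exact: zs.
Qed.

Lemma vabs_sum_supp (z : nat -> nat -> R) n i l : (i < n)%N ->
  supp (z i) l -> supp (\sum_(x <- mkseq (fun l => vabs (z l)) n) x) l.
Proof.
move=> i_n zl; rewrite /supp /= big_map fct_sumE /=.
rewrite gt_eqF//; have : 0 < vabs (z i) l by rewrite normr_gt0.
move/lt_le_trans; apply.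
rewrite (big_rem i) ?mem_iota//= lerDl; apply: sumr_ge0 => h _.
exact: normr_ge0.
Qed.

Lemma Astar_supp_card nrm m u (A : set nat) : (1 < m)%N -> Astar nrm m u ->
  finite_set A -> supp u `<=` A -> (m <= #|` fset_set A|%fset)%N.
Proof.
move=> m1 [x [h1 h2 uE]] fA uA.
have m0 : (0 < m)%N by exact: ltnW.
have ne l : (l < m)%N -> exists c, supp (x l) c.
  move=> lm; have [l0|l0] := posnP l.
    by have [/set0P/set0P[c xc] _ _] := h2 l 1%N ltac:(by rewrite l0) m1; exists c.
  by have [_ [c xc] _] := h2 0%N l l0 lm; exists c.
have /choice[c hc] : forall l, exists c, (l < m)%N -> supp (x l) c.
  move=> l; case: (ltnP l m) => lm; last by exists 0%N.
  by have [c xc] := ne l lm; exists c.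
have cu l : (l < m)%N -> supp u (c l).
  move=> lm; rewrite uE /supp /= scalrfctE scaler_eq0 invr_eq0 gt_eqF ?fn_gt0//=.
  rewrite sumfE (bigD1 (Ordinal lm))//= big1 ?addr0; first exact: hc.
  move=> l' l'l; apply/eqP; apply: contra_neqT l'l => xl'; apply/val_inj => /=.
  exact: (successive_sets_disj h2 (ltn_ord _) lm xl' (hc _ lm)).
have -> : m = size (map c (iota 0 m)) by rewrite size_map size_iota.
apply: uniq_leq_size.
  rewrite map_inj_in_uniq ?iota_uniq// => a b; rewrite !mem_iota /= add0n => am bm e.
  apply: (successive_sets_disj h2 am bm (hc _ am)).
  by rewrite e; apply: hc.
move=> n /mapP[l]; rewrite mem_iota /= add0n => lm ->.
by rewrite in_fset_set// mem_set//; apply/uA/cu.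
Qed.

Lemma Jset_gt1 k : Jset j k -> (1 < k)%N.
Proof.
move=> kJ; have := Jset_f hj kJ; rewrite ltnNge; apply: contraL => k1.
rewrite -leNgt; apply: le_trans (_ : 1 <= _); last by rewrite ler1n.
by rewrite -[leRHS]f1; apply: ler_f; rewrite ?ler0n ?lern1.
Qed.

Lemma Jset_j i : (0 < i)%N -> Jset j (j i).
Proof. by move=> i0; exists i. Qed.

(** An element of A_m has at least m points in its support, and the code exceeds
    the length of the supports by far: all indices of a special sequence after
    the first are larger than the first. *)
Lemma sigma_big nrm (z : nat -> nat -> R) k i : (i.+1 < k)%N ->
  (forall i, (i < k)%N -> Qset (z i)) -> successive k z ->
  Astar nrm (j (2 * k)) (z 0%N) ->
  (j (2 * k) < sigma (mkseq (fun l => vabs (z l)) i.+1))%N.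
Proof.
move=> ik zQ zs zA; set m := j (2 * k); set S := sigma _.
have k0 : (0 < k)%N by case: k ik {zQ zs zA m}.
have mJ : Jset j m by apply: Jset_j; rewrite muln_gt0.
have m1 := Jset_gt1 mJ.
case: hsigma => sL _ sB.
have zs' : Qseqs (mkseq (fun l => vabs (z l)) i.+1).
  apply: Qseqs_mkseq => //.
    by move=> l li; apply: zQ; apply: leq_trans li _; exact: ltnW.
  by move=> l l' ll li; apply: zs => //; apply: leq_trans li _; exact: ltnW.
have S0 : (0 < S)%N by apply: (Jset_gt0 hj); apply: LJ; exact: sL.
have := sB _ zs'; set A := interval_hull _.
have fA : finite_set A.
  have : c00 (\sum_(x <- mkseq (fun l => vabs (z l)) i.+1) x).
    rewrite big_map big_seq; apply: c00_sum => l; rewrite mem_iota add0n /= => li.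
    by have [] := Qset_vabs (zQ l (leq_trans li (ltnW ik))).
  move=> /c00P[B hB]; apply: (sub_finite_set _ (finite_II B)) => n.
  move=> [a [b [_ sb /andP[_ nb]]]] /=; apply: leq_ltn_trans nb _.
  by rewrite ltnNge; apply/negP => /hB; move/eqP: sb.
have subA : supp (z 0%N) `<=` A.
  move=> n zn; exists n, n; rewrite leqnn.
  by split=> //; exact: vabs_sum_supp zn.
have := Astar_supp_card m1 zA fA subA.
rewrite -(ler_nat R) => h1 h2; have {h1 h2} := le_trans h1 h2.
set y := _ `^ _; move=> h.
have y1 : 1 <= y.
  rewrite (_ : 1 = 1 `^ 40^-1); last by rewrite powR1.
  apply: ge0_ler_powR; rewrite ?nnegrE ?ler0n//.
  by rewrite ler1n.
have yS : y <= S%:R.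
  rewrite /y -[leRHS]powRr1 ?ler0n//; apply: ler_powR; first by rewrite ler1n.
  by rewrite invf_le1// ler1n.
have fy : f y <= 2 * y by apply: f_le_double; lra.
have mR : (2 : R) <= m%:R by rewrite ler_nat.
have sq : 0 <= Num.sqrt (f y) by exact: sqrtr_ge0.
have h3 : (20 * m%:R) ^+ 2 <= 2 * y.
  apply: le_trans fy; rewrite -[leRHS]sqr_sqrtr ?f_ge0//; last by lra.
  apply: lerXn2r; rewrite ?nnegrE//; lra.
have : m%:R < S%:R :> R.
  apply: lt_le_trans yS.
  have : 2 * m%:R <= m%:R * m%:R :> R by rewrite ler_wpM2r// ler0n.
  rewrite exprMn expr2 in h3; lra.
by rewrite ltr_nat.
Qed.

End Coding.

(** * Slow growth of f *)
Section Growth.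
Variable R : realType.

Lemma f_pow (a b : nat) (x y : R) : 0 <= x -> 0 <= y ->
  (y + 1) ^+ a <= (x + 1) ^+ b -> a%:R * f y <= b%:R * f x.
Proof.
move=> x0 y0 h; rewrite /f !mulrA ler_pM2r ?invr_gt0 ?ln2_gt0'//.
rewrite !mulr_natl -!lnXn; [|lra|lra].
by rewrite ler_ln ?posrE ?exprn_gt0//; lra.
Qed.

(** The threshold S0 beyond which f is negligible against a power; below it the
    upper estimates are trivial, at the price of the term f (1 + S0) in the
    constant A. *)
Lemma f_vs_power : exists2 S0 : R, 1000 <= S0 &
  forall s, S0 <= s -> (2 * f (1 + s)) ^+ 10 <= s.
Proof.
pose K : R := 11 ^+ 11; pose c : R := 4 ^+ 10.
have K1 : 1 <= K by rewrite exprn_ege1// ler1n.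
have c0 : 0 <= c by rewrite exprn_ge0.
pose B := 2 + K * (c + 1).
exists (Num.max 1000 (expR B)); first by rewrite le_max lexx.
move=> s; rewrite ge_max => /andP[s1 sB].
pose u := ln (2 + s).
have sp : 0 < 2 + s by lra.
have uB : B <= u.
  rewrite -[leLHS]expRK /u ler_ln ?posrE ?expR_gt0//.
  by apply: (le_trans sB); lra.
have Kc : K <= K * (c + 1) by rewrite ler_peMr//; lra.
have u2 : 2 <= u by apply: le_trans uB; rewrite /B; lra.
have fu : 2 * f (1 + s) <= 4 * u.
  rewrite /f (_ : 1 + s + 1 = 2 + s); last by ring.
  rewrite -/u mulrA ler_pdivrMr ?ln2_gt0'//.
  have : 0 <= u * (2 * ln 2 - 1) by rewrite mulr_ge0//; have := ln2_ge R; lra.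
  lra.
have f0' : 0 <= 2 * f (1 + s) by rewrite mulr_ge0// f_ge0//; lra.
apply: (@le_trans _ _ ((4 * u) ^+ 10)).
  by apply: lerXn2r; rewrite ?nnegrE//; lra.
rewrite exprMn -/c.
have e1 : (u / 11) ^+ 11 <= 2 + s.
  rewrite -[leRHS]lnK ?posrE// -/u.
  have -> : expR u = expR (u / 11) ^+ 11 by rewrite -expRM_natl mulrC divfK.
  apply: lerXn2r; rewrite ?nnegrE ?expR_ge0 ?divr_ge0//; first by lra.
  by apply: le_trans (expR_ge1Dx _); rewrite lerDr.
have u10 : 2 <= u ^+ 10.
  apply: (le_trans u2); rewrite exprS ler_peMr//; first by lra.
  by apply: exprn_ege1; lra.
have : (c + 1) * u ^+ 10 <= (u / 11) ^+ 11.
  rewrite expr_div_n -/K ler_pdivlMr; last by lra.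
  rewrite mulrAC exprS ler_wpM2r ?exprn_ge0//; first by lra.
  rewrite mulrC; apply: (le_trans _ uB); rewrite /B; lra.
lra.
Qed.

Variables (S0 : R).
Hypothesis S0_ge : 1000 <= S0.
Hypothesis S0P : forall s, S0 <= s -> (2 * f (1 + s)) ^+ 10 <= s.

(** The divisor l f (1 + s) is at most s^(1/5) / 2, and f is nearly logarithmic. *)
Lemma g_split (s : R) (l : nat) : S0 <= s -> (0 < l)%N -> l%:R ^+ 10 <= s ->
  4 / 5 * f (1 + s) <= f (1 + s / (l%:R * f (1 + s))).
Proof.
move=> sS l0 ls; set g := f (1 + s); set v := l%:R * g; set w := s / v.
have s1 : 1000 <= s by exact: le_trans sS.
have g1 : 1 <= g by apply: f_ge1; lra.
have l1 : 1 <= l%:R :> R by rewrite ler1n.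
have v1 : 1 <= v by rewrite /v -[leLHS]mulr1 ler_pM.
have v5 : (2 * v) ^+ 5 <= s.
  rewrite -(@ler_pXn2r _ 2)// ?nnegrE; [|by rewrite exprn_ge0//; lra|by lra].
  rewrite -exprM (_ : 2 * v = l%:R * (2 * g)); last by rewrite /v; ring.
  rewrite exprMn expr2 ler_pM ?exprn_ge0 ?S0P//; lra.
have w0 : 0 <= w by rewrite divr_ge0//; lra.
have : 4%:R * f (1 + s) <= 5%:R * f (1 + w).
  apply: f_pow; [lra|lra|].
  apply: (@le_trans _ _ ((2 * s) ^+ 4)).
    by apply: lerXn2r; rewrite ?nnegrE; lra.
  apply: (@le_trans _ _ (w ^+ 5)); last first.
    by apply: lerXn2r; rewrite ?nnegrE; lra.
  rewrite /w expr_div_n ler_pdivlMr; last by rewrite exprn_gt0//; lra.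
  have h : v ^+ 5 <= s / 32.
    by rewrite ler_pdivlMr// mulrC; move: v5; rewrite exprMn; congr (_ * _ <= _); ring.
  apply: (@le_trans _ _ ((2 * s) ^+ 4 * (s / 32))).
    by rewrite ler_wpM2l// exprn_ge0//; lra.
  have s5 : 0 <= s ^+ 5 by rewrite exprn_ge0//; lra.
  have -> : (2 * s) ^+ 4 * (s / 32) = s ^+ 5 / 2 by field.
  lra.
rewrite -/g; lra.
Qed.

Variables (Q A : R).
Hypothesis Q_ge1 : 1 <= Q.
Hypothesis A_ge : 100 <= A.
Let g (t : R) := f (1 + t / Q).

Lemma g_ge1 (t : R) : 0 <= t -> 1 <= g t.
Proof. by have Q1 := Q_ge1; move=> t0; apply: f_ge1; rewrite lerDl divr_ge0//; lra. Qed.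

Lemma ler_g (t t' : R) : 0 <= t -> t <= t' -> g t <= g t'.
Proof.
have Q1 := Q_ge1; move=> t0 tt; apply: ler_f; first by rewrite addr_ge0// divr_ge0//; lra.
by rewrite lerD2l ler_pM2r// invr_gt0; lra.
Qed.

(** Recursive step of the upper estimate. The terms with tt i below
    tau = t / (l g t) add up to at most t / g t by the trivial bound; for the
    others g (tt i) >= g tau >= 4/5 g t by [g_split], and the tt i add up to
    t + l at most, where l is small compared with t. *)
Lemma sum_rec (t l : nat) (T : 'I_l -> R) (tt : 'I_l -> nat) :
  S0 <= t%:R / Q -> (0 < l)%N -> l%:R ^+ 10 <= t%:R / Q ->
  (\sum_i tt i <= t + l)%N ->
  (forall i, T i <= (tt i)%:R) -> (forall i, T i <= A * (tt i)%:R / g (tt i)%:R) ->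
  \sum_i T i <= 4 / 3 * A * t%:R / g t%:R.
Proof.
have Q1 := Q_ge1; have A1 := A_ge; move=> sS l0 ls stt T1 T2; set s := t%:R / Q in sS ls.
have l1 : 1 <= l%:R :> R by rewrite ler1n.
have s1 : 1000 <= s by exact: le_trans sS.
have st : s <= t%:R by rewrite ler_pdivrMr ?ler_peMr//; lra.
have g1 : 1 <= g t%:R by exact: g_ge1.
pose tau := t%:R / (l%:R * g t%:R).
have lg : 0 < l%:R * g t%:R by rewrite mulr_gt0//; lra.
have tau0 : 0 <= tau by rewrite divr_ge0//; lra.
have gtau : 4 / 5 * g t%:R <= g tau.
  have := g_split sS l0 ls; rewrite /g -/s.
  suff -> : s / (l%:R * f (1 + s)) = tau / Q by [].
  by rewrite /tau /g -/s /s mulrAC.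
have gtau0 : 1 <= g tau by exact: g_ge1.
have key i : T i <= A * (tt i)%:R / g tau + tau.
  have [h|h] := leP (tt i)%:R tau.
    apply: (le_trans (T1 i)); apply: (le_trans h); rewrite lerDr.
    by apply: divr_ge0; [apply: mulr_ge0; [lra|exact: ler0n]|lra].
  apply: (le_trans (T2 i)); rewrite -[leLHS]addr0 lerD//.
  have gi : g tau <= g (tt i)%:R by apply: ler_g => //; exact: ltW.
  rewrite ler_wpM2l ?mulr_ge0//; first by lra.
  by rewrite lef_pV2 ?posrE; lra.
apply: (@le_trans _ _ (\sum_(i < l) (A * (tt i)%:R / g tau + tau))).
  by apply: ler_sum => i _; exact: key.
rewrite big_split /= sumr_const card_ord -mulr_suml -mulr_sumr.
have l20 : 20 * l%:R <= t%:R :> R.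
  apply: (le_trans _ st); have [l2|l2] := leqP 2 l; last first.
    have l2' : l%:R <= 1 :> R by rewrite lern1 -ltnS.
    lra.
  have l2' : 2 <= l%:R :> R by rewrite ler_nat.
  apply: (le_trans _ ls); rewrite exprS [_ * l%:R]mulrC ler_wpM2l//.
  apply: (@le_trans _ _ (2 ^+ 9)); first by rewrite -natrX ler_nat.
  by apply: lerXn2r; rewrite ?nnegrE; lra.
have sR : \sum_(i < l) (tt i)%:R <= 21 / 20 * t%:R :> R.
  by rewrite -natr_sum; apply: (@le_trans _ _ (t + l)%:R); [rewrite ler_nat|rewrite natrD; lra].
have ltau : tau *+ l = t%:R / g t%:R.
  rewrite -mulr_natl /tau; field; apply/andP; split; rewrite gt_eqF//; lra.
rewrite ltau.
have h1 : (g tau)^-1 <= 5 / 4 / g t%:R.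
  rewrite ler_pdivlMr; last by lra.
  rewrite mulrC ler_pdivrMr; last by lra.
  lra.
have : A * (\sum_(i < l) (tt i)%:R) / g tau <= A * (21 / 20 * t%:R) * (5 / 4 / g t%:R).
  apply: ler_pM => //.
  - by rewrite mulr_ge0 ?sumr_ge0//; lra.
  - by rewrite invr_ge0; lra.
  - by rewrite ler_wpM2l//; lra.
move=> h2; apply: (le_trans (lerD h2 (lexx _))).
have -> : A * (21 / 20 * t%:R) * (5 / 4 / g t%:R) + t%:R / g t%:R =
   (21 / 16 * A + 1) * (t%:R / g t%:R) by field; lra.
have -> : 4 / 3 * A * t%:R / g t%:R = (4 / 3 * A) * (t%:R / g t%:R) by rewrite !mulrA.
rewrite ler_wpM2r//; last by lra.
by rewrite divr_ge0//; lra.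
Qed.

Lemma t_over_g (t : R) : 1 <= t -> 1 / 4 <= t / g t.
Proof.
have Q1 := Q_ge1; move=> t1; have g1 : 1 <= g t by apply: g_ge1; lra.
rewrite ler_pdivlMr; last by lra.
have : g t <= f (1 + t).
  apply: ler_f; first by rewrite addr_ge0// divr_ge0//; lra.
  by rewrite lerD2l ler_pdivrMr ?ler_peMr//; lra.
have : f (1 + t) <= 2 * (1 + t) by apply: f_le_double; lra.
lra.
Qed.

End Growth.

(** * Counting incidences of sets and blocks *)
Section Count.
Variables (R : realType) (k : nat) (x : nat -> nat -> R).

Definition meets (E : set nat) (i : 'I_k) : bool := `[< exists n, E n /\ supp (x i) n >].

Lemma hitP E (i : 'I_k) : reflect (exists n, E n /\ supp (x i) n) (meets E i).
Proof. exact: asboolP. Qed.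

Definition Imeet (I : {set 'I_k}) (E : set nat) : {set 'I_k} :=
  [set i in I | meets E i]%SET.

(** The first sets meeting the blocks give at most [#|I|] incidences. Every other
    incidence is determined by its set: a set meeting a block cannot come after a
    set meeting a later block. *)
Lemma count_meet l (E : nat -> set nat) (I : {set 'I_k}) :
  ordered k x -> successive_sets l E ->
  (\sum_(a < l) #|Imeet I (E a)| <= #|I| + l)%N.
Proof.
move=> xo sE.
pose S : {set 'I_l * 'I_k} := [set p : 'I_l * 'I_k | (p.2 \in I) && meets (E p.1) p.2]%SET.
have -> : (\sum_(a < l) #|Imeet I (E a)| = #|S|)%N.
  rewrite -[RHS]sum1_card [RHS]big_mkcond /=.
  rewrite [RHS](eq_bigr (fun p => if (p.1, p.2) \in S then 1 else 0)%N); last by move=> [].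
  rewrite -(pair_bigA _ (fun a i => if (a, i) \in S then 1 else 0)%N) /=.
  apply: eq_bigr => a _; rewrite -[LHS]sum1_card [LHS]big_mkcond /=; apply: eq_bigr => i _.
  by rewrite !inE.
pose S1 := [set p in S | [forall a : 'I_l, (a < p.1)%N ==> ~~ meets (E a) p.2]]%SET.
rewrite -(cardsID S1 S); apply: leq_add.
  rewrite (_ : S :&: S1 = S1); last by apply/finset.setIidPr/fintype.subsetP => p /setIdP[].
  rewrite -(card_in_imset (f := snd) (D := mem S1)).
    by apply/subset_leq_card/fintype.subsetP => i /imsetP[p]; rewrite !inE => /andP[/andP[]] ? _ _ ->.
  move=> [a i] [a' i'] /= h h' ii; rewrite -ii in h' *; move: h h'.
  rewrite !inE /= => /andP[/andP[_ m] /forallP h] /andP[/andP[_ m'] /forallP h'].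
  congr (_, _); apply/val_inj; case: (ltngtP a a') => // aa.
    by have /= := h' a; rewrite aa m.
  by have /= := h a'; rewrite aa m'.
rewrite -[X in (_ <= X)%N](card_ord l) -(card_in_imset (f := fst) (D := mem (S :\: S1))).
  exact: max_card.
have key (a i i' : nat) (b : nat) n n' m : (i < i')%N -> (i' < k)%N -> (b < a)%N -> (a < l)%N ->
    E a n -> supp (x i) n -> E b n' -> supp (x i') n' -> supp (x i') m -> False.
  move=> ii ik ba al En xn En' xn' _.
  have [_ _ /(_ _ _ En' En) nn] := sE _ _ ba al.
  have := xo _ _ ii ik _ _ xn xn' => nn'.
  by have := ltn_trans nn nn'; rewrite ltnn.
move=> [a i] [a' i'] /= h h' ii; rewrite -ii in h' *; move: h h'.
move=> /finset.setDP[pS + ] /finset.setDP[pS' + ].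
rewrite [_ \in S1]finset.in_set pS /= => /forallPn[b hb].
rewrite [_ \in S1]finset.in_set pS' /= => /forallPn[b' hb'].
move: pS pS' hb hb'; rewrite !finset.in_set /= => /andP[_ m] /andP[_ m'].
rewrite 2!negb_imply 2!negbK => /andP[ba mb] /andP[ba' mb'].
have /hitP[n [En xn]] := m; have /hitP[n' [En' xn']] := m'.
have /hitP[p [Ep xp]] := mb; have /hitP[p' [Ep' xp']] := mb'.
congr (_, _); apply/val_inj; case: (ltngtP i i') => // hi; exfalso.
  exact: (key a i i' b' n p' p' hi _ ba' _ En xn Ep' xp' xp').
exact: (key a i' i b n' p p hi _ ba _ En' xn' Ep xp xp).
Qed.

End Count.

(** * Gaps in the set J *)
Section JGrowth.
Variables (R : realType) (j : nat -> nat).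
Hypothesis hj : admissible R j.

Lemma ln_ge_expR (c y : R) : 0 < c -> c <= ln y -> expR c <= y.
Proof.
move=> c0 cy; have y0 : 0 < y.
  by rewrite ltNge; apply/negP => /ln0 e; move: cy; rewrite e leNgt c0.
by rewrite -[leRHS]lnK ?posrE// ler_expR.
Qed.

Lemma J_gap m n : Jset j m -> Jset j n -> (m < n)%N ->
  expR (expR (expR (4 * (m%:R : R) ^+ 2))) <= n%:R.
Proof.
move=> mJ nJ mn; case: hj => _ _ /(_ m n mJ nJ mn) h.
have m0 : (0 : R) < m%:R by rewrite ltr0n (Jset_gt0 hj).
have c0 : 0 < 4 * (m%:R : R) ^+ 2 by rewrite mulr_gt0// exprn_gt0.
apply: ln_ge_expR; first exact: expR_gt0.
apply: ln_ge_expR; first exact: expR_gt0.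
exact: ln_ge_expR.
Qed.

Lemma expR_ge_self (x : R) : x <= expR x.
Proof. by apply: le_trans (expR_ge1Dx x); rewrite lerDr. Qed.

Lemma J_ge100 m : Jset j m -> 100 <= m%:R :> R.
Proof.
move=> mJ; have := Jset_f hj mJ; have := f_le_double (ler0n R m).
lra.
Qed.

Lemma J_gap10 m n : Jset j m -> Jset j n -> (m < n)%N ->
  (m%:R : R) ^+ 10 + 2 <= n%:R.
Proof.
move=> mJ nJ mn; apply: le_trans (J_gap mJ nJ mn).
have m1 := J_ge100 mJ; set x : R := m%:R in m1 *.
apply: (le_trans _ (expR_ge_self _)); apply: (le_trans _ (expR_ge_self _)).
have -> : 4 * x ^+ 2 = (x ^+ 2 / 3) * 12%:R by field.
rewrite expRM_natr.
apply: (@le_trans _ _ ((x ^+ 2 / 3) ^+ 12)); last first.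
  apply: lerXn2r; rewrite ?nnegrE ?expR_ge0 ?expR_ge_self// divr_ge0 ?sqr_ge0//.
apply: (@le_trans _ _ (x ^+ 12)); last first.
  have x3 : x <= x ^+ 2 / 3.
    rewrite ler_pdivlMr// expr2 ler_wpM2l//; lra.
  by apply: lerXn2r => //; rewrite nnegrE; lra.
rewrite (_ : x ^+ 12 = x ^+ 10 * x ^+ 2); last by rewrite -exprD.
have x10 : 1 <= x ^+ 10 by apply: exprn_ege1; lra.
have x2 : 10000 <= x ^+ 2.
  by rewrite (_ : 10000 = 100 ^+ 2); [apply: lerXn2r; rewrite ?nnegrE; lra|ring].
move: (x ^+ 10) (x ^+ 2) x10 x2 => u v u1 v1.
have : 0 <= (u - 1) * (v - 3) by rewrite mulr_ge0//; lra.
lra.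
Qed.

Lemma j_ge i : (0 < i)%N -> (i <= j i)%N.
Proof.
case: hj => inc _ _; elim: i => [//|[|i] IH] _.
  by apply: (Jset_gt0 hj); exists 1%N.
by apply: leq_ltn_trans (IH _) (inc _ _ _ _).
Qed.

Lemma K_lt_j2 k : Kset j k -> (k < j (2 * k))%N.
Proof.
move=> [i /= oi <-]; have i0 : (0 < i)%N by case: i oi.
case: hj => inc _ _; apply: inc => //.
by rewrite mul2n -addnn; apply: leq_trans (_ : i + j i <= _)%N;
  rewrite ?leq_add2r ?j_ge// -addn1 leq_add2l (leq_trans i0)// j_ge.
Qed.

End JGrowth.

Section Numeric.
Variable R : realType.

Lemma le_of_pow10 (s g : R) : 1 <= g -> (2 * g) ^+ 10 <= s -> g <= s.
Proof.
move=> g1 h; apply: le_trans h; apply: (@le_trans _ _ (2 * g)); first by lra.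
by rewrite exprS ler_peMr//; [lra|apply: exprn_ege1; lra].
Qed.

Lemma few_terms_bound (t Q g k S G : R) : 1 <= Q -> k <= Q -> 1 <= g -> g <= t / Q ->
  S <= t + k -> 100 * (t / g) <= G -> 2 * k + 2 * (S / g) <= 16 * G.
Proof.
move=> Q1 kQ g1 gt St tG.
have g0 : 0 < g by lra.
have Q0 : 0 < Q by lra.
have Qt : Q * g <= t by rewrite mulrC -ler_pdivlMr.
have Qr : Q <= t / g by rewrite ler_pdivlMr.
have Qt' : Q <= t by apply: le_trans Qt; rewrite ler_peMr//; lra.
have Sr : S / g <= 2 * (t / g) by rewrite mulrA ler_wpM2r ?invr_ge0//; lra.
lra.
Qed.

Lemma pow10_succ (x : R) : 1 <= x -> x ^+ 10 + 2 <= (x + 1) ^+ 10.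
Proof.
move=> l1.
have -> : (x + 1) ^+ 10 = (x + 1) ^+ 9 * x + (x + 1) ^+ 9 by ring.
have e1 : x ^+ 10 <= (x + 1) ^+ 9 * x.
  rewrite exprSr ler_wpM2r//; [lra|apply: lerXn2r; rewrite ?nnegrE; lra].
have e2 : 2 ^+ 9 <= (x + 1) ^+ 9 by apply: lerXn2r; rewrite ?nnegrE; lra.
have e3 : 2 <= 2 ^+ 9 :> R by rewrite -natrX ler_nat.
lra.
Qed.

Lemma div_le_self (x y : R) : 0 <= x -> 1 <= y -> x / y <= x.
Proof. by move=> x0 y1; rewrite ler_pdivrMr ?ler_peMr//; lra. Qed.

End Numeric.

(** * The upper estimate for sums of blocks *)
Section Upper.
Variables (R : realType) (j : nat -> nat) (sigma : seq (nat -> R) -> nat).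
Variables (X : completeNormedModType R) (iota : (nat -> R) -> X).
Hypothesis hj : admissible R j.
Hypothesis hsigma : coding_function j sigma.
Hypothesis hX : is_completion (gowers_norm j sigma) iota.
Notation apx := (gowers_norm_approx j sigma).
Notation na := (na j sigma).
Notation nm := (nm iota).

Variable S0 : R.
Hypothesis S0_ge : 1000 <= S0.
Hypothesis S0P : forall s, S0 <= s -> (2 * f (1 + s)) ^+ 10 <= s.
Let A : R := 100 + f (1 + S0).

Let A_ge : 100 <= A.
Proof. by rewrite /A lerDl f_ge0//; have := S0_ge; lra. Qed.

Definition psum l (E : nat -> set nat) (v : nat -> R) : R :=
  \sum_(a < l) nm (proj (E a) v).

Lemma f2_ge : 3 / 2 <= f (2 : R).
Proof.
have : 3%:R * f (1 : R) <= 2%:R * f (2 : R) by apply: f_pow => //; rewrite !exprS !expr0; lra.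
rewrite f1; lra.
Qed.

Section Blocks.
Variables (k : nat) (x : nat -> nat -> R) (p : R).
Hypothesis p_ge1 : 1 <= p.
Hypothesis k_gt0 : (0 < k)%N.
Hypothesis x_c00 : forall i, (i < k)%N -> c00 (x i).
Hypothesis x_ordered : ordered k x.
Hypothesis x_le1 : forall i, (i < k)%N -> nm (x i) <= 1.
Hypothesis x_split : forall l, (0 < l)%N -> exists i0 : 'I_k, forall i : 'I_k,
  i != i0 -> forall E, successive_sets l E ->
  psum l E (x i) <= 2 + Num.sqrt (f (l%:R : R)) / k%:R.

Let Q : R := 2 * p.
Let Q_ge1 : 1 <= Q. Proof. by have := p_ge1; rewrite /Q; lra. Qed.
Let g (t : R) := f (1 + t / Q).
Let G (t : R) := A * t / g t.

Definition blocks (I : {set 'I_k}) : nat -> R := \sum_(i in I) x i.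
Let n (I : {set 'I_k}) : R := #|I|%:R.

Hypothesis K_cases : forall k', Kset j k' ->
  [\/ k'%:R <= p, f (1 + k%:R) <= Num.sqrt (f (k'%:R : R)) |
     forall N u I E, special_functional j sigma (apx N) k' u ->
       `|pairing u (proj E (blocks I))| <= 4].

Let n_ge0 I : 0 <= n I. Proof. exact: ler0n. Qed.
Let n_le I : n I <= k%:R.
Proof. by rewrite ler_nat -[leqRHS]card_ord max_card. Qed.
Let g1 (t : R) : 0 <= t -> 1 <= g t.
Proof. by move=> t0; exact: g_ge1. Qed.
Let k1 : 1 <= k%:R :> R. Proof. by rewrite ler1n. Qed.

Lemma c00_blocks I : c00 (blocks I).
Proof. by apply: c00_sum => i _; exact: x_c00. Qed.

Lemma c00_pb E I : c00 (proj E (blocks I)).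
Proof. by apply: c00_proj; exact: c00_blocks. Qed.

Lemma proj_blocks_meet E F I : F `<=` E ->
  proj F (blocks I) = proj F (blocks (Imeet x I E)).
Proof.
move=> FE; rewrite /blocks !proj_sum (bigID (meets x E)) /= [X in _ + X]big1 ?addr0.
  by apply: eq_bigl => i; rewrite finset.in_set.
move=> i /andP[_ /hitP h]; apply: proj_disj => m Fm.
apply/eqP/negPn/negP => xm. apply: h; exists m; split=> //; exact: FE.
Qed.

Lemma nm_pb_le E I : nm (proj E (blocks I)) <= n I.
Proof.
rewrite /blocks proj_sum.
have c (i : 'I_k) : i \in I -> c00 (proj E (x i)) by move=> _; apply/c00_proj/x_c00.
apply: (le_trans (nm_sum hX _ c)); rewrite /n -sum1_card natr_sum.
apply: ler_sum => i _; apply: le_trans (nm_proj hX E (x_c00 (ltn_ord i))) _.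
exact: x_le1.
Qed.

Lemma psum_proj_le l E F v : c00 v -> psum l E (proj F v) <= psum l E v.
Proof.
move=> cv; apply: ler_sum => a _; apply: (nm_abs hX); last exact: c00_proj.
move=> i; rewrite /proj; case: ifP => // _.
by case: ifP => // _; rewrite normr0.
Qed.

(** One exceptional block is bounded through the lower f-estimate of the norm, the
    others by [x_split]. *)
Lemma psum_blocks l E F I : (0 < l)%N -> successive_sets l E ->
  psum l E (proj F (blocks I)) <=
    f (l%:R : R) + n I * (2 + Num.sqrt (f (l%:R : R)) / k%:R).
Proof.
move=> l0 sE; have [i0 hi0] := x_split l0.
have f0 : 0 <= f (l%:R : R) by apply: f_ge0.
set c := 2 + _; have c0 : 0 <= c.
  by rewrite /c addr_ge0// divr_ge0// sqrtr_ge0.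
apply: (@le_trans _ _ (\sum_(i in I) psum l E (x i))).
  rewrite /psum exchange_big /=; apply: ler_sum => a _.
  rewrite /blocks !proj_sum.
  have cc (i : 'I_k) : i \in I -> c00 (proj (E a) (proj F (x i))).
    by move=> _; do 2 apply: c00_proj; exact: x_c00.
  apply: (le_trans (nm_sum hX _ cc)); apply: ler_sum => i _.
  apply: (nm_abs hX); last by apply: c00_proj; exact: x_c00.
  move=> b; rewrite /proj; case: ifP => // _.
  by case: ifP => // _; rewrite normr0.
apply: (@le_trans _ _ (\sum_(i in I) ((if i == i0 then f (l%:R : R) else 0) + c))).
  apply: ler_sum => i _; case: eqP => [->|/eqP ii]; last by rewrite add0r hi0.
  rewrite -[leLHS]addr0 lerD//.
  apply: le_trans (nm_split hX (x_c00 (ltn_ord i0)) l0 sE) _.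
  by rewrite ler_piMr// x_le1.
rewrite big_split /= sumr_const -/(n I) -[X in _ + X]mulr_natl lerD2r.
rewrite -big_mkcondr /=; apply: (@le_trans _ _ (\sum_(i in [set i0]%SET) f (l%:R : R))).
  rewrite [leLHS]big_mkcond [leRHS]big_mkcond /=; apply: ler_sum => i _.
  by rewrite finset.in_set1; case: (i \in I) => //=; case: ifP.
by rewrite finset.big_set1.
Qed.

Lemma psum_blocks2 l E F I : (0 < l)%N -> successive_sets l E ->
  psum l E (proj F (blocks I)) <= 2 * f (l%:R : R) + 2 * n I.
Proof.
move=> l0 sE; apply: (le_trans (psum_blocks F I l0 sE)).
have f1 := fn_ge1 R l0.
have : n I * (Num.sqrt (f (l%:R : R)) / k%:R) <= f (l%:R : R).
  rewrite mulrA ler_pdivrMr; last by (have := k1; lra).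
  have s0 : 0 <= Num.sqrt (f (l%:R : R)) by exact: sqrtr_ge0.
  have s1 : 1 <= Num.sqrt (f (l%:R : R)).
    by rewrite -[leLHS]sqrtr1 ler_wsqrtr.
  have e : Num.sqrt (f (l%:R : R)) ^+ 2 = f (l%:R : R) by rewrite sqr_sqrtr//; lra.
  rewrite mulrC; apply: ler_pM => //.
  by rewrite -[leRHS]e expr2 ler_peMr.
rewrite mulrDr; lra.
Qed.

Lemma G_trivial I : n I / Q <= S0 -> n I <= G (n I).
Proof.
have S1 := S0_ge; have Q1 := Q_ge1.
move=> h; rewrite /G ler_pdivlMr; last by have := g1 (n_ge0 I); lra.
rewrite mulrC ler_wpM2r// /A.
have : g (n I) <= f (1 + S0).
  by apply: ler_f; rewrite ?lerD2l// addr_ge0// divr_ge0//; lra.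
lra.
Qed.

Lemma G_ge25 (I : {set 'I_k}) : (0 < #|I|)%N -> 25 <= G (n I).
Proof.
move=> I0; have := t_over_g Q_ge1 (_ : 1 <= n I).
rewrite /G -/(g _) -mulrA => h; have {}h : 1 / 4 <= n I / g (n I) by apply: h; rewrite /n ler1n.
have A1 := A_ge.
apply: (@le_trans _ _ (100 * (1 / 4))); first by lra.
by apply: ler_pM => //; lra.
Qed.

Lemma tg_le (t : R) : 0 <= t -> 100 * (t / g t) <= G t.
Proof.
move=> t0; rewrite /G -mulrA ler_wpM2r//.
by rewrite divr_ge0//; have := g1 t0; lra.
Qed.

Lemma small_le_G (t G' : R) : 100 * t <= G' -> 0 <= t -> 25 <= G' -> 2 + 2 * t <= G'.
Proof. by lra. Qed.

Lemma n_div_g I : 0 <= n I / g (n I).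
Proof. by rewrite divr_ge0//; have := g1 (n_ge0 I); lra. Qed.

Section Step.
Variable N : nat.
Hypothesis IH : forall I E, na N (proj E (blocks I)) <= G (n I).

Lemma na_meet_le E F I :
  na N (proj F (proj E (blocks I))) <= G (n (Imeet x I F)) /\
  nm (proj F (proj E (blocks I))) <= n (Imeet x I F).
Proof.
rewrite proj_proj (@proj_blocks_meet F); last by apply: subIsetl.
by split; [exact: IH|exact: nm_pb_le].
Qed.

(** Few pieces (l^10 <= n / Q) are handled by the recursion [sum_rec], many pieces by
    [psum_blocks2], since then g (n I) <= 10 f l. *)
Lemma step_split l E F I : (0 < l)%N -> successive_sets l E ->
  \sum_(a < l) na N (proj (E a) (proj F (blocks I))) <= f (l%:R : R) * G (n I).
Proof.
move=> l0 sE; have cF := c00_pb F I.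
have fl := fn_ge1 R l0.
have A1 := A_ge; have Q1 := Q_ge1; have S1 := S0_ge.
have gI := g1 (n_ge0 I).
have [h|h] := leP (n I / Q) S0.
  apply: (le_trans (na_split hX N cF l0 sE)).
  rewrite ler_wpM2l//; first by lra.
  apply: le_trans (na_le_nm hX N.+1 cF) _; apply: le_trans (nm_pb_le F I) _.
  exact: G_trivial.
have I0 : (0 < #|I|)%N.
  by rewrite lt0n; apply/negP => /eqP I0; move: h; rewrite /n I0 mul0r; lra.
have [ls|ls] := leP (l%:R ^+ 10) (n I / Q); last first.
  apply: (@le_trans _ _ (psum l E (proj F (blocks I)))).
    by apply: ler_sum => a _; apply: (na_le_nm hX); do 2 apply: c00_proj; exact: c00_blocks.
  apply: (le_trans (psum_blocks2 F I l0 sE)).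
  have h10 : g (n I) <= 10 * f (l%:R : R).
    have : 1%:R * f (1 + n I / Q) <= 10%:R * f (l%:R : R).
      apply: f_pow; [by []|by rewrite addr_ge0// divr_ge0//; lra|].
      have l1 : 1 <= l%:R :> R by rewrite ler1n.
      rewrite expr1; apply: le_trans (pow10_succ l1).
      by rewrite addrAC [1 + 1 + _]addrC lerD2r; exact: ltW.
    by rewrite mul1r.
  have h25 := G_ge25 I0.
  have h2 : 2 * n I <= 20 * (n I / g (n I)) * f (l%:R : R).
    have -> : 20 * (n I / g (n I)) * f (l%:R : R) = 2 * (n I * (10 * f (l%:R : R) / g (n I))).
      by field; lra.
    rewrite ler_wpM2l// ler_peMr// ler_pdivlMr; lra.
  have := tg_le (n_ge0 I) => h100.
  have : 0 <= f (l%:R : R) * (G (n I) - (2 + 20 * (n I / g (n I)))).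
    rewrite mulr_ge0//; first by lra.
    have := n_div_g I; lra.
  lra.
have [l1|l2] := leqP l 1.
  have {l1 l0} -> : l = 1%N by apply/eqP; rewrite eqn_leq l1.
  by rewrite big_ord1 f1 mul1r proj_proj; exact: IH.
apply: le_trans (_ : 4 / 3 * A * n I / g (n I) <= _).
  apply: (sum_rec S0_ge S0P Q_ge1 A_ge (tt := fun a => #|Imeet x I (E a)|)) => //.
  - exact: ltW.
  - exact: count_meet.
  - move=> a; apply: le_trans (na_le_nm hX N _) _; first exact/c00_proj/c00_pb.
    by have [] := na_meet_le F (E a) I.
  - by move=> a; have [] := na_meet_le F (E a) I.
have f32 : 3 / 2 <= f (l%:R : R).
  by apply: (le_trans f2_ge); apply: ler_f => //; rewrite ler_nat.
have -> : 4 / 3 * A * n I / g (n I) = 4 / 3 * G (n I) by rewrite /G !mulrA.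
rewrite ler_wpM2r//; first by apply: le_trans (G_ge25 I0).
by apply: le_trans f32; lra.
Qed.

Lemma step_Astar m z F I : (0 < m)%N -> Astar (apx N) m z ->
  `|pairing z (proj F (blocks I))| <= G (n I).
Proof.
move=> m0 zA; have cF := c00_pb F I.
have [E sE zE] := Astar_le hX m0 zA cF.
apply: le_trans (zE _ cF) _; rewrite ler_pdivrMl ?fn_gt0//.
exact: step_split.
Qed.

(** A short special functional, of length at most p, is a sum of few pieces, and
    [sum_rec] applies unless k'^10 > n / Q; in this case the indices of its terms
    are so large that each term is nearly bounded by 2. A very long one is small
    on every block but one. The remaining length is a hypothesis. *)
Lemma step_special u F I k' : Kset j k' -> special_functional j sigma (apx N) k' u ->
  `|pairing u (proj F (blocks I))| <= G (n I).
Proof.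
move=> kK su; have cF := c00_pb F I.
have A1 := A_ge; have Q1 := Q_ge1; have S1 := S0_ge.
have gI := g1 (n_ge0 I).
have [h|h] := leP (n I / Q) S0.
  apply: (le_trans (nm_special hX cF kK su)); apply: le_trans (nm_pb_le F I) _.
  exact: G_trivial.
have I0 : (0 < #|I|)%N.
  by rewrite lt0n; apply/negP => /eqP I0; move: h; rewrite /n I0 mul0r; lra.
have G25 := G_ge25 I0.
have sq16 := sqrtf_ge16 hj kK.
have k'0 : (0 < k')%N by apply: (Jset_gt0 hj); exact: KJ.
have k'R : 1 <= k'%:R :> R by rewrite ler1n.
have sq0 : 0 < Num.sqrt (f (k'%:R : R)) by exact: (sqrtf_gt0 hj kK).
have g0 : 0 < g (n I) by exact: lt_le_trans gI.
have Q0 : 0 < Q by exact: lt_le_trans Q1.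
have nQ0 : 0 <= n I / Q by rewrite divr_ge0// ltW.
have nQ1 : 0 <= 1 + n I / Q by rewrite addr_ge0.
case: (su) => z [[zQ zs zA0 zA] uE].
pose M a := if a is b.+1 then sigma (mkseq (fun l => vabs (z l)) b.+1) else j (2 * k').
have zM a : (a < k')%N -> Astar (apx N) (M a) (z a).
  by case: a => [|a] ak //=; exact: zA.
have Mge a : (a < k')%N -> (j (2 * k') <= M a)%N.
  case: a => [|a] ak //=; apply: ltnW.
  exact: (sigma_big hj hsigma ak zQ zs zA0).
have j2J : Jset j (j (2 * k')) by apply: Jset_j; rewrite muln_gt0.
have M0 a : (a < k')%N -> (0 < M a)%N.
  by move=> ak; apply: leq_trans (Mge a ak); exact: Jset_gt0 hj _ j2J.
have sE : successive_sets k' (fun a => supp (z a)) by exact: zs.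
have tri : `|pairing u (proj F (blocks I))| <=
    (Num.sqrt (f (k'%:R : R)))^-1 * \sum_(a < k') `|pairing (z a) (proj F (blocks I))|.
  rewrite uE pairingZl// normrM ger0_norm ?invr_ge0 ?sqrtr_ge0//.
  rewrite ler_wpM2l ?invr_ge0 ?sqrtr_ge0// pairing_suml//.
  exact: ler_norm_sum.
have redE a : pairing (z a) (proj F (blocks I)) =
    pairing (z a) (proj (supp (z a) `&` F) (blocks (Imeet x I (supp (z a))))).
  rewrite (pairing_supp (E := supp (z a)))// proj_proj.
  by rewrite (@proj_blocks_meet (supp (z a)))//; exact: subIsetl.
have szm : (\sum_(a < k') #|Imeet x I (supp (z a))| <= #|I| + k')%N.
  exact: (count_meet I x_ordered sE).
have G0 : 0 <= G (n I) by exact: le_trans G25.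
have done_by (B : R) : \sum_(a < k') `|pairing (z a) (proj F (blocks I))| <= B ->
    B <= 16 * G (n I) -> `|pairing u (proj F (blocks I))| <= G (n I).
  move=> h1 h2; apply: (le_trans tri); rewrite ler_pdivrMl//.
  by apply: (le_trans h1); apply: (le_trans h2); rewrite ler_wpM2r.
have tg := tg_le (n_ge0 I); have ng := n_div_g I.
case: (K_cases kK) => [kp|kbig|]; last first.
- by move=> /(_ N u I F su) h4; apply: (le_trans h4); apply: le_trans G25; rewrite ler_nat.
- (* sqrt (f k') exceeds g (n I): by x_split with l = k', all blocks but one
     contribute at most 2 / g (n I) + 1 / k each *)
  apply: (@le_trans _ _ (2 + 2 * (n I / g (n I)))); last by move: tg ng G25; exact: small_le_G.
  have gs : g (n I) <= Num.sqrt (f (k'%:R : R)).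
    apply: (le_trans _ kbig); apply: ler_f => //.
    by rewrite lerD2l; apply: le_trans (n_le I); exact: div_le_self.
  have [i0 hi0] := x_split k'0.
  rewrite /blocks proj_sum pairing_sumr; last by move=> i _; apply: c00_proj; exact: x_c00.
  apply: (le_trans (ler_norm_sum _ _ _)).
  set c := (2 / Num.sqrt (f (k'%:R : R)) + k%:R^-1).
  have kk := k1.
  have c0 : 0 <= c by rewrite /c addr_ge0// ?divr_ge0 ?invr_ge0// ltW.
  apply: (@le_trans _ _ (\sum_(i in I) ((if i == i0 then 1 else 0) + c))).
    apply: ler_sum => i _; have cFi : c00 (proj F (x i)) by apply: c00_proj; exact: x_c00.
    have xi : nm (proj F (x i)) <= 1.
      by apply: le_trans (nm_proj hX F (x_c00 (ltn_ord i))) _; exact: x_le1.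
    case: eqP => [_|/eqP ii].
      rewrite -[leLHS]addr0 lerD//; apply: le_trans xi.
      exact: (nm_special hX cFi kK su).
    rewrite add0r uE pairingZl// normrM ger0_norm ?invr_ge0 ?sqrtr_ge0//.
    rewrite ler_pdivrMl//.
    have -> : Num.sqrt (f (k'%:R : R)) * c = 2 + Num.sqrt (f (k'%:R : R)) / k%:R.
      by rewrite /c mulrDr mulrC divfK ?gt_eqF.
    apply: le_trans (hi0 i ii _ sE); rewrite pairing_suml//.
    apply: (le_trans (ler_norm_sum _ _ _)); apply: ler_sum => a _.
    rewrite (pairing_supp (E := supp (z a)))//.
    have cz : c00 (proj (supp (z a)) (proj F (x i))) by exact: c00_proj.
    apply: le_trans (Astar_nm hX (M0 a (ltn_ord a)) (zM a (ltn_ord a)) cz) _.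
    apply: (nm_abs hX); last by apply: c00_proj; exact: x_c00.
    move=> b; rewrite /proj; case: ifP => // _.
    by case: ifP => // _; rewrite normr0.
  rewrite big_split /= sumr_const -/(n I) -[X in _ + X]mulr_natl.
  have -> : 2 + 2 * (n I / g (n I)) = 1 + (2 * (n I / g (n I)) + 1) by ring.
  apply: lerD.
    rewrite -big_mkcondr /=; apply: (@le_trans _ _ (\sum_(i in [set i0]%SET) 1)).
      rewrite [leLHS]big_mkcond [leRHS]big_mkcond /=; apply: ler_sum => i _.
      by rewrite finset.in_set1; case: (i \in I) => //=; case: ifP.
    by rewrite finset.big_set1.
  rewrite /c mulrDr; apply: lerD.
    rewrite mulrCA ler_wpM2l// ler_wpM2l//.
    by rewrite lef_pV2 ?posrE.
  by rewrite ler_pdivrMr ?mul1r ?n_le//; exact: lt_le_trans kk.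
have [ks|ks] := leP (k'%:R ^+ 10) (n I / Q).
  apply: (done_by (4 / 3 * A * n I / g (n I))); last first.
    have -> : 4 / 3 * A * n I / g (n I) = 4 / 3 * G (n I) by rewrite /G !mulrA.
    by rewrite ler_wpM2r// ler_pdivrMr// -natrM ler_nat.
  apply: (sum_rec S0_ge S0P Q_ge1 A_ge (tt := fun a => #|Imeet x I (supp (z a))|)) => //.
  - exact: ltW.
  - move=> a; rewrite redE.
    apply: le_trans (Astar_nm hX (M0 a (ltn_ord a)) (zM a (ltn_ord a)) (c00_pb _ _)) _.
    exact: nm_pb_le.
  - move=> a; rewrite redE.
    exact: step_Astar (M0 a (ltn_ord a)) (zM a (ltn_ord a)).
have gM a : (a < k')%N -> g (n I) <= f ((M a)%:R : R).
  move=> ak; apply: ler_f => //.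
  apply: (@le_trans _ _ ((j (2 * k'))%:R)); last by rewrite ler_nat; exact: Mge.
  apply: le_trans (J_gap10 hj (KJ kK) j2J (K_lt_j2 hj kK)).
  by rewrite addrC lerD ?(ltW ks)// ler1n.
have term a : (a < k')%N -> `|pairing (z a) (proj F (blocks I))| <=
    2 + 2 * ((#|Imeet x I (supp (z a))|)%:R / g (n I)).
  move=> ak; rewrite redE.
  set I' := Imeet _ _ _.
  have [E sEa zE] := Astar_le hX (M0 a ak) (zM a ak) (c00_pb (supp (z a) `&` F) I').
  have ga := gM a ak.
  apply: le_trans (zE _ (c00_pb _ _)) _; rewrite ler_pdivrMl ?fn_gt0 ?M0//.
  apply: (@le_trans _ _ (psum (M a) E (proj (supp (z a) `&` F) (blocks I')))).
    by apply: ler_sum => b _; apply: (na_le_nm hX); apply: c00_proj; exact: c00_pb.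
  apply: (le_trans (psum_blocks2 _ I' (M0 a ak) sEa)).
  rewrite mulrDr [_ * 2]mulrC lerD2l mulrCA ler_wpM2l//.
  by rewrite mulrCA ler_peMr ?ler0n// ler_pdivlMr// mul1r.
apply: (done_by (\sum_(a < k') (2 + 2 * ((#|Imeet x I (supp (z a))|)%:R / g (n I))))).
  by apply: ler_sum => a _; exact: term.
rewrite big_split /= sumr_const card_ord -[X in X + _]mulr_natr -mulr_sumr -mulr_suml.
rewrite -natr_sum.
have s2 : (\sum_(a < k') #|Imeet x I (supp (z a))|)%:R <= n I + k'%:R :> R.
  by rewrite -natrD ler_nat.
have kQ : k'%:R <= Q.
  by apply: (le_trans kp); rewrite /Q ler_peMl ?ler1n//; exact: le_trans p_ge1.
have sg : g (n I) <= n I / Q by apply: le_of_pow10 => //; exact: S0P (ltW h).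
exact: (few_terms_bound Q_ge1 kQ gI sg s2 tg).
Qed.

Lemma step_next F I : na N.+1 (proj F (blocks I)) <= G (n I).
Proof.
have A1 := A_ge; have Q1 := Q_ge1; have S1 := S0_ge.
apply/(naSP hX); first exact: c00_pb; split.
- move=> i; have := nm_coord hX i (c00_pb F I).
  have [h|h] := leP (n I / Q) S0.
    move=> hi; apply: (le_trans hi); apply: le_trans (nm_pb_le F I) _.
    exact: G_trivial.
  move=> _; apply: (le_trans (proj_abs _ _ _)); rewrite /blocks sumfE.
  have I0 : (0 < #|I|)%N.
    by rewrite lt0n; apply/negP => /eqP I0; move: h; rewrite /n I0 mul0r; lra.
  have [l hl] := ordered_one i k_gt0 x_ordered.
  apply: (@le_trans _ _ 1); last by have := G_ge25 I0; lra.
  have [lI|lI] := boolP (l \in I).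
    rewrite (bigD1 l)//= big1 ?addr0; last by move=> b /andP[_]; exact: hl.
    apply: le_trans (x_le1 (ltn_ord l)); apply: (nm_coord hX).
    exact: x_c00.
  rewrite big1 ?normr0// => b bI; apply: hl.
  by apply: contraNneq lI => <-.
- by move=> l E l0 sE; exact: step_split.
- by move=> k' u kK su; exact: step_special su.
Qed.

End Step.

Lemma na_pb0 F I : na 0 (proj F (blocks I)) <= G (n I).
Proof.
have A1 := A_ge; have Q1 := Q_ge1; have S1 := S0_ge.
have cF := c00_pb F I.
have [h|h] := leP (n I / Q) S0.
  apply: le_trans (na_le_nm hX 0 cF) _; apply: le_trans (nm_pb_le F I) _.
  exact: G_trivial.
have I0 : (0 < #|I|)%N.
  by rewrite lt0n; apply/negP => /eqP I0; move: h; rewrite /n I0 mul0r; lra.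
rewrite -lee_fin -(apxE hX)//=; apply/ereal_supP => _ [i _ <-]; rewrite lee_fin.
apply: (le_trans (proj_abs _ _ _)); rewrite /blocks sumfE.
have [l hl] := ordered_one i k_gt0 x_ordered.
apply: (@le_trans _ _ 1); last by have := G_ge25 I0; lra.
have [lI|lI] := boolP (l \in I).
  rewrite (bigD1 l)//= big1 ?addr0; last by move=> b /andP[_]; exact: hl.
  apply: le_trans (x_le1 (ltn_ord l)); apply: (nm_coord hX).
  exact: x_c00.
rewrite big1 ?normr0// => b bI; apply: hl.
by apply: contraNneq lI => <-.
Qed.

(** Induction along the approximants of the norm. The count n is divided by Q = 2 p
    to absorb the at most p terms of a short special functional. *)
Theorem upper_estimate F I : nm (proj F (blocks I)) <= A * n I / f (1 + n I / (2 * p)).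
Proof.
suff h N : na N (proj F (blocks I)) <= G (n I) by apply: (nm_le hX) => //; exact: c00_pb.
elim: N F I => [|N IH] F I; first exact: na_pb0.
exact: step_next.
Qed.

Theorem split_estimate l E I : S0 <= n I / (2 * p) -> (0 < l)%N ->
  (l%:R : R) ^+ 10 <= n I / (2 * p) -> successive_sets l E ->
  psum l E (blocks I) <= 4 / 3 * A * n I / f (1 + n I / (2 * p)).
Proof.
move=> hS l0 ls sE.
have e a : proj (E a) (blocks I) = proj (E a) (blocks (Imeet x I (E a))).
  by rewrite (@proj_blocks_meet (E a)).
apply: (sum_rec S0_ge S0P Q_ge1 A_ge (tt := fun a => #|Imeet x I (E a)|)) => //.
- exact: count_meet.
- by move=> a; rewrite e; exact: nm_pb_le.
- by move=> a; rewrite e; exact: upper_estimate.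
Qed.

End Blocks.
End Upper.

(** * Sums of m blocks with m in L *)
Section JPred.
Variables (R : realType) (j : nat -> nat).
Hypothesis hj : admissible R j.

Lemma j_mono i i' : (0 < i)%N -> (i <= i')%N -> (j i <= j i')%N.
Proof.
case: hj => inc _ _ i0; rewrite leq_eqVlt => /orP[/eqP ->//|ii].
by apply/ltnW/inc.
Qed.

Lemma j_inj i i' : (0 < i)%N -> (0 < i')%N -> j i = j i' -> i = i'.
Proof.
case: hj => inc _ _ i0 i0' e; case: (ltngtP i i') => // h.
  by have := inc _ _ i0 h; rewrite e ltnn.
by have := inc _ _ i0' h; rewrite e ltnn.
Qed.

Lemma KL_disj k m : Kset j k -> Lset j m -> k <> m.
Proof.
move=> [i /= oi <-] [i' /= /andP[i0 oi'] <-] e.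
have ii : i = i' by apply: j_inj => //; case: i oi e.
by move: oi'; rewrite -ii oi.
Qed.

(** Here p is the predecessor of m in J, or 1 if there is none. *)
Lemma J_pred m : Jset j m -> exists p : nat,
  [/\ (0 < p)%N, forall k, Jset j k -> (k < m)%N -> (k <= p)%N &
      ((2 * p) ^ 2 <= m)%N].
Proof.
move=> [i /= i0 <-]; case: i i0 => [//|[|i]] _.
  exists 1%N; split=> //.
    move=> k [i /= i0 <-]; rewrite ltnNge => /negP[].
    exact: j_mono.
  have := J_ge100 hj (Jset_j j (ltn0Sn 0)).
  rewrite -(ler_nat R) => h; apply: le_trans h.
  by rewrite ler_nat.
have J1 : Jset j (j i.+1) by exact: Jset_j.
have J2 : Jset j (j i.+2) by exact: Jset_j.
have h1 : (j i.+1 < j i.+2)%N by case: hj => inc _ _; exact: inc.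
exists (j i.+1); split.
- exact: Jset_gt0 hj _ J1.
- move=> k [l /= l0 <-] lt; apply: j_mono => //; rewrite leqNgt; apply/negP => il.
  by move: lt; rewrite ltnNge j_mono.
rewrite -(ler_nat R); apply: le_trans (J_gap10 hj J1 J2 h1).
rewrite natrX natrM; have := J_ge100 hj J1; set x := (j i.+1)%:R => x1.
have x8 : 4 <= x ^+ 8.
  apply: (@le_trans _ _ (2 ^+ 8)); first by rewrite -natrX ler_nat.
  by apply: lerXn2r; rewrite ?nnegrE; lra.
rewrite exprMn [x ^+ 10](_ : _ = x ^+ 8 * x ^+ 2) -?exprD//.
have : 0 <= (x ^+ 8 - 4) * x ^+ 2 by rewrite mulr_ge0 ?sqr_ge0//; lra.
rewrite -[(2%:R) ^+ 2]natrX; lra.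
Qed.

Lemma f_ge_ln (x : R) : 0 < x -> ln x <= f x.
Proof.
move=> x0; rewrite /f ler_pdivlMr ?ln2_gt0'//.
have l2 : ln 2 <= 1 :> R by have := @le_ln1Dx R 1; rewrite -[1 + 1]/(2%:R); apply; lra.
have [lx|lx] := leP 0 (ln x); last first.
  apply: (@le_trans _ _ 0); last by apply: ln_ge0; lra.
  by rewrite mulr_le0_ge0 ?(ltW lx)// ltW// ln2_gt0'.
apply: (@le_trans _ _ (ln x)); first by rewrite ler_piMr.
by rewrite ler_ln ?posrE//; lra.
Qed.

Lemma J_f_gap m n : Jset j m -> Jset j n -> (m < n)%N ->
  (4 * (m%:R : R)) ^+ 4 <= f (n%:R : R).
Proof.
move=> mJ nJ mn; have h := J_gap hj mJ nJ mn.
have m1 := J_ge100 hj mJ; set x : R := m%:R in m1 h *.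
have e0 := expR_gt0 (expR (expR (4 * x ^+ 2))).
have n0 : (0 : R) < n%:R by exact: lt_le_trans h.
apply: le_trans (f_ge_ln n0).
apply: (@le_trans _ _ (expR (expR (4 * x ^+ 2)))); last first.
  by rewrite -[leLHS]expRK ler_ln ?posrE ?expR_gt0.
apply: (le_trans _ (expR_ge_self _)).
have -> : 4 * x ^+ 2 = (x ^+ 2) * 4%:R by ring.
rewrite expRM_natr; apply: lerXn2r; rewrite ?nnegrE ?expR_ge0//; first by lra.
apply: (le_trans _ (expR_ge_self _)); rewrite expr2 ler_wpM2r//; lra.
Qed.

Lemma J_sqrtf_gap m n : Jset j m -> Jset j n -> (m < n)%N ->
  f (1 + m%:R) <= Num.sqrt (f (n%:R : R)).
Proof.
move=> mJ nJ mn; have h := J_f_gap mJ nJ mn.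
have m1 := J_ge100 hj mJ; set x : R := m%:R in m1 h *.
have fx : f (1 + x) <= 4 * x by have := @f_le_double R (1 + x); lra.
have f0 : 0 <= f (1 + x) by apply: f_ge0; lra.
rewrite -[leLHS]ger0_norm// -sqrtr_sqr ler_wsqrtr//; apply: (le_trans _ h).
apply: (@le_trans _ _ ((4 * x) ^+ 2)).
  by apply: lerXn2r; rewrite ?nnegrE//; lra.
by apply: ler_weXn2l => //; lra.
Qed.

Lemma f_half (t Q : R) : 1 <= t -> 0 < Q -> Q ^+ 2 <= t -> f t <= 2 * f (1 + t / Q).
Proof.
move=> t1 Q0 Qt; have : 1%:R * f t <= 2%:R * f (1 + t / Q); last by rewrite mul1r.
have tQ : 0 <= t / Q by rewrite divr_ge0//; lra.
apply: f_pow; [by lra|by lra|].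
rewrite expr1; have h : t <= (t / Q) ^+ 2.
  rewrite expr_div_n ler_pdivlMr ?exprn_gt0// [t ^+ 2]expr2 ler_wpM2l//; lra.
have -> : (1 + t / Q + 1) ^+ 2 = (t / Q) ^+ 2 + 4 * (t / Q) + 4 by ring.
lra.
Qed.

Lemma f_ge_pow (n l : nat) : (2 ^ n <= l)%N -> n%:R <= f (l%:R : R).
Proof.
move=> h; rewrite /f ler_pdivlMr ?ln2_gt0'// mulr_natl -lnXn//.
have lp : 0 < l%:R + 1 :> R by rewrite ltr_wpDl.
rewrite ler_ln ?posrE ?exprn_gt0//.
by rewrite -natrX; apply: (@le_trans _ _ l%:R); rewrite ?ler_nat// lerDl.
Qed.

End JPred.

Section Dichotomy.
Variables (R : realType) (X : completeNormedModType R) (iota : (nat -> R) -> X).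
Notation psum := (psum iota).

(** The exceptional block is the first one on which l pieces are not negligible; by
    the dichotomy, l pieces gain nothing on the later blocks. *)
Lemma split_dichotomy k (x : nat -> nat -> R) : (0 < k)%N ->
  (forall i i' l, (i < i')%N -> (i' < k)%N -> (0 < l)%N ->
     (forall E, successive_sets l E ->
        psum l E (x i) <= Num.sqrt (f (l%:R : R)) / k%:R) \/
     (forall E, successive_sets l E -> psum l E (x i') <= 2)) ->
  forall l, (0 < l)%N -> exists i0 : 'I_k, forall i : 'I_k,
  i != i0 -> forall E, successive_sets l E ->
  psum l E (x i) <= 2 + Num.sqrt (f (l%:R : R)) / k%:R.
Proof.
move=> k0 dich l l0.
have s0 : 0 <= Num.sqrt (f (l%:R : R)) / k%:R by rewrite divr_ge0 ?sqrtr_ge0.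
pose res i := forall E, successive_sets l E ->
        psum l E (x i) <= Num.sqrt (f (l%:R : R)) / k%:R.
have [all|] := pselect (forall i : 'I_k, res i).
  exists (Ordinal k0) => i _ E sE; apply: le_trans (all i E sE) _.
  by rewrite lerDr.
move=> /existsNP[i1 hi1].
have ex : exists i, (i < k)%N && `[< ~ res i >].
  by exists i1; rewrite ltn_ord /=; apply/asboolP.
have := ex_minnP ex; case: ex_minnP => i0 /andP[i0k /asboolP ni0] imin _.
exists (Ordinal i0k) => i ii E sE.
case: (ltngtP i i0) => [h|h|h]; last by case/eqP: ii; apply/val_inj.
  have : res i.
    apply: contrapT => ni; have := imin i; rewrite ltn_ord /=.
    by rewrite (asboolT ni) leqNgt h => /(_ isT).
  by move=> /(_ E sE) h'; apply: (le_trans h'); rewrite lerDr.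
case: (dich _ _ l h (ltn_ord i) l0) => // h'.
by apply: le_trans (h' E sE) _; rewrite lerDl.
Qed.

End Dichotomy.

Section BlockSum.
Variables (R : realType) (j : nat -> nat) (sigma : seq (nat -> R) -> nat).
Variables (X : completeNormedModType R) (iota : (nat -> R) -> X).
Hypothesis hj : admissible R j.
Hypothesis hsigma : coding_function j sigma.
Hypothesis hX : is_completion (gowers_norm j sigma) iota.
Notation apx := (gowers_norm_approx j sigma).
Notation nm := (nm iota).
Notation psum := (psum iota).

(** A piece that does not vanish contains a point of the support. *)
Lemma psum_count l E (v : nat -> R) q : c00 v -> nm v <= 1 ->
  (forall i, supp v i -> (i < q)%N) -> successive_sets l E ->
  psum l E v <= q%:R.
Proof.
move=> cv v1 vq sE.
pose hit (a : 'I_l) (i : 'I_q) : bool := `[< E a i >].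
apply: (@le_trans _ _ (\sum_(a < l) \sum_(i < q) (hit a i)%:R)).
  apply: ler_sum => a _.
  have [h|h] := pselect (exists i, E a i /\ supp v i); last first.
    rewrite proj_disj ?(nm0 hX) ?sumr_ge0// => i Ei.
    by apply/eqP/negPn/negP => vi; apply: h; exists i.
  have [i [Ei vi]] := h; have iq := vq i vi.
  rewrite (bigD1 (Ordinal iq))//= (_ : hit _ _ = true); last by apply/asboolP.
  apply: (@le_trans _ _ 1); last by rewrite lerDl sumr_ge0.
  exact: le_trans (nm_proj hX _ cv) v1.
rewrite exchange_big /=.
apply: (@le_trans _ _ (\sum_(i < q) 1)); last by rewrite sumr_const card_ord.
apply: ler_sum => i _.
pose F (a : nat) : R := (`[< E a i >])%:R.
apply: (sum_atmost1 (F := F)) => // [a al|a a' aa al]; first by rewrite /F; case: asboolP.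
rewrite /F; case: asboolP => h1; last by left.
case: asboolP => h2; last by right.
have e := successive_sets_disj sE (ltn_trans aa al) al h1 h2.
by move: aa; rewrite e ltnn.
Qed.

Variable S0 : R.
Hypothesis S0_ge : 1000 <= S0.
Hypothesis S0P : forall s, S0 <= s -> (2 * f (1 + s)) ^+ 10 <= s.
Let A : R := 100 + f (1 + S0).

Variables (b : nat -> nat -> R) (q : nat -> nat).
Hypothesis q_inc : forall n, (q n < q n.+1)%N.
Hypothesis b_c00 : forall n, c00 (b n).
Hypothesis b_supp : forall n i, supp (b n) i -> (q n <= i < q n.+1)%N.
Hypothesis b_le1 : forall n, nm (b n) <= 1.
Hypothesis b_split : forall n l E, (l <= 2 ^ ((n * q n) ^ 2))%N ->
  successive_sets l E -> psum l E (b n) <= 2.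

Lemma q_mono n n' : (n <= n')%N -> (q n <= q n')%N.
Proof.
move=> /subnK <-; elim: (n' - n)%N => [//|d IH]; rewrite addSn.
by apply: leq_trans IH _; exact: ltnW.
Qed.

Lemma q_ge n : (n <= q n)%N.
Proof. by elim: n => // n IH; apply: leq_ltn_trans IH _. Qed.

Variables (m n0 : nat).
Hypothesis m_L : Lset j m.
Hypothesis m_n0 : (m <= n0)%N.

Let x i := b (n0 + i).
Let m_gt0 : (0 < m)%N. Proof. by apply: (Jset_gt0 hj); exact: LJ. Qed.

Let x_ordered : ordered m x.
Proof.
move=> i i' ii _ a c /b_supp /andP[_ h] /b_supp /andP[h' _].
apply: leq_trans h (leq_trans _ h').
by apply: q_mono; rewrite -addnS leq_add2l.
Qed.

Let x_split l : (0 < l)%N -> exists i0 : 'I_m, forall i : 'I_m,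
  i != i0 -> forall E, successive_sets l E ->
  psum l E (x i) <= 2 + Num.sqrt (f (l%:R : R)) / m%:R.
Proof.
move: l; apply: split_dichotomy => // i i' l ii im l0.
have [h|h] := leqP l (2 ^ (((n0 + i') * q (n0 + i')) ^ 2)).
  by right => E; exact: b_split.
left => E sE.
have mR : (0 : R) < m%:R by rewrite ltr0n.
rewrite ler_pdivlMr//.
apply: (@le_trans _ _ ((n0 + i') * q (n0 + i'))%:R).
  rewrite mulnC natrM; apply: ler_pM => //.
  - by apply: sumr_ge0 => a _; exact: nm_ge0.
  - apply: le_trans (psum_count (q := q (n0 + i).+1) (b_c00 _) (b_le1 _) _ sE) _.
      by move=> c /b_supp /andP[].
    by rewrite ler_nat; apply: q_mono; rewrite -addnS leq_add2l.
  - by rewrite ler_nat (leq_trans m_n0)// leq_addr.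
rewrite -[leLHS]ger0_norm// -sqrtr_sqr ler_wsqrtr// -natrX.
by apply: f_ge_pow; exact: ltnW.
Qed.

(** No special functional has a length in L, so [upper_estimate] applies with its last
    alternative void. *)
Theorem block_sum : S0 ^+ 2 <= m%:R ->
  let v := \sum_(i < m) b (n0 + i) in
  [/\ forall E, nm (proj E v) <= 2 * A * m%:R / f (m%:R : R),
      forall l E F, (0 < l)%N -> (l ^ 20 <= m)%N -> successive_sets l E ->
        psum l E (proj F v) <= 8 / 3 * A * m%:R / f (m%:R : R) &
      forall l E F, (0 < l)%N -> successive_sets l E ->
        psum l E (proj F v) <= 2 * f (l%:R : R) + 2 * m%:R].
Proof.
move=> Sm v; have mJ := LJ m_L.
have [p [p0 pP p2]] := J_pred hj mJ.
have pR : 1 <= p%:R :> R by rewrite ler1n.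
have mR : 1 <= m%:R :> R by rewrite ler1n.
have p2R : (2 * p%:R) ^+ 2 <= m%:R :> R by rewrite -natrM -natrX ler_nat.
have Kc k' : Kset j k' -> [\/ k'%:R <= p%:R :> R,
     f (1 + m%:R) <= Num.sqrt (f (k'%:R : R)) |
     forall N u (I : {set 'I_m}) E, special_functional j sigma (apx N) k' u ->
       `|pairing u (proj E (blocks x I))| <= 4].
  move=> kK; case: (ltngtP k' m) => h.
  - by apply: Or31; rewrite ler_nat; apply: pP => //; exact: (KJ kK).
  - by apply: Or32; exact: (J_sqrtf_gap hj mJ (KJ kK) h).
  - by case: (KL_disj hj kK m_L).
have xc i : (i < m)%N -> c00 (x i) by move=> _; exact: b_c00.
have x1 i : (i < m)%N -> nm (x i) <= 1 by move=> _; exact: b_le1.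
have vE : v = blocks x [set: 'I_m]%SET.
  by rewrite /v /blocks; apply: eq_bigl => i; rewrite finset.in_setT.
have cT : #|[set: 'I_m]%SET| = m by rewrite cardsT card_ord.
have cv : c00 v by apply: c00_sum => i _; exact: b_c00.
have fm : f (m%:R : R) <= 2 * f (1 + m%:R / (2 * p%:R)).
  by apply: f_half => //; lra.
have fm1 := fn_ge1 R m_gt0.
have A0 : 0 <= A by rewrite /A addr_ge0// f_ge0//; have := S0_ge; lra.
have half (C : R) : 0 <= C -> C * m%:R / f (1 + m%:R / (2 * p%:R)) <= 2 * C * m%:R / f (m%:R : R).
  move=> C0; rewrite ler_pdivrMr; last by lra.
  rewrite [leRHS]mulrAC ler_pdivlMr; last by lra.
  have -> : 2 * C * m%:R * f (1 + m%:R / (2 * p%:R)) = (C * m%:R) * (2 * f (1 + m%:R / (2 * p%:R))) by ring.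
  by rewrite ler_wpM2l// mulr_ge0//; lra.
split.
- move=> E; rewrite vE.
  apply: (le_trans (upper_estimate hj hsigma hX S0_ge S0P pR m_gt0 xc x_ordered x1 x_split Kc E _)).
  by rewrite cT -/A; exact: half.
- move=> l E F l0 lm sE; apply: (le_trans (psum_proj_le hX _ _ _ cv)).
  rewrite vE.
  have l1R : 1 <= l%:R :> R by rewrite ler1n.
  have pp : 0 < 2 * p%:R :> R by lra.
  have lp : (l%:R : R) ^+ 10 <= #|[set: 'I_m]%SET|%:R / (2 * p%:R).
    rewrite cT ler_pdivlMr// -(@ler_pXn2r _ 2)// ?nnegrE; [|by rewrite mulr_ge0 ?exprn_ge0//; lra|by lra].
    rewrite exprMn -exprM expr2; apply: ler_pM => //; rewrite ?exprn_ge0//; try lra.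
    by rewrite -natrX ler_nat.
  have Sp : S0 <= #|[set: 'I_m]%SET|%:R / (2 * p%:R).
    have S1 := S0_ge.
    rewrite cT ler_pdivlMr// -(@ler_pXn2r _ 2)// ?nnegrE; [|by rewrite mulr_ge0//; lra|by lra].
    by rewrite exprMn expr2; apply: ler_pM => //; rewrite ?exprn_ge0 ?sqr_ge0//; lra.
  apply: (le_trans (split_estimate hj hsigma hX S0_ge S0P pR m_gt0 xc x_ordered x1 x_split Kc Sp l0 lp sE)).
  rewrite cT -/A; apply: (le_trans (half (4 / 3 * A) _)); first by rewrite mulr_ge0//; lra.
  by rewrite le_eqVlt; apply/orP; left; apply/eqP; field; lra.
- move=> l E F l0 sE; rewrite vE.
  have := psum_blocks2 hX m_gt0 xc x1 x_split F [set: 'I_m]%SET l0 sE.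
  by rewrite cT.
Qed.

End BlockSum.

(** * Rational norming functionals *)
Lemma inj_unbounded (g : nat -> nat) B : injective g -> exists t, (B <= g t)%N.
Proof.
move=> gi; apply: contrapT => /forallNP h.
have hB t : (g t < B)%N by rewrite ltnNge; apply/negP; exact: h.
pose F (t : 'I_B.+1) : 'I_B := Ordinal (hB t).
have Fi : injective F by move=> t t' [/gi e]; apply/val_inj.
by have := leq_card F Fi; rewrite !card_ord ltnn.
Qed.

Section RationalFunctionals.
Variables (R : realType) (j : nat -> nat) (sigma : seq (nat -> R) -> nat).
Variables (X : completeNormedModType R) (iota : (nat -> R) -> X).
Hypothesis hj : admissible R j.
Hypothesis hX : is_completion (gowers_norm j sigma) iota.
Implicit Types x y u : nat -> R.
Notation apx := (gowers_norm_approx j sigma).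
Notation na := (na j sigma).
Notation nm := (nm iota).

Lemma norming_pos N x r : c00 x -> 0 <= r -> r < na N x ->
  exists u, [/\ c00 u, (dual_norm (apx N) u <= 1)%E, supp u `<=` supp x,
                forall i, 0 <= u i * x i & r < pairing u x].
Proof.
move=> cx r0 rx; have [u [cu du su pu]] := norming hX cx r0 rx.
pose v i := if 0 <= x i then `|u i| else - `|u i|.
have vu i : `|v i| = `|u i| by rewrite /v; case: ifP; rewrite ?normrN normr_id.
have vx i : v i * x i = `|u i * x i|.
  rewrite /v normrM; case: ifPn => h; first by rewrite (ger0_norm h).
  by rewrite (ltr0_norm (_ : x i < 0)) ?ltNge// mulrN mulNr.
exists v; split.
- by apply: (c00_le (y := u)) => // i; rewrite vu.
- by apply: (dual_abs hX) du => i; rewrite vu.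
- by move=> i; rewrite /supp /= -normr_eq0 vu normr_eq0; exact: su.
- by move=> i; rewrite vx.
- apply: (lt_le_trans pu); have /c00P[C xC] := cx.
  rewrite !(@pairingE _ _ x C) => [|i /xC ->|i /xC ->]; rewrite ?mulr0//.
  by apply: ler_sum => i _; rewrite vx ler_norm.
Qed.

Lemma rational_below (r : R) : exists c : rat,
  [/\ 3 / 4 * `|r| <= `|ratr c|, `|ratr c : R| <= `|r| & 0 <= ratr c * r].
Proof.
have pos (s : R) : 0 < s -> exists c : rat, 3 / 4 * s <= ratr c <= s.
  move=> s0; have : 3 / 4 * s < s by lra.
  move=> /rat_in_itvoo[c]; rewrite in_itv /= => /andP[h1 h2].
  by exists c; rewrite !ltW.
have [r0|r0|->] := ltgtP r 0.
- have [|c /andP[h1 h2]] := pos (- r); first by rewrite oppr_gt0.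
  have c0 : 0 <= ratr c :> R by lra.
  exists (- c); rewrite rmorphN normrN (ger0_norm c0) (ltr0_norm r0).
  by split=> //; rewrite mulNr -mulrN mulr_ge0//; lra.
- have [c /andP[h1 h2]] := pos r r0.
  have c0 : 0 <= ratr c :> R by lra.
  exists c; rewrite (ger0_norm c0) (gtr0_norm r0); split=> //.
  by rewrite mulr_ge0// ltW.
- by exists 0; rewrite rmorph0 normr0 mulr0 mul0r.
Qed.

Lemma dual_coord N u i : (dual_norm (apx N) u <= 1)%E -> `|u i| <= 1.
Proof.
move=> du; rewrite -(pairing_unit u i).
by apply: le_trans (dual_le hX du (c00_unit R i)) _; exact: (na_unit hj hX).
Qed.

(** The U t are a rational approximation of u multiplied by the distinct factors
    1 - 1 / (t + 3). Their moduli are distinct, hence so are their codes: this is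
    what allows the codes to be taken arbitrarily large. *)
Theorem rational_functionals m N (phi : nat -> nat -> R) : (0 < m)%N ->
  (forall i, (i < m)%N -> [/\ c00 (phi i), (dual_norm (apx N) (phi i) <= 1)%E &
      supp (phi i) !=set0]) ->
  ordered m phi ->
  let u := (f (m%:R : R))^-1 *: \sum_(i < m) phi i in
  exists U : nat -> nat -> R,
    [/\ forall t, Qset (U t), forall t, Astar (apx N) m (U t),
        injective (fun t => vabs (U t)),
        forall t, supp (U t) = supp u &
        forall t i, 2^-1 * `|u i| <= `|U t i| /\ 0 <= U t i * u i].
Proof.
move=> m0 hphi phio u; have fm := fn_ge1 R m0.
have fm0 : 0 < f (m%:R : R) by exact: fn_gt0.
have cu : c00 u by apply/c00Z/c00_sum => i _; have [] := hphi i (ltn_ord i).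
have uE (l : 'I_m) i : supp (phi l) i -> u i = (f (m%:R : R))^-1 * phi l i.
  move=> pl; rewrite /u scalrfctE sumfE (bigD1 l)//= big1 ?addr0// => l' l'l.
  have [l0 h0] := ordered_one i m0 phio.
  have e : l = l0 by apply/eqP/negPn/negP => /h0 e; move: pl; rewrite /supp /= e eqxx.
  by apply: h0; rewrite -e.
have u0 i : (forall l : 'I_m, ~ supp (phi l) i) -> u i = 0.
  move=> h; rewrite /u scalrfctE sumfE big1 ?scaler0// => l _.
  by apply/eqP/negPn/negP; exact: h.
have u1 i : `|u i| <= 1.
  have [[l pl]|/forallNP/u0 ->] := pselect (exists l : 'I_m, supp (phi l) i); last by rewrite normr0.
  rewrite (uE _ _ pl) normrM ger0_norm ?invr_ge0 ?(ltW fm0)// ler_pdivrMl// mulr1.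
  apply: le_trans fm; have [_ dl _] := hphi l (ltn_ord l).
  exact: dual_coord dl.
have /choice[c hc] : forall i, exists c : rat,
    [/\ 3 / 4 * `|u i| <= `|ratr c|, `|ratr c : R| <= `|u i| & 0 <= ratr c * u i].
  by move=> i; exact: rational_below.
pose th (t : nat) : rat := 1 - (t.+3)%:R^-1.
have thR t : ratr (th t) = 1 - t.+3%:R^-1 :> R.
  by rewrite /th rmorphB rmorph1 fmorphV rmorph_nat.
have th1 t : 2 / 3 <= (ratr (th t) : R) <= 1.
  rewrite thR; have h : t.+3%:R^-1 <= 3^-1 :> R by rewrite lef_pV2 ?posrE ?ler_nat// ltr0n.
  have h' : 0 <= t.+3%:R^-1 :> R by rewrite invr_ge0.
  by move: (t.+3%:R^-1) h h' => w h h'; apply/andP; split; lra.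
have thinj t t' : ratr (th t) = ratr (th t') :> R -> t = t'.
  rewrite !thR => /addrI/oppr_inj/invr_inj/eqP.
  by rewrite eqr_nat => /eqP[].
pose U t i : R := ratr (th t * c i).
have UE t i : U t i = ratr (th t) * ratr (c i) by rewrite /U rmorphM.
have nU t i : `|U t i| = ratr (th t) * `|ratr (c i)|.
  by rewrite UE normrM ger0_norm//; have /andP[] := th1 t; lra.
have Ule t i : `|U t i| <= `|u i|.
  rewrite nU; have [_ h _] := hc i; apply: le_trans h.
  by rewrite ler_piMl//; have /andP[] := th1 t.
have Uge t i : 2^-1 * `|u i| <= `|U t i|.
  rewrite nU; have [h _ _] := hc i; have /andP[h1 _] := th1 t.
  apply: (@le_trans _ _ (2 / 3 * (3 / 4 * `|u i|))); first by lra.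
  by apply: ler_pM => //; rewrite mulr_ge0.
have sU t : supp (U t) = supp u.
  apply/seteqP; split => i; rewrite /supp /= -!normr_gt0 => h.
    exact: lt_le_trans h (Ule t i).
  by apply: lt_le_trans (Uge t i); rewrite mulr_gt0.
exists U; split=> //.
- move=> t; split; first by apply: c00_le cu => i; exact: Ule.
  move=> i; split; first by exists (th t * c i).
  exact: le_trans (Ule t i) (u1 i).
- move=> t.
  exists (fun l => f (m%:R : R) *: proj (supp (phi l)) (U t)).
  have psi l i : (l < m)%N -> `|(f (m%:R : R) *: proj (supp (phi l)) (U t)) i| <= `|phi l i|.
    move=> lm; rewrite scalrfctE normrM (ger0_norm (ltW fm0)).
    have [pl|pl] := pselect (supp (phi l) i); last by rewrite proj_notin// normr0 mulr0.
    rewrite proj_in//; apply: (@le_trans _ _ (f (m%:R : R) * `|u i|)).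
      by rewrite ler_wpM2l// ltW.
    rewrite (uE (Ordinal lm) _ pl) normrM ger0_norm ?invr_ge0 ?(ltW fm0)//.
    by rewrite mulVKf// gt_eqF.
  have psis l : (l < m)%N -> supp (f (m%:R : R) *: proj (supp (phi l)) (U t)) = supp (phi l).
    move=> lm; apply/seteqP; split => i.
      by rewrite /supp /= scalrfctE scaler_eq0 negb_or => /andP[_ h]; have [] := supp_proj h.
    move=> pl; rewrite /supp /= scalrfctE scaler_eq0 negb_or gt_eqF//= proj_in//.
    have : supp (U t) i.
      rewrite sU /supp /= (uE (Ordinal lm) _ pl) mulf_eq0 negb_or invr_eq0 gt_eqF//.
    by [].
  split.
  - move=> l lm; have [cl dl _] := hphi l lm; split.
      by apply: c00_le cl => i; exact: psi.
    by apply: (dual_abs hX) dl => i; exact: psi.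
  - move=> l l' ll lm; rewrite !psis//; last exact: ltn_trans lm.
    have [_ _ ne] := hphi l (ltn_trans ll lm); have [_ _ ne'] := hphi l' lm.
    by split=> // i i'; exact: phio.
  - apply/funext => i; rewrite scalrfctE sumfE.
    have [[l pl]|/forallNP h] := pselect (exists l : 'I_m, supp (phi l) i).
      rewrite (bigD1 l)//= big1 ?addr0 => [|l' l'l].
        by rewrite scalrfctE proj_in// /GRing.scale /= mulKf// gt_eqF.
      rewrite scalrfctE proj_notin ?scaler0// => pl'.
      have [l0 h0] := ordered_one i m0 phio.
      have e : l = l0 by apply/eqP/negPn/negP => /h0 e; move: pl; rewrite /supp /= e eqxx.
      by move: l'l; rewrite e => /h0 e'; move: pl'; rewrite /supp /= e' eqxx.
    rewrite big1 ?scaler0 => [|l _]; last by rewrite scalrfctE proj_notin ?scaler0.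
    apply/normr0_eq0/le_anti; rewrite normr_ge0 andbT.
    by apply: le_trans (Ule t i) _; rewrite u0// normr0.
- move=> t t' e; apply: thinj.
  have [_ _ [i pi]] := hphi 0%N m0.
  have ui : supp u i.
    by rewrite /supp /= (uE (Ordinal m0) _ pi) mulf_eq0 negb_or invr_eq0 gt_eqF.
  have := congr1 (fun v => v i) e; rewrite /vabs !nU; apply: mulIf.
  rewrite gt_eqF//; have [h _ _] := hc i; apply: lt_le_trans h.
  by rewrite mulr_gt0 ?normr_gt0.
- move=> t i; split=> //; rewrite UE -mulrA mulr_ge0//; last by have [] := hc i.
  by have /andP[] := th1 t; lra.
Qed.

End RationalFunctionals.

(** * Special sequences carried by the wrong parts *)
Section SpecialSequence.
Variables (R : realType) (j : nat -> nat) (sigma : seq (nat -> R) -> nat).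
Variables (X : completeNormedModType R) (iota : (nat -> R) -> X).
Hypothesis hj : admissible R j.
Hypothesis hsigma : coding_function j sigma.
Hypothesis hX : is_completion (gowers_norm j sigma) iota.
Notation apx := (gowers_norm_approx j sigma).
Notation na := (na j sigma).
Notation nm := (nm iota).

Variables (a b : nat -> nat -> R) (q : nat -> nat) (c0 : R).
Hypothesis q_inc : forall n, (q n < q n.+1)%N.
Hypothesis a_c00 : forall n, c00 (a n).
Hypothesis a_supp : forall n i, supp (a n) i -> (q n <= i < q n.+1)%N.
Hypothesis ab_disj : forall n n' i, supp (a n) i -> b n' i = 0.
Hypothesis c0_gt0 : 0 < c0.
Hypothesis a_ge : forall n, c0 <= nm (a n).

Lemma a_norming n : exists p : (nat -> R) * nat,
  [/\ c00 p.1, (dual_norm (apx p.2) p.1 <= 1)%E, supp p.1 `<=` supp (a n),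
      forall i, 0 <= p.1 i * a n i & c0 / 2 < pairing p.1 (a n)].
Proof.
have c4 : 0 < c0 / 4 by rewrite divr_gt0.
have [N hN] := na_approx hX (a_c00 n) c4.
have c2 : c0 / 2 < na N (a n) by apply: lt_le_trans hN; have := a_ge n; have := c0_gt0; lra.
have c20 : 0 <= c0 / 2 by rewrite divr_ge0// ltW.
have [u hu] := norming_pos hX (a_c00 n) c20 c2.
by exists (u, N).
Qed.

Lemma max_level (Nf : nat -> nat) m : exists N, forall e, (e < m)%N -> (Nf e <= N)%N.
Proof.
exists (\max_(e < m) Nf e) => e em.
exact: (leq_bigmax (F := fun e : 'I_m => Nf e) (Ordinal em)).
Qed.

(** Functionals norming m consecutive wrong parts are added and divided by f m,
    then made rational, which costs a factor 2. *)
Lemma block_functionals n0 m N0 : (0 < m)%N -> exists (N : nat) (U : nat -> nat -> R),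
  [/\ (N0 <= N)%N, forall t, Qset (U t) /\ Astar (apx N) m (U t),
      injective (fun t => vabs (U t)),
      forall t, supp (U t) !=set0 /\ forall c, supp (U t) c ->
        (forall n, b n c = 0) /\ (q n0 <= c < q (n0 + m))%N &
      forall t e, (e < m)%N -> c0 / (4 * f (m%:R : R)) <= pairing (U t) (a (n0 + e))].
Proof.
move=> m0; have fm := fn_gt0 R m0.
have /choice[P hP] := a_norming.
have [N1 hN1] := max_level (fun e => (P (n0 + e)%N).2) m.
pose N := maxn N0 N1; pose phi e := (P (n0 + e)%N).1.
have sphi e : supp (phi e) `<=` supp (a (n0 + e)) by have [] := hP (n0 + e)%N.
have phi_ok e : (e < m)%N -> [/\ c00 (phi e), (dual_norm (apx N) (phi e) <= 1)%E &
      supp (phi e) !=set0].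
  move=> em; have [h1 h2 h3 _ h5] := hP (n0 + e)%N; split=> //.
    apply: le_trans h2; apply: le_dual_norm => x; apply: apx_mono.
    by apply: leq_trans (hN1 e em) _; exact: leq_maxr.
  apply: contrapT => /nonemptyPn s0.
  have phi0 : phi e = 0.
    apply/funext => i; apply/eqP/negPn/negP => pi.
    by have : supp (phi e) i by []; rewrite s0.
  move: h5; rewrite -/(phi e) phi0 pairing0l ltNge divr_ge0//; exact: ltW.
have qm := q_mono q_inc.
have phio : ordered m phi.
  move=> i i' ii im c d /sphi/a_supp/andP[_ h] /sphi/a_supp/andP[h' _].
  apply: leq_trans h (leq_trans _ h').
  by apply: qm; rewrite -addnS leq_add2l.
have [U [h1 h2 h3 h4 h5]] := rational_functionals hj hX m0 phi_ok phio.
set u := _ *: _ in h4 h5.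
have ua e i : (e < m)%N -> u i * a (n0 + e) i = (f (m%:R : R))^-1 * (phi e i * a (n0 + e) i).
  move=> em; have [->|ai] := eqVneq (a (n0 + e) i) 0; first by rewrite !mulr0.
  rewrite /u scalrfctE sumfE (bigD1 (Ordinal em))//= big1 ?addr0 ?mulrA// => l le.
  apply/eqP/negPn/negP => /sphi/a_supp/andP[l1 l2].
  have /andP[e1 e2] := a_supp (ai : supp _ _).
  move/negP: le; apply; apply/eqP/val_inj => /=.
  case: (ltngtP l e) => // h; exfalso.
    have := leq_trans l2 (leq_trans (qm (n0 + l).+1 (n0 + e)%N _) e1).
    by rewrite -addnS leq_add2l ltnn => /(_ h).
  have := leq_trans e2 (leq_trans (qm (n0 + e).+1 (n0 + l)%N _) l1).
  by rewrite -addnS leq_add2l ltnn => /(_ h).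
exists N, U; split=> //; first exact: leq_maxl.
- move=> t; rewrite h4; split.
    have [_ _ [i pi]] := phi_ok 0%N m0; exists i.
    have ai := sphi _ _ pi.
    rewrite /supp /=; apply/negP => /eqP ui; have := ua 0%N i m0.
    rewrite ui mul0r => /esym/eqP; rewrite !mulf_eq0 invr_eq0 gt_eqF//=.
    by move: (pi : phi 0%N i != 0) (ai : a _ i != 0) => /negPf -> /negPf ->.
  move=> c; rewrite /supp /= /u scalrfctE sumfE scaler_eq0 negb_or => /andP[_ uc].
  have [l pl] : exists l : 'I_m, supp (phi l) c.
    apply: contrapT => /forallNP h; move/eqP: uc; apply; apply: big1 => l _.
    by apply/eqP/negPn/negP; exact: h.
  have al := sphi _ _ pl; split; first by move=> n; exact: ab_disj al.
  have /andP[l1 l2] := a_supp al; apply/andP; split.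
    by apply: leq_trans l1; apply: qm; exact: leq_addr.
  apply: leq_trans l2 _; apply: qm; rewrite -addnS leq_add2l; exact: ltn_ord.
- move=> t e em; have [_ _ _ ph5 ph6] := hP (n0 + e)%N.
  have [C aC] : exists C, forall i, (C <= i)%N -> a (n0 + e) i = 0 by apply/c00P.
  rewrite (@pairingE _ _ (a _) C) => [|i /aC ->]; last by rewrite mulr0.
  move: ph6; rewrite (@pairingE _ _ (a _) C) => [|i /aC ->]; last by rewrite mulr0.
  move=> ph6; apply: (@le_trans _ _ (\sum_(i < C) 2^-1 * (u i * a (n0 + e) i))).
    rewrite (eq_bigr (fun i : 'I_C => 2^-1 * (f (m%:R : R))^-1 * (phi e i * a (n0 + e) i))).
      rewrite -mulr_sumr; apply: (@le_trans _ _ (2^-1 * (f (m%:R : R))^-1 * (c0 / 2))).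
        rewrite le_eqVlt; apply/orP; left; apply/eqP; field; by rewrite gt_eqF.
      by rewrite ler_wpM2l ?(ltW ph6)// mulr_ge0 ?invr_ge0// ltW.
    by move=> i _; rewrite ua// mulrA.
  apply: ler_sum => i _; have [hU hs] := h5 t i.
  have ua0 : 0 <= u i * a (n0 + e) i.
    by rewrite ua//; apply: mulr_ge0; [rewrite invr_ge0 ltW|exact: ph5].
  have [ui|ui] := eqVneq (u i) 0.
    have Ui : U t i = 0.
      apply/eqP/negPn/negP => Ui; have : supp (U t) i by [].
      by rewrite h4 /supp /= ui eqxx.
    by rewrite ui Ui !mul0r mulr0.
  have Ua0 : 0 <= U t i * a (n0 + e) i.
    have u2 : 0 < u i ^+ 2 by rewrite exprn_even_gt0.
    have Uu := mulr_ge0 hs ua0.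
    rewrite -(pmulr_rge0 _ u2); apply: (le_trans Uu).
    by rewrite le_eqVlt; apply/orP; left; apply/eqP; ring.
  rewrite -(ger0_norm Ua0) -(ger0_norm ua0) [in leLHS]normrM [in leRHS]normrM mulrA.
  by rewrite ler_wpM2r.
Qed.

(** The index required of the functional number r of a special sequence of length k. *)
Definition code_index (z : nat -> nat -> R) k r : nat :=
  if r is r'.+1 then sigma (mkseq (fun l => vabs (z l)) r'.+1) else j (2 * k).

Lemma eq_code_index z z' k r : (forall l, (l < r)%N -> z l = z' l) -> code_index z k r = code_index z' k r.
Proof.
case: r => //= r h; congr sigma; apply/eq_in_map => l.
by rewrite mem_iota add0n => /= lr; rewrite h.
Qed.

Variable Gam : nat -> nat.

(** State of the construction of a special sequence after i steps. Block r consists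
    of the M vectors of numbers n0 r, ..., n0 r + M - 1, where M is the index of
    z r, and z r sees only their wrong parts. The last clause makes the next
    index exceed any bound prescribed in terms of the end of the block. *)
Definition coded_blocks k n1 (n0 : nat -> nat) (z : nat -> nat -> R) N i :=
  forall r, (r < i)%N -> [/\
    [/\ (n1 <= n0 r)%N, (code_index z k r <= n0 r)%N &
        (r.+1 < i)%N -> (n0 r + code_index z k r <= n0 r.+1)%N],
    Qset (z r) /\ Astar (apx N) (code_index z k r) (z r),
    supp (z r) !=set0 /\ forall c, supp (z r) c ->
        (forall n, b n c = 0) /\ (q (n0 r) <= c < q (n0 r + code_index z k r))%N,
    forall e, (e < code_index z k r)%N ->
      c0 / (4 * f ((code_index z k r)%:R : R)) <= pairing (z r) (a (n0 r + e)) &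
    (Gam (n0 r + code_index z k r) <= code_index z k r.+1)%N].

Lemma coded_ord k n1 n0 z N i r r' : coded_blocks k n1 n0 z N i ->
  (r < r')%N -> (r' < i)%N -> (n0 r + code_index z k r <= n0 r')%N.
Proof.
move=> g; elim: r' => // r' IH; rewrite ltnS leq_eqVlt => /orP[/eqP <-|rr] ri.
  by have [[_ _ h] _ _ _ _] := g r (ltnW ri); exact: h.
apply: leq_trans (IH rr (ltnW ri)) _.
have [[_ _ h] _ _ _ _] := g r' (ltnW ri).
by apply: leq_trans (h ri); exact: leq_addr.
Qed.

Lemma coded_successive k n1 n0 z N i : coded_blocks k n1 n0 z N i -> successive i z.
Proof.
move=> g r r' rr ri; have [_ _ [ne h] _ _] := g r (ltn_trans rr ri).
have [_ _ [ne' h'] _ _] := g r' ri; split=> // c d /h[_ /andP[_ hc]] /h'[_ /andP[hd _]].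
apply: leq_trans hc (leq_trans _ hd); apply: (q_mono q_inc).
exact: coded_ord g rr ri.
Qed.

Lemma coded_Qseqs k n1 n0 z N i : (0 < i)%N -> coded_blocks k n1 n0 z N i ->
  Qseqs (mkseq (fun l => vabs (z l)) i).
Proof.
move=> i0 g; apply: Qseqs_mkseq => //; last exact: coded_successive g.
by move=> r ri; have [_ [] ] := g r ri.
Qed.

Lemma coded_L k n1 n0 z N i : (0 < k)%N -> coded_blocks k n1 n0 z N i -> Lset j (code_index z k i).
Proof.
case: i => [|i] k0 g; first by exists (2 * k)%N; rewrite //= muln_gt0 k0 mul2n odd_double.
by case: hsigma => h _ _; apply: h; exact: coded_Qseqs g.
Qed.

(** The sequences obtained from the candidates U t for the last functional have
    distinct codes, so one of the codes exceeds the prescribed bound. *)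
Theorem special_sequence k n1 : (0 < k)%N -> exists n0 z N, coded_blocks k n1 n0 z N k.
Proof.
move=> k0; suff : forall i, exists n0 z N, coded_blocks k n1 n0 z N i by [].
elim=> [|i [n0 [z [N g]]]].
  by exists (fun=> 0%N), (fun=> 0), 0%N.
set m := code_index z k i.
have mL : Lset j m by exact: coded_L g.
have m0 : (0 < m)%N by apply: (Jset_gt0 hj); exact: LJ.
pose st := maxn n1 (maxn m (if i is i'.+1 then n0 i' + code_index z k i' else 0))%N.
have stge r : (r < i)%N -> (n0 r + code_index z k r <= st)%N.
  rewrite /st {st}; clearbody m; clear mL m0; case: i g => // i g.
  rewrite ltnS leq_eqVlt => /orP[/eqP ->|ri]; first by rewrite !leq_max leqnn !orbT.
  rewrite !leq_max; apply/orP; right; apply/orP; right.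
  apply: leq_trans (coded_ord g ri (ltnSn _)) _; exact: leq_addr.
have [N' [U [NN hU Uinj hs hp]]] := block_functionals st N m0.
pose zt t r := if r == i then U t else z r.
have ztlt t r : (r < i)%N -> zt t r = z r by move=> ri; rewrite /zt ltn_eqF.
have zti t : zt t i = U t by rewrite /zt eqxx.
pose n0' r := if r == i then st else n0 r.
have n0lt r : (r < i)%N -> n0' r = n0 r by move=> ri; rewrite /n0' ltn_eqF.
have n0i : n0' i = st by rewrite /n0' eqxx.
have Mlt t r : (r <= i)%N -> code_index (zt t) k r = code_index z k r.
  by move=> ri; apply: eq_code_index => l lr; apply: ztlt; exact: leq_trans lr ri.
have zQ t : Qseqs (mkseq (fun l => vabs (zt t l)) i.+1).
  apply: Qseqs_mkseq => //.
    move=> r; rewrite ltnS leq_eqVlt => /orP[/eqP ->|ri]; first by rewrite zti; have [] := hU t.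
    by rewrite ztlt//; have [_ []] := g r ri.
  move=> r r' rr; rewrite ltnS leq_eqVlt => /orP[/eqP e|ri]; last first.
    by rewrite !ztlt//; [exact: (coded_successive g)|exact: ltn_trans ri].
  rewrite e in rr *; rewrite zti ztlt//.
  have [_ _ [ne h] _ _] := g r rr; have [ne' h'] := hs t; split=> // c d.
  move=> /h[_ /andP[_ hc]] /h'[_ /andP[hd _]].
  apply: leq_trans hc (leq_trans _ hd); apply: (q_mono q_inc).
  exact: stge.
have [t ht] : exists t, (Gam (st + m) <= sigma (mkseq (fun l => vabs (zt t l)) i.+1))%N.
  apply: inj_unbounded => t t'.
  case: hsigma => _ sinj _ /(sinj _ _ (zQ t) (zQ t')).
  move=> /(congr1 (fun s => nth 0 s i)); rewrite !nth_mkseq// !zti.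
  exact: Uinj.
exists n0', (zt t), N' => r; rewrite ltnS leq_eqVlt => /orP[/eqP ->|ri].
  rewrite n0i zti (Mlt t i (leqnn _)) -/m; split.
  - split; [exact: leq_maxl|by rewrite /st !leq_max leqnn orbT|by rewrite ltnn].
  - exact: hU.
  - exact: hs.
  - by move=> e em; exact: hp.
  - exact: ht.
have [[g1 g2 g3] [g4 g5] g6 g7 g8] := g r ri.
rewrite n0lt// ztlt// (Mlt t r (ltnW ri)) (Mlt t r.+1 ri); split=> //.
  split=> // _; move: (ri); rewrite leq_eqVlt => /orP[/eqP e|ri'].
    rewrite e n0i /st -e; by rewrite !leq_max leqnn !orbT.
  by rewrite n0lt//; exact: g3.
split=> //; apply: le_Astar g5 => x; exact: apx_mono.
Qed.

End SpecialSequence.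

Section Gap20.
Variables (R : realType) (j : nat -> nat).
Hypothesis hj : admissible R j.

Lemma J_gap20 m n : Jset j m -> Jset j n -> (m < n)%N -> (m ^ 20 <= n)%N.
Proof.
move=> mJ nJ mn; rewrite -(ler_nat R); apply: le_trans (J_gap hj mJ nJ mn).
have m1 := J_ge100 hj mJ; rewrite natrX; set x : R := m%:R in m1 *.
apply: (le_trans _ (expR_ge_self _)); apply: (le_trans _ (expR_ge_self _)).
have -> : 4 * x ^+ 2 = (x ^+ 2 / 5) * 20%:R by field.
rewrite expRM_natr; apply: lerXn2r; rewrite ?nnegrE ?expR_ge0//.
apply: (le_trans _ (expR_ge_self _)); rewrite expr2 ler_pdivlMr; last by lra.
by rewrite ler_wpM2l//; lra.
Qed.

Lemma f_over_self (S0 s k : R) : 1 <= s -> (2 * f (1 + s)) ^+ 10 <= s ->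
  1 <= k -> k ^+ 4 <= s -> f s * k ^+ 2 <= s.
Proof.
move=> s1 h k1 ks.
have ff : f s <= f (1 + s) by apply: ler_f; lra.
have f0 : 0 <= f s by apply: f_ge0; lra.
have f1 : 1 <= f (1 + s) by apply: f_ge1; lra.
have f2 : f s ^+ 2 <= s.
  apply: le_trans h; apply: (@le_trans _ _ ((2 * f (1 + s)) ^+ 2)).
    by apply: lerXn2r; rewrite ?nnegrE//; lra.
  by apply: ler_weXn2l => //; lra.
have := sqr_ge0 (f s - k ^+ 2); rewrite sqrrB -[_ ^+ 2 ^+ 2]exprM; lra.
Qed.

End Gap20.

(** * Special functionals of the critical length *)
Section SpecialMatch.
Variables (R : realType) (j : nat -> nat) (sigma : seq (nat -> R) -> nat).
Variables (X : completeNormedModType R) (iota : (nat -> R) -> X).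
Hypothesis hj : admissible R j.
Hypothesis hsigma : coding_function j sigma.
Hypothesis hX : is_completion (gowers_norm j sigma) iota.
Notation apx := (gowers_norm_approx j sigma).
Notation nm := (nm iota).
Notation code_index := (code_index j sigma).

Variables (k : nat) (z x : nat -> nat -> R).
Hypothesis kK : Kset j k.
Hypothesis z_Q : forall r, (r < k)%N -> Qset (z r).
Hypothesis z_succ : successive k z.
Hypothesis M_inc : forall r r', (r < r')%N -> (r' < k)%N -> (code_index z k r < code_index z k r')%N.
Hypothesis x_c00 : forall i, (i < k)%N -> c00 (x i).
Hypothesis x_half : forall i E, (i < k)%N -> nm (proj E (x i)) <= 1.
Hypothesis x_far : forall i N m w E, (i < k)%N -> Lset j m -> (k < m)%N ->
  m <> code_index z k i -> Astar (apx N) m w ->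
  `|pairing w (proj E (x i))| <= (k%:R ^+ 2)^-1.
Hypothesis z_x : forall r i c, (r < k)%N -> (i < k)%N -> supp (z r) c -> x i c = 0.

Let k0 : (0 < k)%N. Proof. exact: Jset_gt0 hj _ (KJ kK). Qed.

(** Let d be the first index at which the moduli of the given special sequence z'
    and of z differ. Before d the functionals live on the supports of z, where
    the blocks vanish. At d the indices agree, and the block of that index is
    paired to at most 1. In every other pair the indices differ, because sigma is
    injective, and the pairing is at most 1 / k^2. *)
Lemma special_match N u (I : {set 'I_k}) E : special_functional j sigma (apx N) k u ->
  `|pairing u (proj E (\sum_(i in I) x i))| <= 4.
Proof.
move=> [z' [[zQ zs zA0 zA] ->]].
have cE (i : 'I_k) : c00 (proj E (x i)) by apply/c00_proj/x_c00.
have zM s : (s < k)%N -> Astar (apx N) (code_index z' k s) (z' s) by case: s => //= s; exact: zA.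
have big s : (s.+1 < k)%N -> (j (2 * k) < code_index z' k s.+1)%N.
  by move=> sk; apply: (sigma_big hj hsigma sk zQ zs zA0).
have MQ s : (s < k)%N -> Qseqs (mkseq (fun l => vabs (z' l)) s.+1).
  move=> sk; apply: Qseqs_mkseq => //.
    by move=> r rs; apply: zQ; exact: leq_trans rs sk.
  by move=> r r' rr rs; apply: zs => //; exact: leq_trans rs sk.
have MQz s : (s < k)%N -> Qseqs (mkseq (fun l => vabs (z l)) s.+1).
  move=> sk; apply: Qseqs_mkseq => //.
    by move=> r rs; apply: z_Q; exact: leq_trans rs sk.
  by move=> r r' rr rs; apply: z_succ => //; exact: leq_trans rs sk.
have j2L : Lset j (j (2 * k)) by exists (2 * k)%N; rewrite //= muln_gt0 k0 mul2n odd_double.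
have ML s : (s < k)%N -> Lset j (code_index z' k s).
  by case: s => // s sk; case: hsigma => h _ _; apply: h; apply: MQ; exact: ltnW.
have Mk s : (s < k)%N -> (k < code_index z' k s)%N.
  case: s => [_|s sk]; first exact: (K_lt_j2 hj kK).
  exact: ltn_trans (K_lt_j2 hj kK) (big s sk).
have exd : exists d, (d == k) || `[< vabs (z' d) <> vabs (z d) >] by exists k; rewrite eqxx.
have [d hd dmin] := ex_minnP exd.
have same s : (s < d)%N -> vabs (z' s) = vabs (z s).
  move=> sd; apply: contrapT => ne; have := dmin s.
  by rewrite (asboolT ne) orbT leqNgt sd => /(_ isT).
have match_ s i : (s < k)%N -> (i < k)%N -> code_index z' k s = code_index z k i -> s = i /\ (s <= d)%N.
  case: s i => [|s] [|i] // sk ik e.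
  - by have := @M_inc 0%N i.+1 isT ik; rewrite -e ltnn.
  - by have := big s sk; rewrite e ltnn.
  case: hsigma => _ sinj _; have {}e := sinj _ _ (MQ _ (ltnW sk)) (MQz _ (ltnW ik)) e.
  have si : s = i by have := congr1 size e; rewrite !size_mkseq => -[].
  split; first by rewrite si.
  rewrite leqNgt; apply/negP => ds; case/orP: hd => [/eqP dk|/asboolP].
    by move: ds; rewrite dk ltnNge ltnW.
  apply; move/(congr1 (fun s => nth 0 s d)): e.
  by rewrite !nth_mkseq// -si.
pose D (s : nat) : R := (s == d)%:R.
have entry s (i : 'I_k) : (s < k)%N ->
    `|pairing (z' s) (proj E (x i))| <= D s * D i + (k%:R ^+ 2)^-1.
  move=> sk; have DD : 0 <= D s * D i by rewrite mulr_ge0.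
  have kk : 0 <= (k%:R ^+ 2)^-1 :> R by rewrite invr_ge0 exprn_ge0.
  have [e|/eqP ne] := eqVneq (code_index z' k s) (code_index z k i); last first.
    by apply: le_trans (x_far E (ltn_ord i) (ML s sk) (Mk s sk) ne (zM s sk)) _; rewrite lerDr.
  have [si] := match_ s i sk (ltn_ord i) e.
  rewrite leq_eqVlt => /orP[/eqP sd|sd].
    have -> : D s * D i = 1 by rewrite /D -si sd eqxx mulr1.
    apply: (@le_trans _ _ 1); last by rewrite lerDl.
    apply: le_trans (Astar_nm hX (leq_trans (ltn0Sn _) (Mk s sk)) (zM s sk) (cE i)) _.
    by rewrite x_half.
  rewrite (@pairingE _ _ _ 0%N) ?big_ord0 ?normr0 ?addr_ge0// => c _.
  have [->|zc] := eqVneq (z' s c) 0; first by rewrite mul0r.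
  rewrite /proj; case: ifP => _; last by rewrite mulr0.
  rewrite (z_x sk (ltn_ord i)) ?mulr0//.
  by rewrite -supp_vabs -same// supp_vabs.
have f16 := sqrtf_ge16 hj kK; set F := Num.sqrt _ in f16 *.
have cT : c00 (proj E (\sum_(i in I) x i)) by apply/c00_proj/c00_sum => i _; exact: x_c00.
rewrite pairingZl// normrM ger0_norm ?invr_ge0//; last by lra.
rewrite ler_pdivrMl; last by lra.
rewrite pairing_suml//; apply: (@le_trans _ _ 2); last by lra.
have Dsum : \sum_(s < k) D s <= 1.
  apply: sum_atmost1 => // [l _|l l' ll _]; rewrite /D; first by case: eqP.
  case: eqP => [e|_]; last by left.
  by right; case: eqP => // e'; move: ll; rewrite e e' ltnn.
have D0 s : 0 <= D s by rewrite /D.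
apply: (le_trans (ler_norm_sum _ _ _)).
apply: (@le_trans _ _ (\sum_(s < k) \sum_(i < k) (D s * D i + (k%:R ^+ 2)^-1))).
  apply: ler_sum => s _.
  rewrite proj_sum pairing_sumr//; apply: (le_trans (ler_norm_sum _ _ _)).
  rewrite [leRHS](bigID (mem I)) /= -[leLHS]addr0; apply: lerD.
    by apply: ler_sum => i _; exact: entry.
  apply: sumr_ge0 => i _; rewrite addr_ge0 ?mulr_ge0// invr_ge0 exprn_ge0//.
rewrite (eq_bigr (fun s : 'I_k => D s * (\sum_(i < k) D i) + k%:R^-1)); last first.
  move=> s _; rewrite big_split /= mulr_sumr sumr_const card_ord; congr (_ + _).
  rewrite -[LHS]mulr_natr expr2 invfM -mulrA mulVf ?mulr1// pnatr_eq0 -lt0n.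
  exact: k0.
rewrite big_split /= -mulr_suml sumr_const card_ord -[X in _ + X]mulr_natr.
rewrite mulVf ?pnatr_eq0 -?lt0n//.
have : (\sum_(i < k) D i) * (\sum_(i < k) D i) <= 1 * 1.
  by apply: ler_pM => //; apply: sumr_ge0.
lra.
Qed.

End SpecialMatch.

(** * Combinations whose right part is negligible *)
Section KeyNumeric.
Variable R : realType.

(** The coefficients do not depend on the vectors, which makes the reindexing
    available for the wrong and the right parts at once. *)
Lemma coef_reindex (k n1 : nat) (M n0 : nat -> nat) (d : nat -> R) :
  (forall r, (r < k)%N -> (n1 <= n0 r)%N) ->
  exists (c : nat -> R) (N : nat), (forall n, (n < n1)%N -> c n = 0) /\
    forall (V : lmodType R) (g : nat -> V),
      \sum_(n < N) c n *: g n = \sum_(r < k) d r *: \sum_(i < M r) g (n0 r + i)%N.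
Proof.
move=> nn; pose c n : R := \sum_(r < k) \sum_(i < M r) d r * (n == n0 r + i)%:R.
have [N hN] := max_level (fun r => n0 r + M r)%N k.
exists c, N; split=> [n n_n1|V g].
  rewrite /c; apply: big1 => r _; apply: big1 => i _.
  rewrite (_ : (n == _) = false) ?mulr0//; apply/negbTE.
  by rewrite neq_ltn (leq_trans n_n1)// (leq_trans (nn r (ltn_ord r)))// leq_addr.
under eq_bigr do rewrite scaler_suml; rewrite exchange_big /=.
apply: eq_bigr => r _; under eq_bigr do rewrite scaler_suml.
rewrite exchange_big /= scaler_sumr; apply: eq_bigr => i _.
have h : (n0 r + i < N)%N by apply: leq_trans (hN r (ltn_ord r)); rewrite ltn_add2l.
rewrite (bigD1 (Ordinal h))//= eqxx mulr1 big1 ?addr0// => n ne.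
by rewrite (_ : (_ == _) = false) ?mulr0 ?scale0r//; apply/negbTE.
Qed.

Lemma far_below_bound (P F' k : R) : 1 <= k -> P <= 2 / 3 -> (4 * k) ^+ 4 <= F' ->
  F'^-1 * P <= (k ^+ 2)^-1.
Proof.
move=> k1 P1 F1; have k2 : 1 <= k ^+ 2 by rewrite exprn_ege1.
have F2 : k ^+ 2 <= F'.
  apply: le_trans F1; apply: (@le_trans _ _ ((4 * k) ^+ 2)).
    by apply: lerXn2r; rewrite ?nnegrE; lra.
  by apply: ler_weXn2l => //; lra.
rewrite ler_pdivrMl; last by lra.
apply: (le_trans P1); rewrite ler_pdivlMr; last by lra.
lra.
Qed.

Lemma far_above_bound (A F M F' k P : R) : 100 <= A -> 1 <= k -> k <= M ->
  0 <= F -> F * k ^+ 2 <= M -> (4 * M) ^+ 4 <= F' ->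
  P <= F / (4 * A * M) * (2 * F' + 2 * M) -> F'^-1 * P <= (k ^+ 2)^-1.
Proof.
move=> A1 k1 kM F0 Fk F1 hP; have k2 : 1 <= k ^+ 2 by rewrite exprn_ege1.
have M2 : M ^+ 2 <= F'.
  apply: le_trans F1; apply: (@le_trans _ _ ((4 * M) ^+ 2)).
    by apply: lerXn2r; rewrite ?nnegrE; lra.
  by apply: ler_weXn2l => //; lra.
have MM : M <= M ^+ 2 by rewrite expr2 ler_peMr; lra.
have FF : F * k ^+ 2 <= F' by lra.
have F'0 : 0 < F' by lra.
have AM : 0 < 4 * A * M by rewrite mulr_gt0//; lra.
rewrite ler_pdivrMl//; apply: (le_trans hP).
rewrite ler_pdivlMr; last by lra.
rewrite (_ : F / _ * _ * _ = F * k ^+ 2 * (2 * F' + 2 * M) / (4 * A * M)); last first.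
  by rewrite mulrAC [F / _ * _]mulrAC mulrAC.
rewrite ler_pdivrMr//.
have : F * k ^+ 2 * (2 * F' + 2 * M) <= M * (4 * F').
  rewrite (_ : F * _ * _ = F * k ^+ 2 * (2 * F') + M * (2 * (F * k ^+ 2))); last by ring.
  have h1 : F * k ^+ 2 * (2 * F') <= M * (2 * F') by rewrite ler_wpM2r//; lra.
  have h2 : M * (2 * (F * k ^+ 2)) <= M * (2 * F') by rewrite ler_wpM2l//; lra.
  lra.
have : 0 <= (A - 1) * (M * F') by rewrite mulr_ge0 ?mulr_ge0//; lra.
lra.
Qed.

Lemma ratio_bound (A c0 eps k sf : R) : 0 < A -> 0 < c0 -> 0 < eps -> 0 < sf -> 0 <= k ->
  32 * A ^+ 2 / (c0 * eps) <= sf ->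
  4 * A * (2 * A * k / (sf * sf)) <= eps * (k * c0 / (4 * sf)).
Proof.
move=> A0 c00' e0 s0 k0; rewrite ler_pdivrMr ?mulr_gt0// => h.
rewrite [leRHS](_ : _ = eps * k * c0 * sf / (4 * (sf * sf))); last by field; rewrite gt_eqF.
rewrite [leLHS](_ : _ = k * (32 * A ^+ 2) / (4 * (sf * sf))); last by field; rewrite gt_eqF.
rewrite ler_wpM2r ?invr_ge0//; first by rewrite !mulr_ge0// ltW.
by rewrite (_ : eps * _ * _ * _ = k * (sf * (c0 * eps))) ?ler_wpM2l//; ring.
Qed.

End KeyNumeric.

Section ExistsK.
Variables (R : realType) (j : nat -> nat).
Hypothesis hj : admissible R j.

Lemma exists_K (n : nat) : exists2 k, Kset j k & (n <= k)%N.
Proof.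
exists (j n.*2.+1); first by exists n.*2.+1; rewrite //= odd_double.
apply: leq_trans (_ : n.*2.+1 <= _)%N; last exact: (j_ge hj).
by rewrite -addnn; apply: leqW; exact: leq_addr.
Qed.

End ExistsK.

Section Key.
Variables (R : realType) (j : nat -> nat) (sigma : seq (nat -> R) -> nat).
Variables (X : completeNormedModType R) (iota : (nat -> R) -> X).
Hypothesis hj : admissible R j.
Hypothesis hsigma : coding_function j sigma.
Hypothesis hX : is_completion (gowers_norm j sigma) iota.
Notation apx := (gowers_norm_approx j sigma).
Notation na := (na j sigma).
Notation nm := (nm iota).
Notation psum := (psum iota).

Variable S0 : R.
Hypothesis S0_ge : 1000 <= S0.
Hypothesis S0P : forall s, S0 <= s -> (2 * f (1 + s)) ^+ 10 <= s.
Let A : R := 100 + f (1 + S0).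

Variables (a b : nat -> nat -> R) (q : nat -> nat) (c0 : R).
Hypothesis q_inc : forall n, (q n < q n.+1)%N.
Hypothesis a_c00 : forall n, c00 (a n).
Hypothesis a_supp : forall n i, supp (a n) i -> (q n <= i < q n.+1)%N.
Hypothesis ab_disj : forall n n' i, supp (a n) i -> b n' i = 0.
Hypothesis c0_gt0 : 0 < c0.
Hypothesis a_ge : forall n, c0 <= nm (a n).
Hypothesis b_c00 : forall n, c00 (b n).
Hypothesis b_supp : forall n i, supp (b n) i -> (q n <= i < q n.+1)%N.
Hypothesis b_le1 : forall n, nm (b n) <= 1.
Hypothesis b_split : forall n l E, (l <= 2 ^ ((n * q n) ^ 2))%N ->
  successive_sets l E -> psum l E (b n) <= 2.

Section FixedK.
Variables (k n1 : nat) (n0 : nat -> nat) (z : nat -> nat -> R) (N : nat).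
Hypothesis kK : Kset j k.
Hypothesis kS : S0 ^+ 2 <= k%:R.
Let Gam (n : nat) : nat := 2 ^ (20 * (k * q n) ^ 2).
Hypothesis zcoded : coded_blocks j sigma a b q c0 Gam k n1 n0 z N k.
Let M r := code_index j sigma z k r.

Let k0 : (0 < k)%N. Proof. exact: Jset_gt0 hj _ (KJ kK). Qed.

Lemma coded_prefix r : (r <= k)%N -> coded_blocks j sigma a b q c0 Gam k n1 n0 z N r.
Proof.
move=> rk r' rr; have [[h1 h2 h3] h4 h5 h6 h7] := zcoded (leq_trans rr rk).
by split=> //; split=> // h; apply: h3; exact: leq_trans h rk.
Qed.

Lemma M_L r : (r < k)%N -> Lset j (M r).
Proof. by move=> rk; apply: (coded_L hsigma q_inc k0 (coded_prefix (ltnW rk))). Qed.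

(** The bound Gam is chosen so that M r' to the power 1/20 dominates
    2^((k q)^2), where q bounds the supports of the earlier blocks: this is the
    first alternative of [split_dichotomy]. *)
Lemma M_gap r r' : (r < r')%N -> (r' < k)%N -> (Gam (n0 r + M r) <= M r')%N /\ (M r < M r')%N.
Proof.
have gl n : (n < Gam n)%N.
  apply: leq_ltn_trans (_ : n <= 20 * (k * q n) ^ 2)%N _; last exact: ltn_expl.
  apply: leq_trans (q_ge q_inc n) _; apply: leq_trans (_ : k * q n <= _)%N.
    by rewrite -[leqLHS]mul1n leq_mul2r k0 orbT.
  apply: (@leq_trans ((k * q n) ^ 2)%N); last by rewrite -[leqLHS]mul1n leq_mul2r orbT.
  by rewrite expnS expn1; case: (k * q n)%N => // m; rewrite -[leqLHS]mul1n leq_mul2r orbT.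
have st r1 : (r1.+1 < k)%N -> (Gam (n0 r1 + M r1) <= M r1.+1)%N /\ (M r1 < M r1.+1)%N.
  move=> rk; have [_ _ _ _ h] := zcoded (ltnW rk); split=> //.
  by apply: leq_trans h; apply: leq_trans (gl _); rewrite ltnS leq_addl.
elim: r' => // r' IH; rewrite ltnS leq_eqVlt => /orP[/eqP <-|rr] rk; first exact: st.
have [h1 h2] := IH rr (ltnW rk); have [_ h3] := st r' rk.
by split; [exact: leq_trans h1 (ltnW h3)|exact: ltn_trans h2 h3].
Qed.

Lemma k_lt_M r : (r < k)%N -> (k < M r)%N.
Proof.
move=> rk; have h0 := K_lt_j2 hj kK; case: r rk => [|r] rk //.
by apply: ltn_trans h0 _; have [_] := M_gap (ltn0Sn r) rk.
Qed.

Let fM r : R := f ((M r)%:R : R).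
Let v r := \sum_(i < M r) b (n0 r + i).
Let C r : R := fM r / (4 * A * (M r)%:R).
(** Normalized so that [block_sum] gives norm at most 1/2. *)
Let x r := C r *: v r.

Let A_ge : 100 <= A.
Proof. by rewrite /A lerDl f_ge0//; have := S0_ge; lra. Qed.

Let M0 r : (r < k)%N -> (0 : R) < (M r)%:R.
Proof. by move=> rk; rewrite ltr0n (leq_trans _ (k_lt_M rk)). Qed.

Let fM0 r : (r < k)%N -> 0 < fM r.
Proof. by move=> rk; apply: fn_gt0; rewrite -(ltr0n R) M0. Qed.

Let C0 r : (r < k)%N -> 0 <= C r.
Proof.
move=> rk; have h1 := fM0 rk; have h2 := M0 rk; have h3 := A_ge.
apply: divr_ge0; first exact: ltW.
by apply: mulr_ge0; [apply: mulr_ge0; lra|exact: ltW].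
Qed.

Let v_c00 r : c00 (v r).
Proof. by apply: c00_sum => i _; exact: b_c00. Qed.

Let x_c00 r : c00 (x r).
Proof. exact: c00Z. Qed.

Let v_sum r : (r < k)%N -> _ := fun rk => block_sum hj hsigma hX S0_ge S0P q_inc b_c00 b_supp
  b_le1 b_split (M_L rk) (let: And5 (And3 _ h _) _ _ _ _ := zcoded rk in h)
  (le_trans kS (ltac:(by rewrite ler_nat ltnW// k_lt_M) : k%:R <= (M r)%:R)).

Let nm_x E r : (r < k)%N -> nm (proj E (x r)) <= 1 / 2.
Proof.
move=> rk; have [h _ _] := v_sum rk; have h3 := A_ge.
rewrite projZ (nmZ hX); last exact: c00_proj.
rewrite ger0_norm ?C0//; apply: le_trans (ler_wpM2l (C0 rk) (h E)) _.
rewrite -/A -/(M r) -/(fM r) /C le_eqVlt; apply/orP; left; apply/eqP.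
by field; rewrite !gt_eqF ?M0 ?fM0//; lra.
Qed.

Let psumZ l E F r : (r < k)%N -> psum l E (proj F (x r)) = C r * psum l E (proj F (v r)).
Proof.
move=> rk; rewrite /psum mulr_sumr; apply: eq_bigr => e _.
by rewrite !projZ (nmZ hX) ?ger0_norm ?C0//; apply/c00_proj/c00_proj.
Qed.

Let psum_small l E F r : (r < k)%N -> (0 < l)%N -> (l ^ 20 <= M r)%N ->
  successive_sets l E -> psum l E (proj F (x r)) <= 2 / 3.
Proof.
move=> rk l0 lM sE; have [_ h _] := v_sum rk; have h3 := A_ge.
rewrite psumZ//; apply: le_trans (ler_wpM2l (C0 rk) (h l E F l0 lM sE)) _.
rewrite -/A -/(M r) -/(fM r) /C le_eqVlt; apply/orP; left; apply/eqP.
by field; rewrite !gt_eqF ?M0 ?fM0//; lra.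
Qed.

Let psum_any l E F r : (r < k)%N -> (0 < l)%N -> successive_sets l E ->
  psum l E (proj F (x r)) <= C r * (2 * f (l%:R : R) + 2 * (M r)%:R).
Proof.
move=> rk l0 sE; have [_ _ h] := v_sum rk.
by rewrite psumZ// ler_wpM2l ?C0//; exact: h.
Qed.

Let v_supp r i : supp (v r) i -> (q (n0 r) <= i < q (n0 r + M r))%N.
Proof.
rewrite /supp /v /= sumfE => h.
have [e eb] : exists e : 'I_(M r), supp (b (n0 r + e)) i.
  apply: contrapT => /forallNP h'; move/eqP: h; apply; apply: big1 => e _.
  by apply/eqP/negPn/negP; exact: h'.
have /andP[e1 e2] := b_supp eb; apply/andP; split.
  by apply: leq_trans e1; apply: (q_mono q_inc); exact: leq_addr.
by apply: leq_trans e2 _; apply: (q_mono q_inc); rewrite -addnS leq_add2l.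
Qed.

Let x_supp r i : supp (x r) i -> (q (n0 r) <= i < q (n0 r + M r))%N.
Proof.
by rewrite /supp /x /= scalrfctE scaler_eq0 negb_or => /andP[_] /v_supp.
Qed.

Let x_ordered : ordered k x.
Proof.
move=> r r' rr rk c d /x_supp/andP[_ h] /x_supp/andP[h' _].
apply: leq_trans h (leq_trans _ h'); apply: (q_mono q_inc).
exact: coded_ord zcoded rr rk.
Qed.

Let x_split l : (0 < l)%N -> exists i0 : 'I_k, forall i : 'I_k,
  i != i0 -> forall E, successive_sets l E ->
  psum l E (x i) <= 2 + Num.sqrt (f (l%:R : R)) / k%:R.
Proof.
move: l; apply: split_dichotomy => // i i' l ii ik l0.
have [h|h] := leqP (l ^ 20) (M i').
  right=> E sE; rewrite -[x i']projT; apply: (le_trans (psum_small setT ik l0 h sE)).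
  lra.
left => E sE; have ik0 := ltn_trans ii ik.
have [g1 _] := M_gap ii ik; set qq := q (n0 i + M i) in g1.
have kR : (0 : R) < k%:R by rewrite ltr0n.
have hl : (2 ^ ((k * qq) ^ 2) <= l)%N.
  rewrite -(@leq_exp2r _ _ 20)// -expnM mulnC; apply: ltnW; exact: leq_ltn_trans h.
rewrite ler_pdivlMr//; apply: (@le_trans _ _ (k * qq)%:R).
  rewrite mulnC natrM ler_wpM2r//.
  apply: (psum_count hX (x_c00 _) _ _ sE).
    by rewrite -[x i]projT; apply: (le_trans (nm_x _ ik0)); lra.
  by move=> c /x_supp/andP[].
rewrite -[leLHS]ger0_norm// -sqrtr_sqr ler_wsqrtr// -natrX.
exact: f_ge_pow.
Qed.

(** If m < M i, then m pieces of the block have bounded total norm, and f m is huge.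
    If m > M i, they have total norm at most C i (2 f m + 2 M i), where
    C i is of order f (M i) / M i. *)
Let x_far i N' m w E : (i < k)%N -> Lset j m -> (k < m)%N -> m <> M i ->
  Astar (apx N') m w -> `|pairing w (proj E (x i))| <= (k%:R ^+ 2)^-1.
Proof.
move=> ik mL km mM wA; have m0 : (0 < m)%N by exact: leq_trans km.
have cx : c00 (proj E (x i)) by exact: c00_proj.
have [F sF hF] := Astar_le hX m0 wA cx.
apply: (le_trans (hF _ cx)).
apply: (@le_trans _ _ ((f (m%:R : R))^-1 * psum m F (proj E (x i)))).
  rewrite ler_wpM2l ?invr_ge0 ?(ltW (fn_gt0 R m0))//; apply: ler_sum => e _.
  by apply: (na_le_nm hX); apply: c00_proj.
have kR : 1 <= k%:R :> R by rewrite ler1n.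
have kJ := KJ kK; have mJ := LJ mL; have MJ := LJ (M_L ik).
have A1 := A_ge; have S1 := S0_ge.
case: (ltngtP m (M i)) => // mMi.
  apply: far_below_bound => //; last exact: (J_f_gap hj kJ mJ km).
  by apply: psum_small => //; exact: (J_gap20 hj mJ MJ mMi).
have Mk := k_lt_M ik.
have kM : k%:R + 1 <= (M i)%:R :> R by rewrite natr1 ler_nat.
have k10 := J_gap10 hj kJ MJ Mk.
have SM : S0 <= (M i)%:R.
  apply: (@le_trans _ _ (S0 ^+ 2)); last by have := kS; lra.
  by rewrite expr2 ler_peMr//; lra.
apply: (far_above_bound A1 kR (_ : k%:R <= (M i)%:R) (ltW (fM0 ik))).
- lra.
- apply: (@f_over_self _ (M i)%:R) => //; [by lra|exact: S0P|].
  apply: (@le_trans _ _ (k%:R ^+ 10)); last by lra.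
  exact: ler_weXn2l.
- exact: (J_f_gap hj MJ mJ mMi).
- exact: psum_any.
Qed.

Lemma z_b r n c : (r < k)%N -> supp (z r) c -> b n c = 0.
Proof. by move=> rk zc; have [_ _ [_ h] _ _] := zcoded rk; have [-> ] := h c zc. Qed.

Let z_x r i c : (r < k)%N -> (i < k)%N -> supp (z r) c -> x i c = 0.
Proof.
move=> rk _ zc; rewrite /x /v scalrfctE sumfE big1 ?scaler0// => e _.
exact: z_b zc.
Qed.

Let x_upper : nm (\sum_(r < k) x r) <= 2 * A * k%:R / f (k%:R : R).
Proof.
have kJ := KJ kK; have [p [p0 pP p2]] := J_pred hj kJ.
have pR : 1 <= p%:R :> R by rewrite ler1n.
have kR : 1 <= k%:R :> R by rewrite ler1n.
have z_Q r : (r < k)%N -> Qset (z r) by move=> rk; have [_ []] := zcoded rk.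
have z_s : successive k z by exact: coded_successive zcoded.
have Kc k' : Kset j k' -> [\/ k'%:R <= p%:R :> R,
     f (1 + k%:R) <= Num.sqrt (f (k'%:R : R)) |
     forall N u (I : {set 'I_k}) E, special_functional j sigma (apx N) k' u ->
       `|pairing u (proj E (blocks x I))| <= 4].
  move=> kK'; case: (ltngtP k' k) => h.
  - by apply: Or31; rewrite ler_nat; apply: pP => //; exact: (KJ kK').
  - by apply: Or32; exact: (J_sqrtf_gap hj kJ (KJ kK') h).
  - apply: Or33 => N' u I E; rewrite h; apply: (special_match hj hsigma hX kK z_Q z_s) => //.
    + by move=> r r' rr rk; have [_ ] := M_gap rr rk.
    + by move=> i F ik; apply: (le_trans (nm_x F ik)); lra.
have x1 i : (i < k)%N -> nm (x i) <= 1.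
  by move=> ik; rewrite -[x i]projT; apply: (le_trans (nm_x _ ik)); lra.
have := upper_estimate hj hsigma hX S0_ge S0P pR k0 (fun i _ => x_c00 i) x_ordered x1
  x_split Kc setT [set: 'I_k]%SET.
rewrite projT cardsT card_ord /blocks -/A.
rewrite (eq_bigl (fun=> true)) => [h|i]; last by rewrite finset.in_setT.
apply: (le_trans h).
have f1 : 1 <= f (k%:R : R) by exact: fn_ge1.
have fm : f (k%:R : R) <= 2 * f (1 + k%:R / (2 * p%:R)).
  by apply: f_half => //; [lra|rewrite -natrM -natrX ler_nat].
rewrite ler_pdivrMr; last by lra.
rewrite [leRHS]mulrAC ler_pdivlMr; last by lra.
have -> : 2 * A * k%:R * f (1 + k%:R / (2 * p%:R)) = (A * k%:R) * (2 * f (1 + k%:R / (2 * p%:R))) by ring.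
by rewrite ler_wpM2l// mulr_ge0//; have := A_ge; lra.
Qed.

Let d r : R := fM r / (M r)%:R.

Lemma b_part_upper : nm (\sum_(r < k) d r *: \sum_(i < M r) b (n0 r + i)) <=
  4 * A * (2 * A * k%:R / f (k%:R : R)).
Proof.
have A1 := A_ge.
rewrite (eq_bigr (fun r : 'I_k => (4 * A) *: x r)); last first.
  move=> r _; rewrite /x scalerA; congr (_ *: _); rewrite /d /C.
  have := ltn_ord r; move: (val r) => r' rk.
  by field; rewrite !gt_eqF ?M0//; lra.
rewrite -scaler_sumr (nmZ hX) ?ger0_norm ?mulr_ge0//; try lra; last by apply: c00_sum => r _.
by rewrite ler_wpM2l ?x_upper// mulr_ge0//; lra.
Qed.

Lemma a_part_lower : k%:R * c0 / (4 * Num.sqrt (f (k%:R : R))) <=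
  nm (\sum_(r < k) d r *: \sum_(i < M r) a (n0 r + i)).
Proof.
set y := \sum_(r < k) _.
have s16 := sqrtf_ge16 hj kK; set sf := Num.sqrt _ in s16 *.
have cr r : c00 (\sum_(i < M r) a (n0 r + i)) by apply: c00_sum => i _; exact: a_c00.
have cy : c00 y by apply: c00_sum => r _; apply: c00Z.
pose u := sf^-1 *: \sum_(r < k) z r.
have su : special_functional j sigma (apx N) k u.
  exists z; split=> //; split.
  - by move=> r rk; have [_ []] := zcoded rk.
  - exact: coded_successive zcoded.
  - by have [_ []] := zcoded k0.
  - by move=> r rk; have [_ []] := zcoded rk.
apply: le_trans (nm_special hX cy kK su); apply: le_trans (ler_norm _).
rewrite pairingZl// pairing_suml//.
have term (r : 'I_k) : c0 / 4 <= pairing (z r) y.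
  rewrite /y pairing_sumr; last by move=> r1 _; exact: c00Z.
  rewrite (bigD1 r)//= [X in _ + X]big1 ?addr0; last first.
    move=> r' rr; rewrite (@pairingE _ _ _ 0%N) ?big_ord0// => c _.
    have [->|zc] := eqVneq (z r c) 0; first by rewrite mul0r.
    rewrite scalrfctE sumfE big1 ?scaler0 ?mulr0// => e _.
    apply/eqP/negPn/negP => /a_supp/andP[e1 e2].
    have [_ _ [_ /(_ c zc)[_ /andP[h1 h2]]] _ _] := zcoded (ltn_ord r).
    have qm := q_mono q_inc.
    case: (ltngtP r' r) => [h|h|/val_inj h]; last by rewrite h eqxx in rr.
      have := coded_ord zcoded h (ltn_ord r) => h'.
      have : (q (n0 r' + e).+1 <= q (n0 r))%N.
        by apply: qm; apply: leq_trans h'; rewrite -addnS leq_add2l.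
      by move=> /(leq_trans e2)/leq_trans/(_ h1); rewrite ltnn.
    have := coded_ord zcoded h (ltn_ord r') => h'.
    have : (q (n0 r + M r) <= q (n0 r' + e))%N.
      by apply: qm; apply: leq_trans h' _; exact: leq_addr.
    by move=> /(leq_trans h2)/leq_trans/(_ e1); rewrite ltnn.
  rewrite pairingZr; last exact: cr.
  rewrite pairing_sumr; last by move=> e _; exact: a_c00.
  have [_ _ _ h _] := zcoded (ltn_ord r).
  have rk := ltn_ord r; have h1 := M0 rk; have h2 := fM0 rk.
  apply: (@le_trans _ _ (d r * \sum_(e < M r) c0 / (4 * fM r))).
    rewrite sumr_const card_ord -[X in d r * X]mulr_natr /d le_eqVlt; apply/orP; left; apply/eqP.
    by field; rewrite !gt_eqF.
  apply: ler_wpM2l; first by apply: divr_ge0; exact: ltW.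
  by apply: ler_sum => e _; exact: h.
apply: (@le_trans _ _ (sf^-1 * \sum_(r < k) c0 / 4)).
  rewrite sumr_const card_ord -[X in sf^-1 * X]mulr_natr le_eqVlt; apply/orP; left; apply/eqP.
  by field; rewrite gt_eqF//; lra.
by rewrite ler_wpM2l ?invr_ge0//; [lra|apply: ler_sum => r _; exact: term].
Qed.

End FixedK.

(** The special functional carried by the wrong parts gives the combination of the
    a n a norm of order k / sqrt (f k). To the special functionals of length k the
    right parts are nearly invisible ([special_match]), and the combination of the
    b n has a norm of order k / f k only. *)
Theorem a_dominates_b (eps : R) n1 : 0 < eps -> exists (c : nat -> R) (N : nat),
  [/\ forall n, (n < n1)%N -> c n = 0,
      0 < nm (\sum_(n < N) c n *: a n) &
      nm (\sum_(n < N) c n *: b n) <= eps * nm (\sum_(n < N) c n *: a n)].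
Proof.
move=> e0; have A1 : 100 <= A by rewrite /A lerDl f_ge0//; have := S0_ge; lra.
pose T := 32 * A ^+ 2 / (c0 * eps).
have T0 : 0 <= T.
  apply: divr_ge0; last by apply: mulr_ge0; exact: ltW.
  by apply: mulr_ge0 => //; exact: sqr_ge0.
pose n2 := maxn (Num.bound (S0 ^+ 2)) (2 ^ Num.bound (T ^+ 2)).
have [k kK kn] := exists_K hj n2.
have kS : S0 ^+ 2 <= k%:R.
  apply/ltW/(lt_le_trans (archi_boundP (sqr_ge0 S0))).
  by rewrite ler_nat (leq_trans _ kn)// leq_maxl.
have kf : T <= Num.sqrt (f (k%:R : R)).
  rewrite -[leLHS]ger0_norm// -sqrtr_sqr ler_wsqrtr//.
  apply/ltW/(lt_le_trans (archi_boundP (sqr_ge0 T))); apply: f_ge_pow.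
  by rewrite (leq_trans _ kn)// leq_maxr.
have k0 : (0 < k)%N by exact: Jset_gt0 hj _ (KJ kK).
have [n0 [z [N zg]]] := special_sequence hj hsigma hX q_inc a_c00 a_supp ab_disj c0_gt0 a_ge
  (fun n => 2 ^ (20 * (k * q n) ^ 2))%N n1 k0.
have hb := b_part_upper kK kS zg; have ha := a_part_lower kK zg.
have n1n0 r : (r < k)%N -> (n1 <= n0 r)%N by move=> rk; have [[]] := zg r rk.
have [c [N' [c0' cE]]] := coef_reindex (code_index j sigma z k)
  (fun r => f ((code_index j sigma z k r)%:R : R) / (code_index j sigma z k r)%:R) n1n0.
exists c, N'; rewrite !cE.
have s16 := sqrtf_ge16 hj kK.
have s0 : 0 < Num.sqrt (f (k%:R : R)) by lra.
split=> //.
  apply: lt_le_trans ha; rewrite divr_gt0 ?mulr_gt0// ltr0n//.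
apply: (le_trans hb); apply: le_trans (ler_wpM2l (ltW e0) ha).
have fk : f (k%:R : R) = Num.sqrt (f (k%:R : R)) * Num.sqrt (f (k%:R : R)).
  by rewrite -expr2 sqr_sqrtr// ltW// fn_gt0.
rewrite {1}fk; apply: ratio_bound => //; first by lra.
Qed.

End Key.

(** * Finite packages of vectors *)
Section Package.
Variables (R : realType) (j : nat -> nat) (sigma : seq (nat -> R) -> nat).
Variables (X : completeNormedModType R) (iota : (nat -> R) -> X).
Hypothesis hj : admissible R j.
Hypothesis hX : is_completion (gowers_norm j sigma) iota.
Notation apx := (gowers_norm_approx j sigma).
Notation nm := (nm iota).
Notation psum := (psum iota).

Definition extend0 (V : zmodType) n (F : 'I_n -> V) (i : nat) : V := oapp F 0 (insub i).

Lemma extend0E (V : zmodType) n (F : 'I_n -> V) (i : 'I_n) : extend0 F i = F i.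
Proof. by rewrite /extend0 valK. Qed.

Section Combination.
Variables (N : nat) (u : nat -> nat -> R).
Hypothesis u_c00 : forall i, (i < N)%N -> c00 (u i).
Hypothesis u_ord : ordered N u.
Hypothesis u_le1 : forall i, (i < N)%N -> nm (u i) <= 1.

Definition comb (al : 'I_N -> R) : nat -> R := \sum_(x < N) al x *: u x.

Lemma comb_c00 al : c00 (comb al).
Proof. by apply: c00_sum => i _; apply/c00Z/u_c00. Qed.

Lemma comb_le al : nm (comb al) <= \sum_x `|al x|.
Proof.
apply: (le_trans (nm_sum hX _ _)) => [i _|]; first exact/c00Z/u_c00.
apply: ler_sum => i _; rewrite (nmZ hX); last exact: u_c00.
by rewrite ler_piMr ?u_le1.
Qed.

(** The incidences of pieces and blocks beyond the first one for each block are at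
    most l in number ([count_meet]), and each costs at most eps. *)
Lemma comb_psum (al : 'I_N -> R) l E (eps : R) : successive_sets l E -> 0 <= eps ->
  (forall x, `|al x| <= eps) ->
  psum l E (comb al) <= \sum_x `|al x| + eps * l%:R.
Proof.
move=> sE e0 ale; pose h (a : 'I_l) (x : 'I_N) : bool := meets u (E a) x.
have c (x : 'I_N) : c00 (u x) by exact: u_c00.
apply: (@le_trans _ _ (\sum_(a < l) \sum_x `|al x| * (h a x)%:R)).
  apply: ler_sum => a _; rewrite /comb proj_sum.
  apply: (le_trans (nm_sum hX _ _)) => [i _|]; first exact/c00_proj/c00Z.
  apply: ler_sum => x _; rewrite projZ (nmZ hX); last exact: c00_proj.
  rewrite ler_wpM2l//; case: (hitP u (E a) x) => hx; rewrite /h.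
    rewrite (_ : meets _ _ _ = true); last by apply/hitP.
    exact: le_trans (nm_proj hX _ (c x)) (u_le1 (ltn_ord x)).
  rewrite proj_disj ?(nm0 hX)// => i Ei.
  by apply/eqP/negPn/negP => ux; apply: hx; exists i.
rewrite exchange_big /=.
pose I : {set 'I_N} := [set x | [exists a, h a x]]%SET.
pose J x : R := \sum_(a < l) (h a x)%:R.
have J1 x : x \in I -> 1 <= J x.
  rewrite finset.in_set => /existsP[a ha]; rewrite /J (bigD1 a)//= ha lerDl.
  by apply: sumr_ge0.
have J0 x : x \notin I -> J x = 0.
  rewrite finset.in_set => /existsPn ha; rewrite /J big1// => a _.
  by rewrite (negbTE (ha a)).
have cnt : \sum_(x in I) J x <= #|I|%:R + l%:R.
  have := count_meet I u_ord sE; rewrite -(ler_nat R) natrD natr_sum; apply: le_trans.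
  rewrite /J exchange_big /=; apply: ler_sum => a _.
  rewrite -sum1_card natr_sum [leRHS]big_mkcond /= [leLHS]big_mkcond /=.
  apply: ler_sum => x _; rewrite [x \in Imeet _ _ _]finset.in_set; case: ifP => //= xI.
    by rewrite /h; case: (meets _ _ _).
rewrite (eq_bigr (fun x : 'I_N => `|al x| * J x)); last by move=> x _; rewrite mulr_sumr.
rewrite (bigID (mem I)) /= [X in _ + X]big1 ?addr0; last by move=> x /J0 ->; rewrite mulr0.
apply: (@le_trans _ _ (\sum_(x in I) (`|al x| + eps * (J x - 1)))).
  apply: ler_sum => x xI; rewrite -[J x in leLHS](subrK 1) mulrDr mulr1 addrC lerD2l.
  by rewrite ler_wpM2r// subr_ge0 J1.
rewrite big_split /= -mulr_sumr; apply: lerD.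
  by rewrite [leRHS](bigID (mem I)) /= lerDl sumr_ge0.
rewrite ler_wpM2l// sumrB sumr_const; have := cnt; lra.
Qed.

End Combination.

(** The array of [design] is transported to a block basis of type l1. For the last
    clause, consider the common part of the two halves of the array: its
    restriction to Z or to the complement of Z is large, and either restriction is
    dominated by an average over the vectors of the corresponding sign. *)
Theorem package (eps : R) (L Q : nat) : 0 < eps ->
  exists (K Q' : nat) (lam : nat -> bool) (w : nat -> nat -> R),
  [/\ (Q < Q')%N,
      forall k, (k < K)%N -> [/\ c00 (w k), nm (w k) <= 1 &
        forall i, supp (w k) i -> (Q <= i < Q')%N],
      forall k l E, (k < K)%N -> (l <= L)%N -> successive_sets l E -> psum l E (w k) <= 2,
      forall c : nat -> R, exists g : nat -> R, (forall i, `|g i| <= 1) /\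
        nm ((\sum_(k < K) (sign_of R (lam k) * c k) *: w k) -
            (fun i => g i * (\sum_(k < K) c k *: w k) i)) <=
        eps * nm (\sum_(k < K) c k *: w k) &
      forall Z : set nat, exists k, (k < K)%N /\
        16^-1 <= nm (proj (if lam k then Z else ~` Z) (w k))].
Proof.
(* eps / 2 compensates the constant 1/2 of james, 1 / (L + 1) serves for psum *)
move=> e0; pose eps1 := Num.min (eps / 2) (L.+1%:R^-1).
have e1 : 0 < eps1 by rewrite lt_min divr_gt0// invr_gt0 ltr0n.
have [K [N [K' [P [al [[K'0 KP KnP] al1 ale hg hm]]]]]] := design e1.
have N0 : (0 < N)%N.
  case: N al al1 {ale hg hm} => // al al1.
  have : (0 < #|[pred k | P k]|)%N by rewrite KP.
  case/card_gt0P => k _; have := al1 k; rewrite big_ord0 => /eqP.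
  by rewrite eq_sym oner_eq0.
have [u [uc uo uQ u1 ulow]] := james hj hX Q N0.
have ulow' (a : 'I_N -> R) : 2^-1 * \sum_x `|a x| <= nm (comb u a).
  have := ulow (extend0 a); rewrite /comb.
  by under eq_bigr do rewrite extend0E; under [X in _ <= nm X]eq_bigr do rewrite extend0E.
have uc' (x : 'I_N) : c00 (u x) by exact: uc.
have [Q1 hQ1] : exists Q1, forall (x : 'I_N) i, supp (u x) i -> (i < Q1)%N.
  have /choice[B hB] : forall x : 'I_N, exists B, forall i, (B <= i)%N -> u x i = 0.
    by move=> x; apply/c00P.
  exists (\max_x B x) => x i ux; rewrite ltnNge; apply/negP => h.
  move/eqP: ux; apply; apply: hB; apply: leq_trans h; exact: leq_bigmax.
pose w := extend0 (fun k : 'I_K => comb u (al k)).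
have wE (k : 'I_K) : w k = comb u (al k) by rewrite /w extend0E.
have lift (k : nat) : (k < K)%N -> exists k' : 'I_K, k = k' by move=> h; exists (Ordinal h).
exists K, (maxn Q.+1 Q1), (fun k => if insub k is Some k' then P k' else true), w.
have PE (k : 'I_K) : (if insub (k : nat) is Some k' then P k' else true) = P k by rewrite valK.
have sumw (d : 'I_K -> R) : \sum_k d k *: w k = comb u (fun x => \sum_k d k * al k x).
  under eq_bigr do rewrite wE /comb scaler_sumr.
  rewrite exchange_big /comb; apply: eq_bigr => x _.
  by rewrite scaler_suml; apply: eq_bigr => k _; rewrite scalerA.
split.
- exact: leq_maxl.
- move=> _ /lift[k ->]; rewrite wE; split; first exact: comb_c00.
    by apply: (le_trans (comb_le uc u1 _)); rewrite al1.
  move=> i; rewrite /supp /comb /= sumfE => h.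
  have [x ux] : exists x : 'I_N, supp (u x) i.
    apply: contrapT => /forallNP h'; move/eqP: h; apply; apply: big1 => x _.
    rewrite scalrfctE (_ : u x i = 0) ?scaler0//.
    by apply/eqP/negPn/negP; exact: h'.
  by rewrite (uQ _ _ (ltn_ord x) ux) leq_max (hQ1 _ _ ux) orbT.
- move=> _ l E /lift[k ->] lL sE; rewrite wE.
  apply: (le_trans (comb_psum uc uo u1 sE (ltW e1) (ale k))).
  rewrite al1; suff : eps1 * l%:R <= 1 by lra.
  apply: (@le_trans _ _ (L.+1%:R^-1 * l%:R)).
    by rewrite ler_wpM2r// ge_min lexx orbT.
  by rewrite ler_pdivrMl ?ltr0n// mulr1 ler_nat leqW.
- move=> c; have [g [g1 hgc]] := hg (fun k : 'I_K => c k).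
  pose G i : R := \sum_(x < N) g x * (u x i != 0)%:R.
  have one i := @ordered_one R N u i N0 uo.
  have Gx (x : 'I_N) i : u x i != 0 -> G i = g x.
    move=> ux; have [l hl] := one i; rewrite /G (bigD1 x)//= ux mulr1 big1 ?addr0// => y yx.
    have xl : x = l by apply/eqP/negPn/negP => /hl/eqP; rewrite (negbTE ux).
    by rewrite hl ?eqxx ?mulr0// -xl.
  exists G; split.
    move=> i; have [l hl] := one i; rewrite /G (bigD1 l)//= big1 ?addr0 => [|y yl].
      by rewrite normrM g1 mul1r; case: (_ != _); rewrite ?normr1 ?normr0.
    by rewrite hl// eqxx mulr0.
  under eq_bigr do rewrite PE.
  rewrite !sumw; set be := fun x : 'I_N => \sum_(k < K) c k * al k x.
  have -> : comb u (fun x => \sum_(k < K) sign_of R (P k) * c k * al k x) -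
        (fun i => G i * comb u be i) =
      comb u (fun x => \sum_(k < K) sign_of R (P k) * (c k * al k x) - g x * be x).
    apply/funext => i; rewrite /comb [LHS]/GRing.add /= /GRing.opp /= !sumfE mulr_sumr -sumrB.
    apply: eq_bigr => x _; rewrite !scalrfctE.
    have [->|ux] := eqVneq (u x i) 0; first by rewrite !scaler0 mulr0 subr0.
    rewrite (Gx x i ux) scalerBl; congr (_ *: _ - _).
      by apply: eq_bigr => k _; rewrite mulrA.
    by rewrite /GRing.scale /= mulrA.
  apply: (le_trans (comb_le uc u1 _)); apply: (le_trans hgc).
  apply: (@le_trans _ _ (eps / 2 * \sum_x `|be x|)).
    by rewrite ler_wpM2r ?sumr_ge0// ge_min lexx.
  by rewrite -mulrA ler_wpM2l ?(ltW e0).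
move=> Z; pose avg (b : bool) x : R := K'%:R^-1 * \sum_(k | P k == b) `|al k x|.
pose m x : R := Num.min (avg true x) (avg false x).
have K'R : (0 : R) < K'%:R by rewrite ltr0n.
have avg0 b x : 0 <= avg b x by rewrite mulr_ge0 ?invr_ge0 ?sumr_ge0// ltW.
have m0 x : 0 <= m x by rewrite le_min !avg0.
have cm : c00 (comb u m) by exact: comb_c00.
have m8 : 1 / 8 <= nm (comb u m).
  apply: le_trans (ulow' m); apply: (@le_trans _ _ (2^-1 * (1 / 4))); first by lra.
  rewrite ler_wpM2l//; apply: (le_trans hm); apply: ler_sum => x _.
  rewrite ger0_norm// /m /avg; rewrite le_eqVlt; apply/orP; left; apply/eqP.
  by congr (Num.min (_ * _) (_ * _)); apply: eq_bigl => k; case: (P k).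
have cB b : #|[pred k | P k == b]| = K'.
  by case: b; [rewrite -KP|rewrite -KnP]; apply: eq_card => k; rewrite !inE; case: (P k).
have main (b : bool) (Y : set nat) : 16^-1 <= nm (proj Y (comb u m)) ->
    exists k : 'I_K, P k == b /\ 16^-1 <= nm (proj Y (w k)).
  move=> h; apply: contrapT => /forallNP hn.
  have lt k : P k == b -> nm (proj Y (w k)) < 16^-1.
    by move=> Pk; rewrite ltNge; apply/negP => h'; apply: (hn k).
  move: h; apply/negP; rewrite -ltNge.
  have cw (k : 'I_K) : c00 (proj Y (w k)) by apply: c00_proj; rewrite wE; exact: comb_c00.
  have cv (k : 'I_K) : c00 (vabs (proj Y (w k))).
    by apply: c00_le (cw k) => i; rewrite /vabs normr_id.
  have nv (k : 'I_K) : nm (vabs (proj Y (w k))) = nm (proj Y (w k)).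
    apply/le_anti/andP; split; apply: (nm_abs hX) => // i; rewrite /vabs normr_id//.
  apply: (@le_lt_trans _ _ (nm (K'%:R^-1 *: \sum_(k | P k == b) vabs (proj Y (w k))))).
    apply: (nm_abs hX); last by apply/c00Z/c00_sum => k _.
    move=> i; rewrite scalrfctE sumfE [in leRHS]ger0_norm; last first.
      by rewrite /GRing.scale /= mulr_ge0 ?invr_ge0 ?(ltW K'R)// sumr_ge0// => k _; rewrite /vabs.
    rewrite /proj; case: ifP => iY; last first.
      rewrite normr0 /GRing.scale /= mulr_ge0 ?invr_ge0 ?(ltW K'R)//.
      by apply: sumr_ge0 => k _; rewrite /vabs.
    have [l hl] := @ordered_one R N u i N0 uo.
    have onel (d : 'I_N -> R) : comb u d i = d l * u l i.
      rewrite /comb sumfE (bigD1 l)//= big1 ?addr0 ?scalrfctE// => x xl.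
      by rewrite scalrfctE hl ?scaler0.
    rewrite onel normrM ger0_norm//.
    apply: (@le_trans _ _ (avg b l * `|u l i|)).
      by rewrite ler_wpM2r//; case: (b); rewrite ge_min lexx ?orbT.
    rewrite /avg -mulrA; apply: ler_wpM2l; first by rewrite invr_ge0 ltW.
    rewrite mulr_suml; apply: ler_sum => k _; rewrite /vabs /proj iY wE onel normrM.
    by [].
  rewrite (nmZ hX); last by apply: c00_sum => k _.
  rewrite ger0_norm ?invr_ge0 ?(ltW K'R)// ltr_pdivrMl//.
  apply: (le_lt_trans (nm_sum hX _ _)) => [k _//|].
  rewrite -(cB b) -sum1_card natr_sum mulr_suml.
  apply: ltr_sum => [|k Pk]; last by rewrite mul1r nv; exact: lt.
  have : (0 < #|[pred k | P k == b]|)%N by rewrite cB.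
  by case/card_gt0P => k Pk; apply/hasP; exists k; rewrite ?mem_index_enum.
have split_m : nm (comb u m) <= nm (proj Z (comb u m)) + nm (proj (~` Z) (comb u m)).
  have {1}-> : comb u m = proj Z (comb u m) + proj (~` Z) (comb u m).
    apply/funext => i; rewrite /proj [RHS]/GRing.add /= in_setC.
    by case: (i \in Z); rewrite ?addr0 ?add0r.
  by apply: (nmD hX); exact: c00_proj.
have [h|h] := leP 16^-1 (nm (proj Z (comb u m))).
  have [k [/eqP Pk hk]] := main true Z h.
  by exists k; rewrite PE Pk.
have {}h : 16^-1 <= nm (proj (~` Z) (comb u m)) by lra.
have [k [/eqP Pk hk]] := main false (~` Z) h.
by exists k; rewrite PE Pk.
Qed.

End Package.

(** * Bounded operators on closures *)
Section Closure.
Variables (R : realType) (X : normedModType R).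

Lemma closure_normP (A : set X) x :
  closure A x <-> forall e : R, 0 < e -> exists a, A a /\ `|x - a| < e.
Proof.
split=> [cx e e0|h B /nbhs_ballP[e /= e0 eB]].
  have [a [Aa]] := cx _ (nbhsx_ballx x e e0); rewrite -ball_normE /= => xa.
  by exists a.
have [a [Aa xa]] := h e e0; exists a; split=> //; apply: eB.
by rewrite -ball_normE.
Qed.

Lemma closure_subspace (A : set X) : subspace_of A -> subspace_of (closure A).
Proof.
move=> [A0 Al]; split; first exact: subset_closure.
move=> a x y /closure_normP hx /closure_normP hy; apply/closure_normP => e e0.
pose d := e / (2 * (`|a| + 1)).
have a1 : 0 < `|a| + 1 by rewrite ltr_wpDl.
have d0 : 0 < d by rewrite divr_gt0// mulr_gt0.
have [x' [Ax' xx']] := hx d d0; have [y' [Ay' yy']] := hy _ (divr_gt0 e0 (ltr0n R 2)).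
exists (a *: x' + y'); split; first exact: Al.
have -> : a *: x + y - (a *: x' + y') = a *: (x - x') + (y - y').
  by rewrite scalerBr opprD addrACA.
apply: le_lt_trans (ler_normD _ _) _; rewrite normrZ.
have : `|a| * `|x - x'| <= (`|a| + 1) * d.
  by apply: ler_pM => //; [rewrite lerDl|exact: ltW].
have -> : (`|a| + 1) * d = e / 2 by rewrite /d; field; rewrite gt_eqF.
move: (yy'); rewrite [e in _ -> _ -> _ < e](splitr e) => h1 h2.
exact: ler_ltD.
Qed.

End Closure.

Section Extension.
Variables (R : realType) (X : completeNormedModType R).

(** The closure of the graph is again a graph because of the bound, and its domain is
    closed by completeness. *)
Theorem extend_bounded (G : X -> X -> Prop) (C : R) :
  G 0 0 ->
  (forall (a : R) x y x' y', G x y -> G x' y' -> G (a *: x + x') (a *: y + y')) ->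
  (forall x y, G x y -> `|y| <= C * `|x|) ->
  exists T : X -> X,
    [/\ bounded_operator (closure [set x | exists y, G x y]) T &
        forall x y, G x y -> T x = y].
Proof.
move=> G0 Gl GC; pose Dm : set X := [set x | exists y, G x y].
pose cl x y := forall e : R, 0 < e -> exists x' y', [/\ G x' y', `|x - x'| < e & `|y - y'| < e].
pose C1 := `|C| + 1; have C10 : 0 < C1 by rewrite ltr_wpDl.
have GC1 x y : G x y -> `|y| <= C1 * `|x|.
  move=> /GC h; apply: (le_trans h); rewrite ler_wpM2r// /C1.
  by apply: le_trans (ler_norm C) _; rewrite lerDl.
have GB x y x' y' : G x y -> G x' y' -> G (x - x') (y - y').
  move=> g g'; have := Gl (-1) _ _ _ _ g' g.
  by rewrite !scaleN1r ![- _ + _]addrC.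
have clG x y : G x y -> cl x y by move=> g e e0; exists x, y; rewrite !subrr normr0.
have cll a x y x' y' : cl x y -> cl x' y' -> cl (a *: x + x') (a *: y + y').
  move=> h h' e e0; pose d := e / (2 * (`|a| + 1)).
  have a1 : 0 < `|a| + 1 by rewrite ltr_wpDl.
  have d0 : 0 < d by rewrite divr_gt0// mulr_gt0.
  have [x1 [y1 [g1 hx1 hy1]]] := h d d0.
  have [x2 [y2 [g2 hx2 hy2]]] := h' _ (divr_gt0 e0 (ltr0n R 2)).
  have key (u v u1 v1 : X) : `|u - u1| < d -> `|v - v1| < e / 2 ->
      `|a *: u + v - (a *: u1 + v1)| < e.
    move=> hu hv; have -> : a *: u + v - (a *: u1 + v1) = a *: (u - u1) + (v - v1).
      by rewrite scalerBr opprD addrACA.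
    apply: le_lt_trans (ler_normD _ _) _; rewrite normrZ.
    have : `|a| * `|u - u1| <= (`|a| + 1) * d.
      by apply: ler_pM => //; [rewrite lerDl|exact: ltW].
    have -> : (`|a| + 1) * d = e / 2 by rewrite /d; field; rewrite gt_eqF.
    move: hv; rewrite [e in _ -> _ -> _ < e](splitr e) => h1 h2.
    exact: ler_ltD.
  by exists (a *: x1 + x2), (a *: y1 + y2); split; [exact: Gl|exact: key|exact: key].
have clC x y : cl x y -> `|y| <= C1 * `|x|.
  move=> h; apply/ler_addgt0Pr => e e0.
  have e1 : 0 < e / (1 + C1) by rewrite divr_gt0// addr_gt0.
  have [x1 [y1 [/GC1 g1 hx1 hy1]]] := h _ e1.
  have h1 : `|y| <= `|y1| + `|y - y1| by rewrite addrC -{1}(subrK y1 y) ler_normD.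
  have h2 : `|x1| <= `|x| + `|x - x1| by rewrite (distrC x x1) addrC -{1}(subrK x x1) ler_normD.
  have h3 : C1 * `|x1| <= C1 * `|x| + C1 * (e / (1 + C1)).
    rewrite -mulrDr ler_wpM2l ?(ltW C10)//; apply: (le_trans h2).
    by rewrite lerD2l ltW.
  have h4 : C1 * (e / (1 + C1)) + e / (1 + C1) = e by field; rewrite gt_eqF// addr_gt0.
  lra.
have clu x y y' : cl x y -> cl x y' -> y = y'.
  move=> h h'; have := cll (-1) _ _ _ _ h h' => /clC.
  by rewrite !scaleN1r addNr normr0 mulr0 normr_le0 addrC subr_eq0 => /eqP.
have clex x : closure Dm x -> exists y, cl x y.
  move=> /closure_normP hx.
  have pos n : (0 : R) < n.+1%:R^-1 by rewrite invr_gt0 ltr0n.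
  have /choice[s hs] : forall n, exists p : X * X, G p.1 p.2 /\ `|x - p.1| < n.+1%:R^-1.
    by move=> n; have [x' [[y' g] xx']] := hx _ (pos n); exists (x', y').
  pose t n := (s n).2.
  have tc n m : (n <= m)%N -> `|t n - t m| <= C1 * (2 * n.+1%:R^-1).
    move=> nm; have [g h] := hs n; have [g' h'] := hs m.
    apply: le_trans (GC1 _ _ (GB _ _ _ _ g g')) _; rewrite ler_wpM2l ?(ltW C10)//.
    have -> : (s n).1 - (s m).1 = (x - (s m).1) - (x - (s n).1).
      by rewrite opprB [RHS]addrC addrA subrK.
    apply: (le_trans (ler_normB _ _)); rewrite mulr_natl mulr2n; apply: lerD; last exact: ltW.
    by apply: (le_trans (ltW h')); rewrite lef_pV2 ?posrE ?ltr0n// ler_nat.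
  have small e : 0 < e -> exists n, C1 * (2 * n.+1%:R^-1) < e.
    move=> e0; have e1 : 0 < e / (C1 * 2) by rewrite divr_gt0// mulr_gt0.
    have [n _ /(_ n (leqnn _)) /= hn] := near_infty_natSinv_lt (PosNum e1).
    by exists n; rewrite mulrA mulrC -ltr_pdivlMr// mulr_gt0.
  have tcvg : cvg (t @ \oo).
    apply: cauchy_cvg; apply: cauchy_exP => e e0.
    have [n hn] := small e e0; exists (t n); rewrite /fmapE -ball_normE /ball_.
    exists n => // m /= nm; apply: le_lt_trans hn; exact: tc.
  pose y := lim (t @ \oo); exists y => e e0.
  have [n hn] := small e e0.
  have hty : \forall m \near \oo, `|y - t m| < e by move/cvgrPdist_lt: tcvg; apply.
  have [n1 _ hn1] := hty.
  have [n2 _ hn2] := near_infty_natSinv_lt (PosNum e0).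
  pose m := maxn n1 n2; have [g h] := hs m.
  exists (s m).1, (s m).2; split=> //.
    by apply: (lt_trans h); apply: hn2; exact: leq_maxr.
  by apply: hn1; exact: leq_maxl.
have /choice[T hT] : forall x, exists y, closure Dm x -> cl x y.
  move=> x; have [cx|ncx] := pselect (closure Dm x); last by exists 0.
  by have [y hy] := clex x cx; exists y.
have Dsub : subspace_of (closure Dm).
  apply: closure_subspace; split; first by exists 0.
  by move=> a x x' [y g] [y' g']; exists (a *: y + y'); exact: Gl.
exists T; split.
  split=> [a x y Wx Wy|].
    have [_ Wl] := Dsub.
    exact: clu (hT _ (Wl a x y Wx Wy)) (cll a _ _ _ _ (hT _ Wx) (hT _ Wy)).
  by exists C1 => x Wx; apply/clC/hT.
move=> x y g; apply: (@clu x); last exact: clG.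
by apply: hT; apply: subset_closure; exists y.
Qed.

Lemma bounded_below_iso (V : set X) (S : X -> X) (c : R) :
  subspace_of V -> bounded_operator V S -> (forall x, V x -> `|x| <= c * `|S x|) ->
  isomorphism_onto_image V S.
Proof.
move=> [V0 Vl] bS hc; split=> //; have [Sl _] := bS.
have SB x y : V x -> V y -> S (x - y) = S x - S y.
  by move=> Vx Vy; have := Sl (-1) y x Vy Vx; rewrite !scaleN1r ![- _ + _]addrC.
have Vm x y : V x -> V y -> V (x - y).
  by move=> Vx Vy; have := Vl (-1) y x Vy Vx; rewrite scaleN1r addrC.
have inj x y : V x -> V y -> S x = S y -> x = y.
  move=> Vx Vy e; apply/eqP; rewrite -subr_eq0 -normr_le0.
  by apply: (le_trans (hc _ (Vm _ _ Vx Vy))); rewrite SB// e subrr normr0 mulr0.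
have /choice[U hU] : forall y, exists x, (S @` V) y -> V x /\ S x = y.
  move=> y; have [[x Vx <-]|ny] := pselect ((S @` V) y); first by exists x.
  by exists 0.
exists U; split.
  split=> [a y y' Vy Vy'|]; last first.
    by exists c => y Vy; have [Vx e] := hU y Vy; have := hc _ Vx; rewrite e.
  have [Vx ex] := hU _ Vy; have [Vx' ex'] := hU _ Vy'.
  have im : (S @` V) (a *: y + y').
    by exists (a *: U y + U y'); [exact: Vl|rewrite Sl// ex ex'].
  have [Vx2 ex2] := hU _ im; apply: inj => //; first exact: Vl.
  by rewrite ex2 Sl// ex ex'.
move=> x Vx; have im : (S @` V) (S x) by exists x.
by have [Vx2 ex2] := hU _ im; apply: inj.
Qed.

Lemma independent_infinite (V : set X) (y : nat -> X) :
  (forall i, V (y i)) ->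
  (forall m (d : nat -> R), \sum_(i < m) d i *: y i = 0 -> forall i, (i < m)%N -> d i = 0) ->
  ~ finite_dimensional V.
Proof.
move=> Vy ind [n [v VE]].
have /choice[B hB] : forall i, exists a : 'I_n -> R, \sum_(l < n) a l *: v l = y i.
  by move=> i; have := Vy i; rewrite VE => -[a _ <-]; exists a.
pose M : 'M[R]_(n.+1, n) := \matrix_(i < n.+1, l < n) B i l.
have : kermx M != 0.
  by rewrite kermx_eq0 /row_free neq_ltn (leq_ltn_trans (rank_leq_col M)).
case/rowV0Pn => r /sub_kermxP rM r0.
have [i ri] : exists i, r 0 i != 0.
  apply: contrapT => /forallNP h; move/eqP: r0; apply; apply/rowP => i; rewrite mxE.
  by apply/eqP/negPn/negP; exact: h.
pose d (i : nat) : R := if insub i is Some i' then r 0 i' else 0.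
have dE (i' : 'I_n.+1) : d i' = r 0 i' by rewrite /d valK.
move/eqP: ri; apply; rewrite -dE; apply: (ind n.+1) => //.
under eq_bigr do rewrite -hB scaler_sumr.
rewrite exchange_big /= big1// => l _.
under eq_bigr do rewrite scalerA dE.
rewrite -scaler_suml; have := congr1 (fun A : 'rV_n => A 0 l) rM; rewrite !mxE.
by under eq_bigr do rewrite mxE; move=> ->; rewrite scale0r.
Qed.

End Extension.

Section Density.
Variables (R : realType) (X : normedModType R).

Lemma closure_bounded_below (A W : set X) (S : X -> X) (c : R) :
  subspace_of W -> bounded_operator W S -> closure A `<=` W -> 0 <= c ->
  (forall x, A x -> `|x| <= c * `|S x|) ->
  forall x, closure A x -> `|x| <= c * `|S x|.
Proof.
move=> [_ Wl] [Sl [C SC]] AW c0 hA x Ax; apply/ler_addgt0Pr => e e0.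
pose D := 1 + c * `|C|; have D0 : 0 < D by rewrite ltr_pwDl// mulr_ge0.
have [x' [Ax' xx']] := (closure_normP A x).1 Ax _ (divr_gt0 e0 D0).
have Wx := AW _ Ax; have Wx' := AW _ (subset_closure Ax').
have Wd : W (x' - x) by have := Wl (-1) x x' Wx Wx'; rewrite scaleN1r addrC.
have Sd : S (x' - x) = S x' - S x.
  by have := Sl (-1) x x' Wx Wx'; rewrite !scaleN1r ![- _ + _]addrC.
have h1 : `|x| <= `|x'| + `|x - x'| by rewrite addrC -{1}(subrK x' x) ler_normD.
have h2 : `|S x'| <= `|S x| + `|S x' - S x| by rewrite addrC -{1}(subrK (S x) (S x')) ler_normD.
have h3 : `|S x' - S x| <= `|C| * `|x - x'|.
  rewrite -Sd (distrC x); apply: (le_trans (SC _ Wd)).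
  by rewrite ler_wpM2r// ler_norm.
have h4 : c * `|S x'| <= c * (`|S x| + `|C| * `|x - x'|).
  by rewrite ler_wpM2l//; apply: (le_trans h2); rewrite lerD2l.
have h5 : D * `|x - x'| <= e by rewrite mulrC -ler_pdivlMr// ltW.
have h6 := hA _ Ax'.
apply: (le_trans h1); apply: le_trans (lerD h6 (lexx _)) _.
apply: le_trans (lerD h4 (lexx _)) _.
rewrite mulrDr -addrA lerD2l; apply: le_trans h5.
by rewrite /D mulrDl mul1r mulrA addrC.
Qed.

End Density.

(** * The sign operator *)
Section Sums.
Variable R : realType.

Lemma trunc_sum (V : nmodType) (F : nat -> V) N M : (N <= M)%N ->
  (forall n, (N <= n)%N -> F n = 0) -> \sum_(n < M) F n = \sum_(n < N) F n.
Proof.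
move=> NM F0; rewrite [RHS](big_ord_widen M F NM) [LHS](bigID (fun n : 'I_M => (n < N)%N)) /=.
by rewrite [X in _ + X]big1 ?addr0// => n; rewrite -leqNgt; exact: F0.
Qed.

(** Extending by zero merges combinations of different lengths. The coefficients come
    before the vectors, so they serve for vectors and their images at once. *)
Lemma span_combine (D : lmodType R) (a : R) N (c : nat -> D) N' (c' : nat -> D) :
  exists (e : nat -> D) (M : nat), forall (V : lmodType R) (g : nat -> D -> V),
    (forall n b d d', g n (b *: d + d') = b *: g n d + g n d') ->
    \sum_(n < M) g n (e n) = a *: (\sum_(n < N) g n (c n)) + \sum_(n < N') g n (c' n).
Proof.
pose tr N (c : nat -> D) n := if (n < N)%N then c n else 0.
exists (fun n => a *: tr N c n + tr N' c' n), (maxn N N') => V g gl.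
have g0 n : g n 0 = 0.
  by have := gl n 1 0 0; rewrite !scale1r addr0 => /eqP; rewrite -subr_eq subrr => /eqP <-.
under eq_bigr do rewrite gl; rewrite big_split /= -scaler_sumr.
congr (_ *: _ + _).
  rewrite (@trunc_sum _ (fun n => g n (tr N c n)) N) ?leq_maxl//.
    by apply: eq_bigr => n _; rewrite /tr ltn_ord.
  by move=> n Nn; rewrite /tr ltnNge Nn.
rewrite (@trunc_sum _ (fun n => g n (tr N' c' n)) N') ?leq_maxr//.
  by apply: eq_bigr => n _; rewrite /tr ltn_ord.
by move=> n Nn; rewrite /tr ltnNge Nn.
Qed.

Lemma sum_half N : \sum_(n < N) (2^-1 : R) ^+ n.+1 <= 1.
Proof.
suff -> : \sum_(n < N) (2^-1 : R) ^+ n.+1 = 1 - 2^-1 ^+ N.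
  by rewrite gerBl exprn_ge0// invr_ge0.
elim: N => [|N IH]; first by rewrite big_ord0 expr0 subrr.
by rewrite big_ord_recr /= IH exprS; field.
Qed.

Section Blocks.
Variables (q : nat -> nat) (y : nat -> nat -> R).
Hypothesis q_inc : forall n, (q n < q n.+1)%N.
Hypothesis y_supp : forall n i, supp (y n) i -> (q n <= i < q n.+1)%N.

Lemma blocks_ordered N : ordered N y.
Proof.
move=> n n' nn _ c d /y_supp/andP[_ h] /y_supp/andP[h' _].
by apply: leq_trans h (leq_trans _ h'); exact: q_mono.
Qed.

Lemma blocks_apart n n' i : n != n' -> (q n <= i < q n.+1)%N -> y n' i = 0.
Proof.
move=> nn /andP[h1 h2]; apply/eqP/negPn/negP => /y_supp/andP[h3 h4].
have qm := q_mono q_inc.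
case: (ltngtP n n') => [h|h|h]; last by rewrite h eqxx in nn.
  by have := leq_trans h2 (leq_trans (qm _ _ h) h3); rewrite ltnn.
by have := leq_trans h4 (leq_trans (qm _ _ h) h1); rewrite ltnn.
Qed.

Lemma blocks_proj N n : (n < N)%N ->
  proj [set i | (q n <= i < q n.+1)%N] (\sum_(m < N) y m) = y n.
Proof.
move=> nN; rewrite proj_sum (bigD1 (Ordinal nN))//= proj_id; last by move=> i /y_supp.
rewrite big1 ?addr0// => m mn; apply: proj_disj => i /=; apply: blocks_apart.
by apply: contraNneq mn => e; apply/eqP/val_inj.
Qed.

End Blocks.
End Sums.

Section Packages.
Variables (R : realType) (j : nat -> nat) (sigma : seq (nat -> R) -> nat).
Variables (X : completeNormedModType R) (iota : (nat -> R) -> X).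
Hypothesis hj : admissible R j.
Hypothesis hX : is_completion (gowers_norm j sigma) iota.
Notation nm := (nm iota).
Notation psum := (psum iota).

Theorem packages : exists (q K : nat -> nat) (lam : nat -> nat -> bool) (w : nat -> nat -> nat -> R),
  [/\ forall n, (q n < q n.+1)%N,
      forall n k, (k < K n)%N -> [/\ c00 (w n k), nm (w n k) <= 1 &
        forall i, supp (w n k) i -> (q n <= i < q n.+1)%N],
      forall n k l E, (k < K n)%N -> (l <= 2 ^ ((n * q n) ^ 2))%N ->
        successive_sets l E -> psum l E (w n k) <= 2,
      forall n (c : nat -> R), exists g : nat -> R, (forall i, `|g i| <= 1) /\
        nm ((\sum_(k < K n) (sign_of R (lam n k) * c k) *: w n k) -
            (fun i => g i * (\sum_(k < K n) c k *: w n k) i)) <=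
        2^-1 ^+ n.+1 * nm (\sum_(k < K n) c k *: w n k) &
      forall n (Z : set nat), exists k, (k < K n)%N /\
        16^-1 <= nm (proj (if lam n k then Z else ~` Z) (w n k))].
Proof.
have e0 n : (0 : R) < 2^-1 ^+ n.+1 by rewrite exprn_gt0// invr_gt0.
have pk (p : nat * nat) := package hj hX (2 ^ ((p.1 * p.2) ^ 2)) p.2 (e0 p.1).
have /choice[K hK] := pk; have /choice[Q hQ] := hK; have /choice[lam hlam] := hQ.
have /choice[w hw] := hlam.
pose q := fix q n := if n is n'.+1 then Q (n', q n') else 0%N.
exists q, (fun n => K (n, q n)), (fun n => lam (n, q n)), (fun n => w (n, q n)).
split=> n; have [h1 h2 h3 h4 h5] := hw (n, q n); [exact: h1|exact: h2|exact: h3|exact: h4|exact: h5].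
Qed.

End Packages.

Section Operators.
Variables (R : realType) (j : nat -> nat) (sigma : seq (nat -> R) -> nat).
Variables (X : completeNormedModType R) (iota : (nat -> R) -> X).
Hypothesis hj : admissible R j.
Hypothesis hsigma : coding_function j sigma.
Hypothesis hX : is_completion (gowers_norm j sigma) iota.
Notation nm := (nm iota).
Notation psum := (psum iota).

Lemma diagonal_c00 (D : X -> X) (la : nat -> R) (x : nat -> R) :
  bounded_operator [set: X] D ->
  (forall i, D (iota (unit_vec R i)) = la i *: iota (unit_vec R i)) ->
  c00 x -> D (iota x) = iota (fun i => la i * x i).
Proof.
move=> [Dl _] Dla /c00P[B xB].
have D0 : D 0 = 0.
  have := Dl 1 0 0 I I; rewrite !scale1r addr0 => /eqP.
  by rewrite -subr_eq subrr => /eqP <-.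
have DD x1 y1 : D (x1 + y1) = D x1 + D y1 by have := Dl 1 x1 y1 I I; rewrite !scale1r.
have DZ a x1 : D (a *: x1) = a *: D x1 by have := Dl a x1 0 I I; rewrite !addr0 D0 addr0.
have exp (v : nat -> R) : (forall i, (B <= i)%N -> v i = 0) ->
    v = \sum_(i < B) v i *: unit_vec R i.
  move=> vB; apply/funext => i; rewrite sumfE.
  under eq_bigr do rewrite scalrfctE /unit_vec.
  have [iB|Bi] := ltnP i B; last first.
    rewrite vB// big1// => l _; rewrite (_ : (i == l) = false) ?scaler0//.
    by apply/negbTE; rewrite neq_ltn (leq_trans (ltn_ord l) Bi) orbT.
  rewrite (bigD1 (Ordinal iB))//= eqxx big1 ?addr0.
    by rewrite /GRing.scale /= mulr1.
  move=> l li; rewrite (_ : (i == l) = false) ?scaler0//.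
  by apply: contraNF li => /eqP e; apply/eqP/val_inj.
rewrite {1}(exp x xB) [in RHS](exp (fun i => la i * x i)); last by move=> i /xB ->; rewrite mulr0.
rewrite !(iota_sum hX); try by move=> i _; apply/c00Z/c00_unit.
rewrite (big_morph D DD D0); apply: eq_bigr => i _.
rewrite !(iotaZ hX); try exact: c00_unit.
by rewrite DZ Dla scalerA mulrC.
Qed.

Variables (q K : nat -> nat) (lam : nat -> nat -> bool) (w : nat -> nat -> nat -> R).
Hypothesis q_inc : forall n, (q n < q n.+1)%N.
Hypothesis w_basic : forall n k, (k < K n)%N -> [/\ c00 (w n k), nm (w n k) <= 1 &
        forall i, supp (w n k) i -> (q n <= i < q n.+1)%N].
Hypothesis w_split : forall n k l E, (k < K n)%N -> (l <= 2 ^ ((n * q n) ^ 2))%N ->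
        successive_sets l E -> psum l E (w n k) <= 2.
Hypothesis w_mult : forall n (c : nat -> R), exists g : nat -> R, (forall i, `|g i| <= 1) /\
        nm ((\sum_(k < K n) (sign_of R (lam n k) * c k) *: w n k) -
            (fun i => g i * (\sum_(k < K n) c k *: w n k) i)) <=
        2^-1 ^+ n.+1 * nm (\sum_(k < K n) c k *: w n k).
Hypothesis w_wrong : forall n (Z : set nat), exists k, (k < K n)%N /\
        16^-1 <= nm (proj (if lam n k then Z else ~` Z) (w n k)).

Let wc n (k : 'I_(K n)) : c00 (w n k). Proof. by have [] := w_basic (ltn_ord k). Qed.

Definition vec N (c : nat -> nat -> R) : nat -> R :=
  \sum_(n < N) \sum_(k < K n) c n k *: w n k.
Definition signed_vec N (c : nat -> nat -> R) : nat -> R :=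
  \sum_(n < N) \sum_(k < K n) (sign_of R (lam n k) * c n k) *: w n k.

Lemma c00_vec N c : c00 (vec N c).
Proof. by apply: c00_sum => n _; apply: c00_sum => k _; apply: c00Z. Qed.

Lemma c00_signed_vec N c : c00 (signed_vec N c).
Proof. by apply: c00_sum => n _; apply: c00_sum => k _; apply: c00Z. Qed.

(** On each package the sign change is multiplication by a function of modulus at
    most 1, up to a relative error 2^-(n+1). The products are dominated by the
    vector itself, and the norm is a lattice norm. *)
Lemma signed_vec_le N c : nm (signed_vec N c) <= 2 * nm (vec N c).
Proof.
have [->|N0] := posnP N.
  by rewrite /signed_vec /vec !big_ord0 (nm0 hX) mulr0.
pose y n := \sum_(k < K n) c n k *: w n k.
pose y' n := \sum_(k < K n) (sign_of R (lam n k) * c n k) *: w n k.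
have cy n : c00 (y n) by apply: c00_sum => k _; apply: c00Z.
have cy' n : c00 (y' n) by apply: c00_sum => k _; apply: c00Z.
have ysupp n i : supp (y n) i -> (q n <= i < q n.+1)%N.
  rewrite /supp /y /= sumfE => h; have [k ck] : exists k : 'I_(K n), supp (w n k) i.
    apply: contrapT => /forallNP h'; move/eqP: h; apply; apply: big1 => k _.
    rewrite scalrfctE (_ : w n k i = 0) ?scaler0//.
    by apply/eqP/negPn/negP; exact: h'.
  by have [_ _ h2] := w_basic (ltn_ord k); exact: h2 ck.
have /choice[g hg] : forall n, exists g : nat -> R, (forall i, `|g i| <= 1) /\
    nm (y' n - (fun i => g i * y n i)) <= 2^-1 ^+ n.+1 * nm (y n).
  by move=> n; exact: w_mult.
pose gy n : nat -> R := fun i => g n i * y n i.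
have gyy n i : `|gy n i| <= `|y n i|.
  by rewrite normrM ler_piMl//; have [] := hg n.
have cgy n : c00 (gy n) by apply: c00_le (cy n); exact: gyy.
have cv : c00 (vec N c) := c00_vec N c.
have -> : signed_vec N c = \sum_(n < N) gy n + \sum_(n < N) (y' n - gy n).
  by rewrite -big_split /=; apply: eq_bigr => n _; rewrite addrC subrK.
have ch n : c00 (y' n - gy n).
  by apply: c00D => //; rewrite -scaleN1r; exact: c00Z.
apply: (le_trans (nmD hX _ _)); try by apply: c00_sum => n _.
rewrite mulr_natl mulr2n; apply: lerD.
  apply: (nm_abs hX) => // i.
  apply: (@ordered_sum_abs _ N gy y i N0) => [|n _]; last exact: gyy.
  exact: blocks_ordered.
apply: (le_trans (nm_sum hX _ _)) => [n _//|].
apply: (@le_trans _ _ (\sum_(n < N) 2^-1 ^+ n.+1 * nm (vec N c))).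
  apply: ler_sum => n _; have [_ h] := hg n; apply: (le_trans h).
  rewrite ler_wpM2l ?exprn_ge0 ?invr_ge0//.
  by rewrite -(blocks_proj q_inc ysupp (ltn_ord n)); exact: (nm_proj hX _ cv).
by rewrite -mulr_suml ler_piMl ?(nm_ge0)//; exact: sum_half.
Qed.

Definition signed_graph (x y : X) : Prop := exists N c,
  x = iota (vec N c) /\ y = iota (signed_vec N c).

Lemma signed_operator : exists T : X -> X,
  bounded_operator (closure [set x | exists y, signed_graph x y]) T /\
  forall N c, T (iota (vec N c)) = iota (signed_vec N c).
Proof.
have [||x y [N [c [-> ->]]]|T [bT hT]] := @extend_bounded R X signed_graph 2.
- by exists 0%N, (fun _ _ => 0); rewrite /vec /signed_vec !big_ord0 (iota0 hX).
- move=> a x y x' y' [N [c [-> ->]]] [N' [c' [-> ->]]].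
  have [e [M he]] := @span_combine R (nat -> R) a N c N' c'; exists M, e.
  pose g n (d : nat -> R) := \sum_(k < K n) d k *: w n k.
  pose g' n (d : nat -> R) := \sum_(k < K n) (sign_of R (lam n k) * d k) *: w n k.
  have -> : vec M e = a *: vec N c + vec N' c'.
    apply: (he _ g) => n b d d'; rewrite /g scaler_sumr -big_split /=.
    by apply: eq_bigr => k _; rewrite scalerA -scalerDl.
  have -> : signed_vec M e = a *: signed_vec N c + signed_vec N' c'.
    apply: (he _ g') => n b d d'; rewrite /g' scaler_sumr -big_split /=.
    by apply: eq_bigr => k _; rewrite scalerA -scalerDl mulrDr mulrCA.
  rewrite !(iotaD hX) ?(iotaZ hX)//; do ?[exact: c00_vec|exact: c00_signed_vec|apply: c00Z].
- exact: signed_vec_le.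
by exists T; split=> // N c; apply: hT; exists N, c.
Qed.

(** The scalar 1 is at distance at least 1 from every negative number, and -1 from
    every other one. *)
Lemma wrong_choice (la : nat -> R) : exists (kk : nat -> nat) (Z : nat -> set nat),
  forall n, [/\ (kk n < K n)%N, 16^-1 <= nm (proj (Z n) (w n (kk n))) &
    forall i, Z n i -> 1 <= `|sign_of R (lam n (kk n)) - la i|].
Proof.
pose Z0 : set nat := [set i | la i < 0].
have /choice[kk hk] := fun n => w_wrong n Z0.
exists kk, (fun n => if lam n (kk n) then Z0 else ~` Z0) => n.
have [h1 h2] := hk n; split=> // i; case: (lam n (kk n)); rewrite /Z0 /sign_of /=.
  by move=> h; rewrite ger0_norm; lra.
by move=> /negP; rewrite -leNgt => h; rewrite ler0_norm; lra.
Qed.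

End Operators.

Section Blocks.
Variables (R : realType) (j : nat -> nat) (sigma : seq (nat -> R) -> nat).
Variables (X : completeNormedModType R) (iota : (nat -> R) -> X).
Hypothesis hj : admissible R j.
Hypothesis hX : is_completion (gowers_norm j sigma) iota.
Notation nm := (nm iota).

Variables (a b : nat -> nat -> R) (q : nat -> nat).
Hypothesis q_inc : forall n, (q n < q n.+1)%N.
Hypothesis a_c00 : forall n, c00 (a n).
Hypothesis b_c00 : forall n, c00 (b n).
Hypothesis a_supp : forall n i, supp (a n) i -> (q n <= i < q n.+1)%N.

Definition coef_blocks (m : nat -> nat) (c : nat -> nat -> R) := forall p,
  [/\ (m p < m p.+1)%N, forall n, c p n != 0 -> (m p <= n < m p.+1)%N,
      nm (\sum_(n < m p.+1) c p n *: a n) = 1 &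
      nm (\sum_(n < m p.+1) c p n *: b n) <= 2^-1 ^+ p.+1].

Lemma exists_coef_blocks :
  (forall (eps : R) n1, 0 < eps -> exists (c : nat -> R) (N : nat),
  [/\ forall n, (n < n1)%N -> c n = 0,
      0 < nm (\sum_(n < N) c n *: a n) &
      nm (\sum_(n < N) c n *: b n) <= eps * nm (\sum_(n < N) c n *: a n)]) ->
  exists m c, coef_blocks m c.
Proof.
move=> key.
have /choice[N hN] : forall r : nat * nat, exists N (c : nat -> R), [/\ (r.2 < N)%N,
    forall n, c n != 0 -> (r.2 <= n < N)%N, nm (\sum_(n < N) c n *: a n) = 1 &
    nm (\sum_(n < N) c n *: b n) <= 2^-1 ^+ r.1.+1].
  move=> [p n1] /=; have e0 : (0 : R) < 2^-1 ^+ p.+1 by rewrite exprn_gt0// invr_gt0.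
  have [c [N [c0 ca cb]]] := key _ n1 e0.
  pose t := nm (\sum_(n < N) c n *: a n); have t0 : 0 < t by [].
  pose c' n := if (n < N)%N then t^-1 * c n else 0.
  exists (maxn N n1.+1), c'.
  have sc (g : nat -> nat -> R) : \sum_(n < maxn N n1.+1) c' n *: g n = t^-1 *: \sum_(n < N) c n *: g n.
    rewrite (@trunc_sum _ (fun n => c' n *: g n) N) ?leq_maxl//.
      by rewrite scaler_sumr; apply: eq_bigr => n _; rewrite /c' ltn_ord scalerA.
    by move=> n Nn; rewrite /c' ltnNge Nn scale0r.
  have cs (g : nat -> nat -> R) : (forall n, c00 (g n)) -> c00 (\sum_(n < N) c n *: g n).
    by move=> h; apply: c00_sum => n _; apply: c00Z.
  rewrite !sc !(nmZ hX); try exact: cs.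
  rewrite ger0_norm ?invr_ge0 ?(ltW t0)//; split.
  - exact: leq_maxr.
  - move=> n; rewrite /c'; case: (ltnP n N) => [nN cn|]; last by rewrite eqxx.
    rewrite leq_max nN andbT leqNgt; apply: contraNN cn => /c0 ->.
    by rewrite mulr0.
  - by rewrite mulVf// gt_eqF.
  - by rewrite ler_pdivrMl// mulrC.
have /choice[c hc] := hN.
pose m := fix m p := if p is p'.+1 then N (p', m p') else 0%N.
by exists m, (fun p => c (p, m p)) => p; have := hc (p, m p).
Qed.

Variables (m : nat -> nat) (c : nat -> nat -> R).
Hypothesis mc : coef_blocks m c.

Definition total_coef (d : nat -> R) P n : R := \sum_(p < P) d p * c p n.

Let m_inc p : (m p < m p.+1)%N. Proof. by have [] := mc p. Qed.

Lemma total_sum (V : lmodType R) (g : nat -> V) (d : nat -> R) P :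
  \sum_(p < P) d p *: (\sum_(n < m p.+1) c p n *: g n) = \sum_(n < m P) total_coef d P n *: g n.
Proof.
rewrite [RHS](eq_bigr (fun n : 'I_(m P) => \sum_(p < P) (d p * c p n) *: g n)); last first.
  by move=> n _; rewrite /total_coef scaler_suml.
rewrite exchange_big /=; apply: eq_bigr => p _.
rewrite -(@trunc_sum _ (fun n => c p n *: g n) (m p.+1) (m P)).
- by rewrite scaler_sumr; apply: eq_bigr => n _; rewrite scalerA.
- exact: q_mono m_inc _ _ (ltn_ord p).
- move=> n mn; have [_ h _ _] := mc p; have [->|/h/andP[_]] := eqVneq (c p n) 0; first by rewrite scale0r.
  by rewrite ltnNge mn.
Qed.

Let ya p := \sum_(n < m p.+1) c p n *: a n.
Let yb p := \sum_(n < m p.+1) c p n *: b n.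

Let ya_c00 p : c00 (ya p). Proof. by apply: c00_sum => n _; exact: c00Z. Qed.
Let yb_c00 p : c00 (yb p). Proof. by apply: c00_sum => n _; exact: c00Z. Qed.

Let ya_supp p i : supp (ya p) i -> (q (m p) <= i < q (m p.+1))%N.
Proof.
rewrite /supp /ya /= sumfE => h.
have [n cn] : exists n : 'I_(m p.+1), c p n *: a n i != 0.
  apply: contrapT => /forallNP h'; move/eqP: h; apply; apply: big1 => n _.
  by apply/eqP/negPn/negP; exact: h'.
move: cn; rewrite scaler_eq0 negb_or => /andP[cn an].
have /andP[i1 i2] := a_supp an; have [_ /(_ _ cn)/andP[n1 n2] _ _] := mc p.
apply/andP; split; first by apply: leq_trans i1; exact: q_mono.
by apply: leq_trans i2 _; exact: q_mono.
Qed.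

(** The projection onto the p-th block leaves d p times a vector of norm 1. *)
Lemma coef_le (d : nat -> R) P p : (p < P)%N -> `|d p| <= nm (\sum_(n < m P) total_coef d P n *: a n).
Proof.
move=> pP; have cz r : c00 (d r *: ya r) by exact: c00Z.
have cs : c00 (\sum_(p < P) d p *: ya p) by apply: c00_sum.
have s r i : supp (d r *: ya r) i -> (q (m r) <= i < q (m r.+1))%N.
  by rewrite /supp /= scalrfctE scaler_eq0 negb_or => /andP[_]; exact: ya_supp.
have qm r : (q (m r) < q (m r.+1))%N by apply: leq_trans (q_inc _) _; exact: q_mono.
have := nm_proj hX [set i | (q (m p) <= i < q (m p.+1))%N] cs.
rewrite (blocks_proj qm s pP) (nmZ hX)// -total_sum.
by have [_ _ -> _] := mc p; rewrite mulr1.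
Qed.

(** Every |d p| is dominated by the norm of the wrong part, and the right parts of the
    blocks have summable norms. *)
Lemma b_part_le (d : nat -> R) P : nm (\sum_(n < m P) total_coef d P n *: b n) <=
  nm (\sum_(n < m P) total_coef d P n *: a n).
Proof.
set za := nm (\sum_(n < m P) total_coef d P n *: a n).
rewrite -total_sum; apply: (le_trans (nm_sum hX _ _)) => [p _|]; first exact: c00Z (yb_c00 p).
apply: (@le_trans _ _ (\sum_(p < P) 2^-1 ^+ p.+1 * za)).
  apply: ler_sum => p _; rewrite (nmZ hX _ (yb_c00 p)) mulrC; have [_ _ _ h] := mc p.
  by apply: ler_pM; rewrite ?(nm_ge0)//; exact: coef_le.
by rewrite -mulr_suml; apply: ler_piMl; [exact: nm_ge0|exact: sum_half].
Qed.

End Blocks.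

Theorem corollary2p7 (R : realType) (j : nat -> nat)
    (sigma : seq (nat -> R) -> nat)
    (X : completeNormedModType R) (iota : (nat -> R) -> X)
    (hj : admissible R j) (hsigma : coding_function j sigma)
    (hX : is_completion (gowers_norm j sigma) iota) :
  exists (W : set X) (T : X -> X),
    [/\ subspace_of W, closed W, bounded_operator W T &
        ~ exists (D S : X -> X),
            [/\ diagonal_operator iota D,
                bounded_operator W S,
                strictly_singular W S &
                forall w, W w -> T w = D w + S w]].
Proof.
pose nm := nm iota.
have [q [K [lam [w [q_inc wb wsp wm ww]]]]] := packages hj hX.
have [T [bT hT]] := signed_operator hX q_inc wb wm.
set dom := [set x | _] in bT; pose W := closure dom.
exists W, T.
have sub_dom : subspace_of dom.
  split.
    by exists 0, 0%N, (fun _ _ => 0); rewrite /vec /signed_vec !big_ord0 (iota0 hX).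
  move=> a x x' [_ [N [c [-> _]]]] [_ [N' [c' [-> _]]]].
  have [e [M he]] := @span_combine R (nat -> R) a N c N' c'.
  exists (iota (signed_vec K lam w M e)), M, e; split=> //.
  pose g n (d : nat -> R) := \sum_(k < K n) d k *: w n k.
  have -> : vec K w M e = a *: vec K w N c + vec K w N' c'.
    apply: (he _ g) => n b d d'; rewrite /g scaler_sumr -big_split /=.
    by apply: eq_bigr => k _; rewrite scalerA -scalerDl.
  by rewrite (iotaD hX) ?(iotaZ hX)//; do ?[exact: (c00_vec wb)|apply: c00Z].
have subW : subspace_of W := closure_subspace sub_dom.
split=> //; first exact: closed_closure.
move=> [D [S [[bD [la Dla]] bS ss TDS]]].
have [kk [Z hkk]] := wrong_choice ww la.
pose w' n := w n (kk n); pose s n := sign_of R (lam n (kk n)).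
pose a n := proj (Z n) (w' n); pose b n := proj (~` Z n) (w' n).
have w'_basic n : [/\ c00 (w' n), nm (w' n) <= 1 &
    forall i, supp (w' n) i -> (q n <= i < q n.+1)%N].
  by have [kn _ _] := hkk n; exact: wb.
have cw n : c00 (w' n) by have [] := w'_basic n.
have sw n i : supp (w' n) i -> (q n <= i < q n.+1)%N by have [_ _] := w'_basic n; apply.
have ca n : c00 (a n) by exact: c00_proj.
have cb n : c00 (b n) by exact: c00_proj.
have sa n i : supp (a n) i -> (q n <= i < q n.+1)%N by move=> /supp_proj[_ /sw].
have sb n i : supp (b n) i -> (q n <= i < q n.+1)%N by move=> /supp_proj[_ /sw].
have wab n : w' n = a n + b n.
  apply/funext => i; rewrite /a /b /proj [RHS]/GRing.add /= in_setC.
  by case: (i \in Z n); rewrite ?addr0 ?add0r.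
have ab n n' i : supp (a n) i -> b n' i = 0.
  move=> ai; have [nn|nn] := eqVneq n n'.
    by rewrite -nn /b proj_notin// => nZ; have [Zi _] := supp_proj ai.
  exact: (blocks_apart q_inc sb nn (sa _ _ ai)).
have a16 n : 16^-1 <= nm (a n) by have [] := hkk n.
have b1 n : nm (b n) <= 1.
  by apply: le_trans (nm_proj hX _ (cw n)) _; have [] := w'_basic n.
have bsp n l E : (l <= 2 ^ ((n * q n) ^ 2))%N -> successive_sets l E ->
    psum iota l E (b n) <= 2.
  move=> lL sE; apply: le_trans (psum_proj_le hX l E _ (cw n)) _.
  by have [kn _ _] := hkk n; exact: wsp.
have [S0 S0_ge S0P] := f_vs_power R.
have i16 : (0 : R) < 16^-1 by rewrite invr_gt0.
have key := a_dominates_b hj hsigma hX S0_ge S0P q_inc ca sa ab i16 a16 cb sb b1 bsp.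
have [m [c mc]] := exists_coef_blocks hX ca cb key.
(* y p is the p-th block of the sequence on which S is bounded below *)
pose y p := \sum_(n < m p.+1) c p n *: w' n.
pose za (d : nat -> R) P := nm (\sum_(n < m P) total_coef c d P n *: a n).
have cy p : c00 (y p) by apply: c00_sum => n _; exact: c00Z.
have yE (d : nat -> R) P : \sum_(p < P) d p *: y p = \sum_(n < m P) total_coef c d P n *: w' n.
  exact: (total_sum mc).
pose A := [set x | exists P (d : nat -> R), x = iota (\sum_(p < P) d p *: y p)].
(* the right parts at most double the norm *)
have low (d : nat -> R) P : nm (\sum_(p < P) d p *: y p) <= 2 * za d P.
  rewrite yE; set e := total_coef c d P.
  have -> : \sum_(n < m P) e n *: w' n = \sum_(n < m P) e n *: a n + \sum_(n < m P) e n *: b n.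
    by rewrite -big_split /=; apply: eq_bigr => n _; rewrite wab scalerDr.
  apply: (le_trans (nmD hX _ _)); try by apply: c00_sum => n _; exact: c00Z.
  rewrite mulr_natl mulr2n lerD2l; exact: (b_part_le hX q_inc ca cb sa mc).
(* of each package only the vector of number kk n occurs *)
have selE (d : nat -> R) P : let e := total_coef c d P in let ek n k := e n * (k == kk n)%:R in
    \sum_(p < P) d p *: y p = vec K w (m P) ek /\
    signed_vec K lam w (m P) ek = \sum_(n < m P) (e n * s n) *: w' n.
  move=> e ek; rewrite yE; split; apply: eq_bigr => n _; have [kn _ _] := hkk n.
    rewrite (bigD1 (Ordinal kn))//= /ek eqxx mulr1 big1 ?addr0// => k kne.
    rewrite (_ : (k == kk n :> nat) = false) ?mulr0 ?scale0r//.
    by apply: contraNF kne => /eqP h; apply/eqP/val_inj.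
  rewrite (bigD1 (Ordinal kn))//= /ek eqxx mulr1 big1 ?addr0; first by rewrite mulrC.
  move=> k kne; rewrite (_ : (k == kk n :> nat) = false) ?mulr0 ?scale0r//.
  by apply: contraNF kne => /eqP h; apply/eqP/val_inj.
have Adom : A `<=` dom.
  move=> _ [P [d ->]]; have [-> _] := selE d P.
  by eexists; eexists; eexists; split; reflexivity.
(* S multiplies w' n by s n - la, which has modulus at least 1 on Z n *)
have up (d : nat -> R) P : za d P <= `|S (iota (\sum_(p < P) d p *: y p))|.
  have [e1 e2] := selE d P; set x := \sum_(p < P) _ in e1 *; set e := total_coef c d P in e1 e2.
  have Wx : W (iota x) by apply/subset_closure/Adom; exists P, d.
  have cx : c00 x by apply: c00_sum => p _; exact: c00Z.
  have Sx : S (iota x) = iota (\sum_(n < m P) e n *: (fun i => (s n - la i) * w' n i)).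
    have -> : S (iota x) = T (iota x) - D (iota x) by rewrite TDS// addrC addKr.
    rewrite (diagonal_c00 hX bD Dla cx) {1}e1 hT e2.
    have cl : c00 (fun i => la i * x i).
      apply/c00P; have /c00P[B xB] := cx; exists B => i /xB ->; exact: mulr0.
    have csw : c00 (\sum_(n < m P) (e n * s n) *: w' n) by apply: c00_sum => n _; exact: c00Z.
    rewrite -scaleN1r -(iotaZ hX)// -(iotaD hX)//; last exact: c00Z.
    congr iota; apply/funext => i; rewrite [LHS]/GRing.add /= [in LHS]/GRing.scale /= !sumfE.
    rewrite {1}/x yE sumfE -/e.
    rewrite [X in _ + X](_ : _ = \sum_(n < m P) - (la i * (e n * w' n i))); last first.
      rewrite /GRing.scale /= mulN1r mulr_sumr -sumrN; apply: eq_bigr => n _.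
      by [].
    rewrite -big_split /=; apply: eq_bigr => n _; rewrite !scalrfctE /GRing.scale /=.
    by ring.
  rewrite Sx /za; have [P0|P0] := posnP (m P).
    by rewrite P0 !big_ord0 /nm (nm0 hX).
  pose v n : nat -> R := fun i => (s n - la i) * w' n i.
  have cv n : c00 (v n).
    by apply/c00P; have /c00P[B xB] := cw n; exists B => i /xB; rewrite /v => ->; rewrite mulr0.
  apply: (nm_abs hX); last by apply: c00_sum => n _; apply: c00Z; exact: cv.
  move=> i; apply: (@ordered_sum_abs _ (m P) (fun n => e n *: a n) (fun n => e n *: v n) i P0).
    apply: orderedZ; apply: (blocks_ordered q_inc) => n l; rewrite /supp /v /= mulf_eq0 negb_or.
    by move=> /andP[_]; exact: sw.
  move=> n _; rewrite !scalrfctE !normrZ ler_wpM2l// /a /proj /v.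
  case: ifP => [/set_mem Zi|_]; last by rewrite normr0.
  by rewrite ler_peMl//; have [_ _ h] := hkk n; exact: h.
pose V := closure A.
have subA : subspace_of A.
  split; first by exists 0%N, (fun=> 0); rewrite big_ord0 (iota0 hX).
  move=> t _ _ [P [d ->]] [P' [d' ->]].
  have [e [M he]] := @span_combine R R^o t P d P' d'; exists M, e.
  have -> : \sum_(p < M) e p *: y p = t *: \sum_(p < P) d p *: y p + \sum_(p < P') d' p *: y p.
    apply: (he _ (fun p (x : R^o) => x *: y p)) => n t' x x'.
    by rewrite scalerDl scalerA.
  have cs Q dd : c00 (\sum_(p < Q) dd p *: y p) by apply: c00_sum => p _; exact: c00Z.
  by rewrite (iotaD hX) ?(iotaZ hX)//; exact: c00Z.
have VW : V `<=` W by exact: closureS.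
have subV : subspace_of V := closure_subspace subA.
have bSV : bounded_operator V S.
  have [Sl [C SC]] := bS; split.
    by move=> t x x' Vx Vx'; apply: Sl; exact: VW.
  by exists C => x Vx; apply: SC; exact: VW.
apply: (ss V VW subV (@closed_closure _ _)); last first.
  apply: (bounded_below_iso (c := 2)) => //.
  apply: (closure_bounded_below subW bS VW) => // _ [P [d ->]].
  by apply: (le_trans (low d P)); rewrite ler_wpM2l//; exact: up.
apply: (@independent_infinite R X V (fun p => iota (y p))).
  move=> p; apply: subset_closure; exists p.+1, (fun i => (i == p)%:R).
  rewrite big_ord_recr /= eqxx scale1r big1 ?add0r// => i _.
  by rewrite (ltn_eqF (ltn_ord i)) scale0r.
move=> P d d0 p pP; apply/eqP; rewrite -normr_le0.
apply: le_trans (coef_le hX q_inc ca sa mc d pP) _; apply: (le_trans (up d P)).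
rewrite (iota_sum hX); last by move=> i _; exact: c00Z.
under eq_bigr do rewrite (iotaZ hX)//.
rewrite d0; have [_ [C SC]] := bS; have := SC 0 subW.1.
by rewrite normr0 mulr0.
Qed.
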